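(* Let $P$ be a hybrid program such that the transition relation $\rightarrow_h$ of its set of simplification rules $P^s$ is confluent. Let $\langle L,Q;E;\bar X\rangle$ be a state (with $L$ a multiset of linear and $Q$ a multiset of persistent constraints) that is data-sufficient with respect to $P$. Then \[ \langle L,Q;E;\bar X\rangle\in\mathcal M^{h}(P)\quad\text{if and only if}\quad (L\wedge Q\wedge E)\ \text{is satisfiable within }\mathcal{CP}. \]
   Context: Built-in constraints are formulas of a constraint language containing $=$, $\mathit{true}$, $\mathit{false}$, interpreted in a first-order theory $CT$ whose non-logical axioms are coherent formulas $\forall(C\rightarrow\exists\bar Z.D)$ with $C,D$ conjunctions of built-in constraints. CHR constraints are atoms built from a disjoint set of predicate symbols, which is partitioned into linear and persistent symbols; constraints built from them are called linear resp. persistent. Multisets of constraints are identified with conjunctions; $\mathrm{fv}$ = free variables; $\exists_{-\bar X}\phi$ = existential closure of $\phi$ except $\bar X$. A rule is $r@K\backslash H\Longleftrightarrow G\mid C,B$ ($K$, $H$ multisets of CHR constraints not both empty, $G$, $C$ conjunctions of built-ins, $B$ multiset of CHR constraints), with $\mathrm{lv}(r)=\mathrm{fv}(G,C,B)\setminus\mathrm{fv}(K,H)$; it is a simplification rule if $H\neq\emptyset$, a propagation rule otherwise. A hybrid rule is a rule whose kept head $K$ contains only persistent constraints and whose removed head $H$ contains only linear constraints; a hybrid program is a finite set of hybrid rules; $P^s$ is its subset of simplification rules. Logical reading of a rule: $\forall((K\wedge G)\rightarrow(H\leftrightarrow\exists_{-\mathrm{fv}(K,H)}(G\wedge C\wedge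 B)))$; $\mathcal{CP}$ is $CT$ with the readings of the rules of $P$. States: $\langle S;E;\bar X\rangle$ ($S$ multiset of CHR constraints, $E$ conjunction of built-ins, $\bar X$ set of variables); $\Sigma$ the set of states; $\Sigma_p$ the purely persistent states, i.e. those whose CHR store is a set of persistent constraints. The abstract equivalence $\equiv_a$ is the least equivalence with: (1) $\langle S; Y=t\wedge D; \bar X\rangle\equiv_a\langle S[Y\backslash t]; Y=t\wedge D;\bar X\rangle$; (2) $\langle S; \mathit{false};\bar X\rangle\equiv_a\langle S';\mathit{false};\bar X\rangle$; (3) $\langle S; D;\bar X\rangle\equiv_a\langle S;E;\bar X\rangle$ if $CT\models \exists_{-\mathrm{fv}(S,\bar X)}D\leftrightarrow\exists_{-\mathrm{fv}(S,\bar X)}E$; (4) $\langle S;E;\bar X\rangle\equiv_a\langle S;E;\{Y\}\cup\bar X\rangle$ if $Y\notin\mathrm{fv}(S,E)$. The hybrid equivalence $\equiv_h$ is the smallest equivalence containing $\equiv_a$ with $\langle c,c,S;D;\bar X\rangle\equiv_h\langle c,S;D;\bar X\rangle$ for every persistent constraint $c$. For a program $Q$, $\rightarrow_h$ is the least relation with $\langle K,H,D; G\wedge E;\bar X\rangle\rightarrow_h\langle B,K,D; C\wedge G\wedge E;\bar X\rangle$ whenever $(r@K\backslash H\Longleftrightarrow G\mid C,B)$ is a renamed variant of a rule of $Q$ with $\mathrm{lv}(r)\cap\bar X=\emptyset$, and closed under $\equiv_h$ on both sides; $\rightarrow_h^*$ is the transitive closure of $\rightarrow_h\cup\equiv_h$;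 confluence means $\sigma\rightarrow_h^*\sigma_1$, $\sigma\rightarrow_h^*\sigma_2$ imply a common $\sigma'$ with $\sigma_i\rightarrow_h^*\sigma'$. $[\![\bot]\!]_h$ is the $\equiv_h$-class of $\bot=\langle\emptyset;\mathit{false};\emptyset\rangle$. Operators: $\langle Q\rangle_h(\mathcal X)=\{\sigma\mid\exists\sigma'\in\mathcal X,\ \sigma\rightarrow_h\sigma'\}$ and $[Q]_h(\mathcal X)=\{\sigma\mid\forall\sigma',\ \sigma\rightarrow_h\sigma'\Rightarrow\sigma'\in\mathcal X\}$ (transitions w.r.t. $Q$). The hybrid semantics is $\mathcal M^{h}(P)=\nu\mathcal X.\big([P]_h(\mathcal X)\cap\mu\mathcal Y.(\langle P^s\rangle_h(\mathcal Y)\cup(\Sigma_p\setminus[\![\bot]\!]_h))\big)$. A state $\sigma$ is data-sufficient w.r.t. $P$ if for every $\sigma'$ with $\sigma\rightarrow_h^*\sigma'$ (w.r.t. $P$) there is $\sigma''\in\Sigma_p$ with $\sigma'\rightarrow_h^*\sigma''$ w.r.t. $P^s$.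
   Formalization: Local variables of a fired rule are fresh for the whole remaining state, not only for the global variables; purely persistent stores may contain repetitions; built-in constraints are atomic formulas (and conjunctions of them). Read literally, the claim fails on each point. *)

(* Defs.v *)
From Stdlib Require Import List Permutation Relations FinFun Arith.
From Stdlib Require Fin.
Import ListNotations.

Set Implicit Arguments.

(** Multisets of CHR constraints and conjunctions of built-in constraints are
    lists of atoms; the set of global variables of a state is a finite list of
    variables.  That the order of a store, and the order and repetitions of the
    global variables, are irrelevant is built into the equivalence of states
    ([ea_repr] below). *)

(** ** Syntax *)

Record signature := {
  fsym : Type;
  farity : fsym -> nat;
  bsym : Type;
  barity : bsym -> nat;
  csym : Type;
  carity : csym -> nat;
  persistent_sym : csym -> bool   (* the other CHR symbols are linear *)
}.

Definition var := nat.

Inductive term (Sg : signature) : Type :=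
| Var (x : var)
| App (f : fsym Sg) (a : Fin.t (farity Sg f) -> term Sg).
Arguments Var {Sg} x.
Arguments App {Sg} f a.

(** Built-in constraints are the atomic ones: closing them under disjunction or
    negation would make the restriction to coherent axioms void. *)
Inductive builtin (Sg : signature) : Type :=
| BTrue
| BFalse
| BEq (t u : term Sg)
| BPred (p : bsym Sg) (a : Fin.t (barity Sg p) -> term Sg).
Arguments BTrue {Sg}.
Arguments BFalse {Sg}.
Arguments BEq {Sg} t u.
Arguments BPred {Sg} p a.

Inductive chr (Sg : signature) : Type :=
| Chr (c : csym Sg) (a : Fin.t (carity Sg c) -> term Sg).
Arguments Chr {Sg} c a.

Definition persistent {Sg : signature} (c : chr Sg) : Prop :=
  match c with Chr s _ => persistent_sym Sg s = true end.

Definition linear {Sg : signature} (c : chr Sg) : Prop :=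
  match c with Chr s _ => persistent_sym Sg s = false end.

(** ** Free variables and substitution *)

Fixpoint fv_term {Sg : signature} (t : term Sg) (x : var) : Prop :=
  match t with
  | Var y => x = y
  | App f a => exists i, fv_term (a i) x
  end.

Definition fv_builtin {Sg : signature} (b : builtin Sg) (x : var) : Prop :=
  match b with
  | BTrue | BFalse => False
  | BEq t u => fv_term t x \/ fv_term u x
  | BPred p a => exists i, fv_term (a i) x
  end.

Definition fv_chr {Sg : signature} (c : chr Sg) (x : var) : Prop :=
  match c with Chr s a => exists i, fv_term (a i) x end.

Definition fv_builtins {Sg : signature} (E : list (builtin Sg)) (x : var) : Prop :=
  Exists (fun b => fv_builtin b x) E.

Definition fv_store {Sg : signature} (S : list (chr Sg)) (x : var) : Prop :=
  Exists (fun c => fv_chr c x) S.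

Fixpoint subst_term {Sg : signature} (s : var -> term Sg) (t : term Sg) : term Sg :=
  match t with
  | Var x => s x
  | App f a => App f (fun i => subst_term s (a i))
  end.

Definition subst_builtin {Sg : signature} (s : var -> term Sg) (b : builtin Sg)
  : builtin Sg :=
  match b with
  | BTrue => BTrue
  | BFalse => BFalse
  | BEq t u => BEq (subst_term s t) (subst_term s u)
  | BPred p a => BPred p (fun i => subst_term s (a i))
  end.

Definition subst_chr {Sg : signature} (s : var -> term Sg) (c : chr Sg) : chr Sg :=
  match c with Chr p a => Chr p (fun i => subst_term s (a i)) end.

Definition single {Sg : signature} (y : var) (t : term Sg) : var -> term Sg :=
  fun x => if Nat.eq_dec x y then t else Var x.

Definition renaming {Sg : signature} (rho : var -> var) : var -> term Sg :=
  fun x => Var (rho x).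

(** ** First-order structures *)

(** Equality is a logical symbol, interpreted as identity. *)
Record structure (Sg : signature) := {
  dom : Type;
  dom_inhabited : inhabited dom;
  ifun : forall f : fsym Sg, (Fin.t (farity Sg f) -> dom) -> dom;
  ibuiltin : forall p : bsym Sg, (Fin.t (barity Sg p) -> dom) -> Prop;
  ichr : forall c : csym Sg, (Fin.t (carity Sg c) -> dom) -> Prop
}.

Definition valuation {Sg : signature} (M : structure Sg) := var -> dom M.

Fixpoint eval {Sg : signature} {M : structure Sg} (v : valuation M) (t : term Sg)
  : dom M :=
  match t with
  | Var x => v x
  | App f a => ifun M f (fun i => eval v (a i))
  end.

Definition holds_builtin {Sg : signature} {M : structure Sg} (v : valuation M)
  (b : builtin Sg) : Prop :=
  match b with
  | BTrue => True
  | BFalse => False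
  | BEq t u => eval v t = eval v u
  | BPred p a => ibuiltin M p (fun i => eval v (a i))
  end.

Definition holds_chr {Sg : signature} {M : structure Sg} (v : valuation M)
  (c : chr Sg) : Prop :=
  match c with Chr p a => ichr M p (fun i => eval v (a i)) end.

Definition holds_builtins {Sg : signature} {M : structure Sg} (v : valuation M)
  (E : list (builtin Sg)) : Prop := Forall (holds_builtin v) E.

Definition holds_store {Sg : signature} {M : structure Sg} (v : valuation M)
  (S : list (chr Sg)) : Prop := Forall (holds_chr v) S.

(** [ex_except V phi] is the existential closure of [phi] with the exception
    of the variables in [V]. *)
Definition ex_except {Sg : signature} {M : structure Sg} (V : var -> Prop)
  (phi : valuation M -> Prop) (v : valuation M) : Prop :=
  exists w : valuation M, (forall x, V x -> w x = v x) /\ phi w.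

(** ** Coherent theories *)

Record coherent (Sg : signature) := {
  premise : list (builtin Sg);
  exvars : list var;
  conclusion : list (builtin Sg)
}.

Definition theory (Sg : signature) := coherent Sg -> Prop.

Definition holds_coherent {Sg : signature} (M : structure Sg) (a : coherent Sg)
  : Prop :=
  forall v : valuation M,
    holds_builtins v (premise a) ->
    ex_except (fun x => ~ In x (exvars a))
      (fun w => holds_builtins w (conclusion a)) v.

Definition models_CT {Sg : signature} (CT : theory Sg) (M : structure Sg) : Prop :=
  forall a, CT a -> holds_coherent M a.

(** ** Rules and their logical reading *)

Record rule (Sg : signature) := {
  kept : list (chr Sg);
  removed : list (chr Sg);
  guard : list (builtin Sg);
  body_builtin : list (builtin Sg);
  body_chr : list (chr Sg)
}.

Definition fv_head {Sg : signature} (r : rule Sg) (x : var) : Prop :=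
  fv_store (kept r) x \/ fv_store (removed r) x.

Definition lv {Sg : signature} (r : rule Sg) (x : var) : Prop :=
  (fv_builtins (guard r) x \/ fv_builtins (body_builtin r) x \/
   fv_store (body_chr r) x) /\ ~ fv_head r x.

Definition rename_rule {Sg : signature} (rho : var -> var) (r : rule Sg) : rule Sg := {|
  kept := map (subst_chr (renaming rho)) (kept r);
  removed := map (subst_chr (renaming rho)) (removed r);
  guard := map (subst_builtin (renaming rho)) (guard r);
  body_builtin := map (subst_builtin (renaming rho)) (body_builtin r);
  body_chr := map (subst_chr (renaming rho)) (body_chr r)
|}.

Definition program (Sg : signature) := list (rule Sg).

Definition hybrid_rule {Sg : signature} (r : rule Sg) : Prop :=
  ~ (kept r = [] /\ removed r = []) /\
  Forall persistent (kept r) /\ Forall linear (removed r).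

Definition hybrid_program {Sg : signature} (P : program Sg) : Prop :=
  Forall hybrid_rule P.

Definition is_simplification {Sg : signature} (r : rule Sg) : bool :=
  match removed r with [] => false | _ :: _ => true end.

Definition simplification_rules {Sg : signature} (P : program Sg) : program Sg :=
  filter is_simplification P.

Definition holds_reading {Sg : signature} (M : structure Sg) (r : rule Sg) : Prop :=
  forall v : valuation M,
    holds_store v (kept r) /\ holds_builtins v (guard r) ->
    (holds_store v (removed r) <->
     ex_except (fv_head r)
       (fun w => holds_builtins w (guard r) /\
                 holds_builtins w (body_builtin r) /\
                 holds_store w (body_chr r)) v).

Definition models_CP {Sg : signature} (CT : theory Sg) (P : program Sg)
  (M : structure Sg) : Prop :=
  models_CT CT M /\ forall r, In r P -> holds_reading M r.

Definition satisfiable_CP {Sg : signature} (CT : theory Sg) (P : program Sg)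
  (L Q : list (chr Sg)) (E : list (builtin Sg)) : Prop :=
  exists M : structure Sg, models_CP CT P M /\
    exists v : valuation M,
      holds_store v L /\ holds_store v Q /\ holds_builtins v E.

(** ** States and their equivalences *)

Record state (Sg : signature) := St {
  store : list (chr Sg);
  builtins : list (builtin Sg);
  globals : list var
}.
Arguments St {Sg} store builtins globals.

Definition bot {Sg : signature} : state Sg := St [] [BFalse] [].

Inductive equiv_a_base {Sg : signature} (CT : theory Sg) : relation (state Sg) :=
| ea_repr S S' E X X' :
    Permutation S S' -> (forall x, In x X <-> In x X') ->
    equiv_a_base CT (St S E X) (St S' E X')
| ea_subst S y t D X :
    equiv_a_base CT (St S (BEq (Var y) t :: D) X)
                    (St (map (subst_chr (single y t)) S) (BEq (Var y) t :: D) X)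
| ea_false S S' X :
    equiv_a_base CT (St S [BFalse] X) (St S' [BFalse] X)
| ea_builtin S D E X :
    (forall M : structure Sg, models_CT CT M -> forall v : valuation M,
       ex_except (fun x => fv_store S x \/ In x X)
         (fun w => holds_builtins w D) v <->
       ex_except (fun x => fv_store S x \/ In x X)
         (fun w => holds_builtins w E) v) ->
    equiv_a_base CT (St S D X) (St S E X)
| ea_global S E X y :
    ~ fv_store S y -> ~ fv_builtins E y ->
    equiv_a_base CT (St S E X) (St S E (y :: X)).

Definition equiv_a {Sg : signature} (CT : theory Sg) : relation (state Sg) :=
  clos_refl_sym_trans _ (equiv_a_base CT).

Inductive equiv_h_base {Sg : signature} (CT : theory Sg) : relation (state Sg) :=
| eh_abstract s s' : equiv_a CT s s' -> equiv_h_base CT s s'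
| eh_contract c S D X :
    persistent c -> equiv_h_base CT (St (c :: c :: S) D X) (St (c :: S) D X).

Definition equiv_h {Sg : signature} (CT : theory Sg) : relation (state Sg) :=
  clos_refl_sym_trans _ (equiv_h_base CT).

(** ** Transitions *)

(** The local variables of the renamed rule must be fresh for all of [D], [E]
    and [X]: with freshness for [X] alone, a local variable could be captured
    by a variable quantified existentially in the state, which is unsound for
    the logical reading. *)
Inductive step_h {Sg : signature} (CT : theory Sg) (Q : program Sg)
  : relation (state Sg) :=
| step_rule r0 r rho D E X :
    In r0 Q -> Injective rho -> r = rename_rule rho r0 ->
    (forall x, lv r x -> ~ fv_store D x /\ ~ fv_builtins E x /\ ~ In x X) ->
    step_h CT Q
      (St (kept r ++ removed r ++ D) (guard r ++ E) X)
      (St (body_chr r ++ kept r ++ D) (body_builtin r ++ guard r ++ E) X)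
| step_equiv s s' t t' :
    equiv_h CT s s' -> step_h CT Q s' t' -> equiv_h CT t' t -> step_h CT Q s t.

Definition steps_h {Sg : signature} (CT : theory Sg) (Q : program Sg)
  : relation (state Sg) :=
  clos_trans _ (union _ (step_h CT Q) (equiv_h CT)).

Definition confluent {Sg : signature} (CT : theory Sg) (Q : program Sg) : Prop :=
  forall s s1 s2, steps_h CT Q s s1 -> steps_h CT Q s s2 ->
    exists s', steps_h CT Q s1 s' /\ steps_h CT Q s2 s'.

(** ** Hybrid semantics *)

(** Repetitions are allowed in the store: it is a set of persistent constraints
    up to [equiv_h].  Forbidding them would make the class of consistent purely
    persistent states not invariant under [equiv_h]. *)
Definition purely_persistent {Sg : signature} (s : state Sg) : Prop :=
  Forall persistent (store s).

Definition diamond {Sg : signature} (CT : theory Sg) (Q : program Sg)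
  (A : state Sg -> Prop) (s : state Sg) : Prop :=
  exists s', A s' /\ step_h CT Q s s'.

Definition box {Sg : signature} (CT : theory Sg) (Q : program Sg)
  (A : state Sg -> Prop) (s : state Sg) : Prop :=
  forall s', step_h CT Q s s' -> A s'.

(** Least and greatest fixpoints of a monotone operator on subsets of [T]
    (Knaster-Tarski). *)
Definition mu {T : Type} (F : (T -> Prop) -> (T -> Prop)) (x : T) : Prop :=
  forall A : T -> Prop, (forall y, F A y -> A y) -> A x.

Definition nu {T : Type} (F : (T -> Prop) -> (T -> Prop)) (x : T) : Prop :=
  exists A : T -> Prop, (forall y, A y -> F A y) /\ A x.

Definition hybrid_semantics {Sg : signature} (CT : theory Sg) (P : program Sg)
  : state Sg -> Prop :=
  nu (fun A s =>
    box CT P A s /\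
    mu (fun B s' =>
      diamond CT (simplification_rules P) B s' \/
      (purely_persistent s' /\ ~ equiv_h CT s' bot)) s).

Definition data_sufficient {Sg : signature} (CT : theory Sg) (P : program Sg)
  (s : state Sg) : Prop :=
  forall s', steps_h CT P s s' ->
    exists s'', purely_persistent s'' /\
      steps_h CT (simplification_rules P) s' s''.

(* Main.v *)
Require Import Defs.
From Stdlib Require Import List.
From Stdlib Require Import Permutation Relations FinFun Arith Lia.
From Stdlib Require Fin.
From Stdlib Require Import Classical ClassicalEpsilon FunctionalExtensionality
  PropExtensionality ProofIrrelevance Eqdep.
Import ListNotations.

Set Implicit Arguments.

(** Truth in a structure is invariant under equivalence of states, and in a model of [CP] it is
    preserved by transitions; with data-sufficiency this gives the "if" direction.

    Conversely, let the state be in the semantics.  All states reachable from it are then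
    consistent and normalise to purely persistent ones.  A free model of [CT] and of the
    persistent part is built as a chase: its elements are names for the local variables that
    derivations between purely persistent states introduce, and finitely many of its facts
    always come from a single reachable state.  A multiset of ground linear atoms is declared
    true if ground simplifications rewrite it to the empty multiset, and a linear atom is true
    if it belongs to a true multiset.  This truth goes backward along transitions by definition.
    It goes forward by confluence: by induction on the rewriting, every reduct of a state with
    a true instance again has a true instance, which yields the readings of the simplification
    rules.  Propagation rules hold because the state reached by firing one normalises to a
    purely persistent state, which the chase has added. *)

(** * Substitution and evaluation *)

(** The body of a propagation rule may contain linear constraints, so its immediate result need not
    consist of persistent facts. This is why the chase is closed under whole derivations between
    purely persistent states; as state equivalence is part of a derivation, closure under [CT] and
    under the laws of equality comes with it. Linear atoms cannot be settled one at a time, because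
    a rule may remove several of them jointly. True multisets can be added up, however: atoms that
    belong separately to true multisets also belong to a common one, and this turns truth of
    multisets back into a first-order interpretation. The language has no constants for domain
    elements, so ground atoms are represented by atoms over fresh variables, obtained by adding a
    bound [N], together with a valuation. Derivations are transported into larger states in two
    ways. [plug] keeps the context exactly and moves local variables away from it; [refines] lets
    local variables become arbitrary terms and the global variables change, but loses control of the
    additional built-ins. *)

Lemma fin_bounded (n : nat) (P : Fin.t n -> nat -> Prop) :
  (forall i m m', P i m -> m <= m' -> P i m') ->
  (forall i, exists m, P i m) -> exists m, forall i, P i m.
Proof.
  induction n as [|n IH]; intros mono H.
  - exists 0. intros i. exact (Fin.case0 (fun i => P i 0) i).
  - destruct (H Fin.F1) as [m1 H1].
    destruct (IH (fun i m => P (Fin.FS i) m)) as [m2 H2].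
    + intros i m m'. apply mono.
    + intros i. apply H.
    + exists (m1 + m2). intros i. apply (Fin.caseS' i).
      * apply (mono _ _ _ H1). lia.
      * intros j. apply (mono _ _ _ (H2 j)). lia.
Qed.

Section Substitution.
Context {Sg : signature}.
Implicit Types (t : term Sg) (b : builtin Sg) (c : chr Sg)
  (E : list (builtin Sg)) (S : list (chr Sg)) (s : var -> term Sg).

Definition osubst s s' : var -> term Sg := fun x => subst_term s (s' x).

Lemma subst_term_ext s s' t :
  (forall x, fv_term t x -> s x = s' x) -> subst_term s t = subst_term s' t.
Proof.
  induction t as [x|f a IH]; simpl; intros H.
  - auto.
  - f_equal. apply functional_extensionality. intros i. apply IH. eauto.
Qed.

Lemma subst_builtin_ext s s' b :
  (forall x, fv_builtin b x -> s x = s' x) -> subst_builtin s b = subst_builtin s' b.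
Proof.
  destruct b as [| |t u|p a]; simpl; intros H; f_equal; auto using subst_term_ext.
  apply functional_extensionality. intros i. apply subst_term_ext. eauto.
Qed.

Lemma subst_chr_ext s s' c :
  (forall x, fv_chr c x -> s x = s' x) -> subst_chr s c = subst_chr s' c.
Proof.
  destruct c as [p a]; simpl; intros H; f_equal.
  apply functional_extensionality. intros i. apply subst_term_ext. eauto.
Qed.

Lemma subst_term_comp s s' t :
  subst_term s (subst_term s' t) = subst_term (osubst s s') t.
Proof.
  induction t as [x|f a IH]; simpl; auto.
  f_equal. apply functional_extensionality. auto.
Qed.

Lemma subst_builtin_comp s s' b :
  subst_builtin s (subst_builtin s' b) = subst_builtin (osubst s s') b.
Proof.
  destruct b; simpl; f_equal; auto using subst_term_comp.
  apply functional_extensionality. intros i. apply subst_term_comp.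
Qed.

Lemma subst_chr_comp s s' c :
  subst_chr s (subst_chr s' c) = subst_chr (osubst s s') c.
Proof.
  destruct c; simpl; f_equal.
  apply functional_extensionality. intros i. apply subst_term_comp.
Qed.

Lemma subst_term_var t : subst_term Var t = t.
Proof.
  induction t as [x|f a IH]; simpl; auto.
  f_equal. apply functional_extensionality. auto.
Qed.

Lemma subst_builtin_var b : subst_builtin Var b = b.
Proof.
  destruct b; simpl; f_equal; auto using subst_term_var.
  apply functional_extensionality. intros i. apply subst_term_var.
Qed.

Lemma subst_chr_var c : subst_chr Var c = c.
Proof.
  destruct c; simpl; f_equal.
  apply functional_extensionality. intros i. apply subst_term_var.
Qed.

Lemma fv_subst_term s t y :
  fv_term (subst_term s t) y <-> exists x, fv_term t x /\ fv_term (s x) y.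
Proof.
  induction t as [x|f a IH]; simpl; split.
  - eauto.
  - intros (z & -> & H); auto.
  - intros (i & Hi). apply IH in Hi. destruct Hi as (x & H1 & H2). eauto.
  - intros (x & (i & Hi) & H). exists i. apply IH. eauto.
Qed.

Lemma fv_subst_builtin s b y :
  fv_builtin (subst_builtin s b) y <-> exists x, fv_builtin b x /\ fv_term (s x) y.
Proof.
  destruct b as [| |t u|p a]; simpl; split; try (firstorder; fail).
  - rewrite !fv_subst_term. firstorder.
  - rewrite !fv_subst_term. firstorder.
  - intros (i & Hi). apply fv_subst_term in Hi. firstorder.
  - intros (x & (i & Hi) & H). exists i. apply fv_subst_term. eauto.
Qed.

Lemma fv_subst_chr s c y :
  fv_chr (subst_chr s c) y <-> exists x, fv_chr c x /\ fv_term (s x) y.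
Proof.
  destruct c as [p a]; simpl; split.
  - intros (i & Hi). apply fv_subst_term in Hi. firstorder.
  - intros (x & (i & Hi) & H). exists i. apply fv_subst_term. eauto.
Qed.

Lemma fv_store_in S y : fv_store S y <-> exists c, In c S /\ fv_chr c y.
Proof. unfold fv_store. apply Exists_exists. Qed.

Lemma fv_builtins_in E y : fv_builtins E y <-> exists b, In b E /\ fv_builtin b y.
Proof. unfold fv_builtins. apply Exists_exists. Qed.

Lemma fv_store_app S S' y : fv_store (S ++ S') y <-> fv_store S y \/ fv_store S' y.
Proof. unfold fv_store. apply Exists_app. Qed.

Lemma fv_builtins_app E E' y :
  fv_builtins (E ++ E') y <-> fv_builtins E y \/ fv_builtins E' y.
Proof. unfold fv_builtins. apply Exists_app. Qed.

Lemma fv_builtins_cons b E y :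
  fv_builtins (b :: E) y <-> fv_builtin b y \/ fv_builtins E y.
Proof. unfold fv_builtins. apply Exists_cons. Qed.

Lemma fv_store_cons c S y : fv_store (c :: S) y <-> fv_chr c y \/ fv_store S y.
Proof. unfold fv_store. apply Exists_cons. Qed.

Lemma fv_subst_store s S y :
  fv_store (map (subst_chr s) S) y <-> exists x, fv_store S x /\ fv_term (s x) y.
Proof.
  unfold fv_store. rewrite Exists_map, Exists_exists. split.
  - intros (c & Hc & H). apply fv_subst_chr in H. destruct H as (x & H1 & H2).
    exists x. split; auto. apply Exists_exists. eauto.
  - intros (x & Hx & H). apply Exists_exists in Hx. destruct Hx as (c & Hc & Hx).
    exists c. split; auto. apply fv_subst_chr. eauto.
Qed.

Lemma fv_subst_builtins s E y :
  fv_builtins (map (subst_builtin s) E) y <->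
  exists x, fv_builtins E x /\ fv_term (s x) y.
Proof.
  unfold fv_builtins. rewrite Exists_map, Exists_exists. split.
  - intros (c & Hc & H). apply fv_subst_builtin in H. destruct H as (x & H1 & H2).
    exists x. split; auto. apply Exists_exists. eauto.
  - intros (x & Hx & H). apply Exists_exists in Hx. destruct Hx as (c & Hc & Hx).
    exists c. split; auto. apply fv_subst_builtin. eauto.
Qed.

Lemma subst_store_ext s s' S :
  (forall x, fv_store S x -> s x = s' x) ->
  map (subst_chr s) S = map (subst_chr s') S.
Proof.
  intros H. apply map_ext_in. intros c Hc. apply subst_chr_ext.
  intros x Hx. apply H. apply fv_store_in. eauto.
Qed.

Lemma subst_builtins_ext s s' E :
  (forall x, fv_builtins E x -> s x = s' x) ->
  map (subst_builtin s) E = map (subst_builtin s') E.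
Proof.
  intros H. apply map_ext_in. intros c Hc. apply subst_builtin_ext.
  intros x Hx. apply H. apply fv_builtins_in. eauto.
Qed.

Lemma subst_store_comp s s' S :
  map (subst_chr s) (map (subst_chr s') S) = map (subst_chr (osubst s s')) S.
Proof. rewrite map_map. apply map_ext. apply subst_chr_comp. Qed.

Lemma subst_builtins_comp s s' E :
  map (subst_builtin s) (map (subst_builtin s') E) =
  map (subst_builtin (osubst s s')) E.
Proof. rewrite map_map. apply map_ext. apply subst_builtin_comp. Qed.

Lemma subst_store_var S : map (subst_chr Var) S = S.
Proof. rewrite <- (map_id S) at 2. apply map_ext. apply subst_chr_var. Qed.

Lemma subst_builtins_var E : map (subst_builtin Var) E = E.
Proof. rewrite <- (map_id E) at 2. apply map_ext. apply subst_builtin_var. Qed.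

Lemma persistent_subst s c : persistent (subst_chr s c) <-> persistent c.
Proof. destruct c; simpl; tauto. Qed.

Lemma persistent_subst_store s S :
  Forall persistent (map (subst_chr s) S) <-> Forall persistent S.
Proof.
  rewrite Forall_map. split; apply Forall_impl; intros c; apply persistent_subst.
Qed.

Lemma linear_subst s c : linear (subst_chr s c) <-> linear c.
Proof. destruct c; simpl; tauto. Qed.

Lemma fv_term_bounded t : exists n, forall x, fv_term t x -> x < n.
Proof.
  induction t as [x|f a IH]; simpl.
  - exists (x + 1). intros; subst; lia.
  - destruct (fin_bounded (fun i n => forall x, fv_term (a i) x -> x < n)) as [n Hn].
    + intros i m m' H L x Hx. specialize (H x Hx). lia.
    + exact IH.
    + exists n. intros x (i & Hi). eauto.
Qed.

Lemma fv_builtin_bounded b : exists n, forall x, fv_builtin b x -> x < n.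
Proof.
  destruct b as [| |t u|p a]; simpl.
  - exists 0; tauto.
  - exists 0; tauto.
  - destruct (fv_term_bounded t) as [n Hn], (fv_term_bounded u) as [m Hm].
    exists (n + m). intros x [H|H]; [specialize (Hn _ H)|specialize (Hm _ H)]; lia.
  - destruct (fin_bounded (fun i n => forall x, fv_term (a i) x -> x < n)) as [n Hn].
    + intros i m m' H L x Hx. specialize (H x Hx). lia.
    + intros i. apply fv_term_bounded.
    + exists n. intros x (i & Hi). eauto.
Qed.

Lemma fv_chr_bounded c : exists n, forall x, fv_chr c x -> x < n.
Proof.
  destruct c as [p a]; simpl.
  destruct (fin_bounded (fun i n => forall x, fv_term (a i) x -> x < n)) as [n Hn].
  - intros i m m' H L x Hx. specialize (H x Hx). lia.
  - intros i. apply fv_term_bounded.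
  - exists n. intros x (i & Hi). eauto.
Qed.

Lemma fv_store_bounded S : exists n, forall x, fv_store S x -> x < n.
Proof.
  induction S as [|c S (n & Hn)].
  - exists 0. intros x H. inversion H.
  - destruct (fv_chr_bounded c) as [m Hm]. exists (n + m). intros x H.
    apply fv_store_cons in H. destruct H as [H|H]; [specialize (Hm _ H)|specialize (Hn _ H)]; lia.
Qed.

Lemma fv_builtins_bounded E : exists n, forall x, fv_builtins E x -> x < n.
Proof.
  induction E as [|c S (n & Hn)].
  - exists 0. intros x H. inversion H.
  - destruct (fv_builtin_bounded c) as [m Hm]. exists (n + m). intros x H.
    apply fv_builtins_cons in H. destruct H as [H|H]; [specialize (Hm _ H)|specialize (Hn _ H)]; lia.
Qed.

Lemma globals_bounded (X : list var) : exists n, forall x, In x X -> x < n.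
Proof.
  induction X as [|y X (n & Hn)].
  - exists 0. simpl; tauto.
  - exists (n + y + 1). intros x [->|H]; [|specialize (Hn _ H)]; lia.
Qed.

(** States carry their global variables as a list, so bounded sets of variables have to be listed;
    membership is decided classically. *)
Lemma bounded_list (p : var -> Prop) n :
  (forall x, p x -> x < n) -> exists l, forall x, In x l <-> p x.
Proof.
  intros H. exists (filter (fun x => if excluded_middle_informative (p x) then true else false) (seq 0 n)).
  intros x. rewrite filter_In, in_seq.
  destruct (excluded_middle_informative (p x)); split; try tauto.
  - intros _. split; auto. specialize (H _ p0). lia.
  - intros [_ F]. discriminate.
Qed.

End Substitution.

(** * Evaluation in a structure and ground instances of atoms *)

Section Semantics.
Context {Sg : signature} {M : structure Sg}.
Implicit Types (t : term Sg) (b : builtin Sg) (c : chr Sg)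
  (E : list (builtin Sg)) (S : list (chr Sg)) (s : var -> term Sg) (v : valuation M).

Definition esubst v s : valuation M := fun x => eval v (s x).

(** An atom over the domain of [M]. Truth predicates speak of multisets of these because elements of
    [M] need not be denoted by terms. *)
Definition gatom : Type := {p : csym Sg & Fin.t (carity Sg p) -> dom M}.

Definition ginst v c : gatom :=
  match c with Chr p a => existT _ p (fun i => eval v (a i)) end.

Definition gpers (g : gatom) : Prop := persistent_sym Sg (projT1 g) = true.

Lemma gpers_ginst v c : gpers (ginst v c) <-> persistent c.
Proof. destruct c; unfold gpers; simpl; tauto. Qed.

Lemma eval_ext v v' t :
  (forall x, fv_term t x -> v x = v' x) -> eval v t = eval v' t.
Proof.
  induction t as [x|f a IH]; simpl; intros H.
  - auto.
  - f_equal. apply functional_extensionality. intros i. apply IH. eauto.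
Qed.

Lemma eval_subst v s t : eval v (subst_term s t) = eval (esubst v s) t.
Proof.
  induction t as [x|f a IH]; simpl; auto.
  f_equal. apply functional_extensionality. auto.
Qed.

Lemma holds_builtin_subst v s b :
  holds_builtin v (subst_builtin s b) <-> holds_builtin (esubst v s) b.
Proof.
  destruct b as [| |t u|p a]; simpl; try tauto.
  - rewrite !eval_subst. tauto.
  - replace (fun i => eval v (subst_term s (a i))) with
      (fun i => eval (esubst v s) (a i)); [tauto|].
    apply functional_extensionality. intros i. symmetry. apply eval_subst.
Qed.

Lemma holds_builtin_ext v v' b :
  (forall x, fv_builtin b x -> v x = v' x) -> holds_builtin v b -> holds_builtin v' b.
Proof.
  destruct b as [| |t u|p a]; simpl; intros H; try tauto.
  - rewrite (eval_ext v v' t), (eval_ext v v' u); auto.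
  - replace (fun i => eval v (a i)) with (fun i => eval v' (a i)); [tauto|].
    apply functional_extensionality. intros i. symmetry. apply eval_ext. eauto.
Qed.

Lemma ginst_subst v s c : ginst v (subst_chr s c) = ginst (esubst v s) c.
Proof.
  destruct c as [p a]; simpl. f_equal.
  apply functional_extensionality. intros i. apply eval_subst.
Qed.

Lemma ginst_ext v v' c :
  (forall x, fv_chr c x -> v x = v' x) -> ginst v c = ginst v' c.
Proof.
  destruct c as [p a]; simpl; intros H. f_equal.
  apply functional_extensionality. intros i. apply eval_ext. eauto.
Qed.

Lemma holds_builtins_subst v s E :
  holds_builtins v (map (subst_builtin s) E) <-> holds_builtins (esubst v s) E.
Proof.
  unfold holds_builtins. rewrite Forall_map.
  split; apply Forall_impl; intros b; apply holds_builtin_subst.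
Qed.

Lemma holds_builtins_ext v v' E :
  (forall x, fv_builtins E x -> v x = v' x) -> holds_builtins v E -> holds_builtins v' E.
Proof.
  unfold holds_builtins. rewrite !Forall_forall. intros H H1 b Hb.
  apply (holds_builtin_ext v); auto. intros x Hx. apply H. apply fv_builtins_in. eauto.
Qed.

Lemma holds_builtins_app v E E' :
  holds_builtins v (E ++ E') <-> holds_builtins v E /\ holds_builtins v E'.
Proof. apply Forall_app. Qed.

Lemma holds_builtins_cons v b E :
  holds_builtins v (b :: E) <-> holds_builtin v b /\ holds_builtins v E.
Proof. apply Forall_cons_iff. Qed.

Lemma ginst_store_subst v s S :
  map (ginst v) (map (subst_chr s) S) = map (ginst (esubst v s)) S.
Proof. rewrite map_map. apply map_ext. intros; apply ginst_subst. Qed.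

Lemma ginst_store_ext v v' S :
  (forall x, fv_store S x -> v x = v' x) -> map (ginst v) S = map (ginst v') S.
Proof.
  intros H. apply map_ext_in. intros c Hc. apply ginst_ext.
  intros x Hx. apply H. apply fv_store_in. eauto.
Qed.

Definition gholds (g : gatom) : Prop := ichr M (projT1 g) (projT2 g).

Lemma gholds_ginst v c : gholds (ginst v c) <-> holds_chr v c.
Proof. destruct c; unfold gholds; simpl; tauto. Qed.

Lemma gholds_store v S : Forall gholds (map (ginst v) S) <-> holds_store v S.
Proof.
  unfold holds_store. rewrite Forall_map.
  split; apply Forall_impl; intros c; apply gholds_ginst.
Qed.

End Semantics.
Arguments gatom {Sg} M.
Arguments holds_builtin_ext {Sg M} v v' {b}.
Arguments holds_builtins_ext {Sg M} v v' {E}.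
Arguments subst_store_ext {Sg} s s' S.
Arguments subst_builtins_ext {Sg} s s' E.
Arguments ginst_store_ext {Sg M} v v' S.

(** * Equivalence of states *)

(** The variables from [N] on are a fresh copy of all variables: [x + N] is read by [f], while
    everything below [N] keeps its value under [v]. *)
Definition shift_valuation {D : Type} (N : nat) (v f : var -> D) : var -> D :=
  fun y => if N <=? y then f (y - N) else v y.

Lemma shift_valuation_lt {D : Type} N (v f : var -> D) y :
  y < N -> shift_valuation N v f y = v y.
Proof. intros H. unfold shift_valuation. destruct (Nat.leb_spec N y); auto; lia. Qed.

Lemma shift_valuation_add {D : Type} N (v f : var -> D) y :
  shift_valuation N v f (y + N) = f y.
Proof.
  unfold shift_valuation. destruct (Nat.leb_spec N (y + N)); try lia. f_equal; lia.
Qed.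

Definition shift {Sg : signature} (N : nat) : var -> term Sg := renaming (fun x => x + N).

Lemma fv_head_rename {Sg : signature} rho (r : rule Sg) y :
  fv_head (rename_rule rho r) y <-> exists x, fv_head r x /\ y = rho x.
Proof.
  unfold fv_head. simpl. rewrite !fv_subst_store. unfold renaming. simpl. firstorder.
Qed.

Lemma lv_rename {Sg : signature} rho (r : rule Sg) y : Injective rho ->
  lv (rename_rule rho r) y <-> exists x, lv r x /\ y = rho x.
Proof.
  intros Hi. unfold lv. rewrite fv_head_rename. simpl.
  rewrite fv_subst_store, !fv_subst_builtins. unfold renaming. simpl. split.
  - intros (H & Hn).
    assert (K : exists x, (fv_builtins (guard r) x \/ fv_builtins (body_builtin r) x \/
                     fv_store (body_chr r) x) /\ y = rho x) by firstorder.
    destruct K as (x & Hx & ->). exists x. split; auto. split; auto.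
    intros F. apply Hn. eauto.
  - intros (x & (H & Hn) & ->). split; [firstorder|].
    intros (z & Hz & e). apply Hi in e. subst. auto.
Qed.

Section Equivalence.
Context {Sg : signature} (CT : theory Sg).
Implicit Types (E D : list (builtin Sg)) (S : list (chr Sg)) (s : var -> term Sg)
  (X Y : list var) (st : state Sg).

Definition entails E D : Prop :=
  forall M : structure Sg, models_CT CT M -> forall v : valuation M,
    holds_builtins v E -> holds_builtins v D.

Lemma equiv_h_refl st : equiv_h CT st st.
Proof. apply rst_refl. Qed.

Lemma equiv_h_sym st st' : equiv_h CT st st' -> equiv_h CT st' st.
Proof. apply rst_sym. Qed.

Lemma equiv_h_trans st st' st'' :
  equiv_h CT st st' -> equiv_h CT st' st'' -> equiv_h CT st st''.
Proof. apply rst_trans. Qed.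

Lemma equiv_h_of_a_base st st' : equiv_a_base CT st st' -> equiv_h CT st st'.
Proof. intros H. apply rst_step, eh_abstract, rst_step, H. Qed.

Lemma equiv_h_perm S S' E X : Permutation S S' -> equiv_h CT (St S E X) (St S' E X).
Proof. intros H. apply equiv_h_of_a_base, ea_repr; auto. tauto. Qed.

(** The witness may change the value of any variable outside the store and the globals; this is how
    equations for fresh variables are added and dropped. *)
Lemma equiv_h_builtins S D E X :
  (forall M : structure Sg, models_CT CT M -> forall v : valuation M,
     holds_builtins v D -> exists w, (forall x, fv_store S x \/ In x X -> w x = v x) /\
       holds_builtins w E) ->
  (forall M : structure Sg, models_CT CT M -> forall v : valuation M,
     holds_builtins v E -> exists w, (forall x, fv_store S x \/ In x X -> w x = v x) /\
       holds_builtins w D) ->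
  equiv_h CT (St S D X) (St S E X).
Proof.
  intros H1 H2. apply equiv_h_of_a_base, ea_builtin. intros M HM v.
  split; intros (w & Hw & Hh).
  - destruct (H1 M HM w Hh) as (w' & Hw' & Hh'). exists w'. split; auto.
    intros x Hx. rewrite Hw'; auto.
  - destruct (H2 M HM w Hh) as (w' & Hw' & Hh'). exists w'. split; auto.
    intros x Hx. rewrite Hw'; auto.
Qed.

Lemma equiv_h_entails S D E X :
  entails D E -> entails E D -> equiv_h CT (St S D X) (St S E X).
Proof.
  intros H1 H2. apply equiv_h_builtins; intros M HM v H; exists v; split; auto.
Qed.

Lemma equiv_h_unsat S S' D E X :
  (forall M : structure Sg, models_CT CT M -> forall v : valuation M, ~ holds_builtins v D) ->
  (forall M : structure Sg, models_CT CT M -> forall v : valuation M, ~ holds_builtins v E) ->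
  equiv_h CT (St S D X) (St S' E X).
Proof.
  intros HD HE.
  assert (F : forall (M : structure Sg) (v : valuation M), ~ holds_builtins v [BFalse]).
  { intros M v H. inversion H; subst. auto. }
  apply equiv_h_trans with (St S [BFalse] X).
  { apply equiv_h_entails; intros M HM v H; exfalso; [eapply HD|eapply F]; eauto. }
  apply equiv_h_trans with (St S' [BFalse] X).
  { apply equiv_h_of_a_base, ea_false. }
  apply equiv_h_entails; intros M HM v H; exfalso; [eapply F|eapply HE]; eauto.
Qed.

(** The equations are in solved form: no right-hand side contains a variable to be eliminated, so
    eliminating one variable after the other yields the simultaneous substitution. An entailed
    equation is added to the built-ins, used, and removed again. *)
Lemma solve_subst (ys : list var) s S E X :
  (forall y y', In y ys -> In y' ys -> ~ fv_term (s y) y') ->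
  (forall M : structure Sg, models_CT CT M -> forall v : valuation M,
     holds_builtins v E -> forall y, In y ys -> v y = eval v (s y)) ->
  equiv_h CT (St S E X)
    (St (map (subst_chr (fun x => if in_dec Nat.eq_dec x ys then s x else Var x)) S) E X).
Proof.
  revert S. induction ys as [|y ys IH]; intros S Hs HE.
  - rewrite (subst_store_ext _ Var), subst_store_var; [apply equiv_h_refl|].
    intros x _. destruct (in_dec Nat.eq_dec x []); simpl in *; tauto.
  - assert (K : forall S0, equiv_h CT (St S0 E X) (St S0 (BEq (Var y) (s y) :: E) X)).
    { intros S0. apply equiv_h_entails; intros M HM v H.
      - apply holds_builtins_cons. split; auto. simpl. apply (HE M HM v H). simpl; auto.
      - apply holds_builtins_cons in H. tauto. }
    eapply equiv_h_trans; [apply K|].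
    eapply equiv_h_trans; [apply equiv_h_of_a_base, ea_subst|].
    eapply equiv_h_trans; [apply equiv_h_sym, K|].
    eapply equiv_h_trans; [apply IH|].
    + intros z z' Hz Hz'. apply Hs; simpl; auto.
    + intros M HM v H z Hz. apply (HE M HM v H). simpl; auto.
    + rewrite subst_store_comp.
      erewrite subst_store_ext; [apply equiv_h_refl|].
      intros x _. unfold osubst, single.
      destruct (Nat.eq_dec x y) as [->|n].
      * destruct (in_dec Nat.eq_dec y (y :: ys)) as [_|F]; [|simpl in F; tauto].
        rewrite <- (subst_term_var (s y)) at 2. apply subst_term_ext.
        intros z Hz. destruct (in_dec Nat.eq_dec z ys) as [i|]; auto.
        exfalso. apply (Hs y z); simpl; auto.
      * simpl subst_term.
        destruct (in_dec Nat.eq_dec x ys), (in_dec Nat.eq_dec x (y :: ys));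
          simpl in *; auto; exfalso; intuition congruence.
Qed.

(** Route through fresh variables [x + N], which are equal both to [s x] and to [s' x]:
    [ea_subst] only eliminates variables. *)
Lemma subst_cong S S' E X s s' :
  (forall x, fv_store S x ->
     forall M : structure Sg, models_CT CT M -> forall v : valuation M,
     holds_builtins v E -> eval v (s x) = eval v (s' x)) ->
  equiv_h CT (St (map (subst_chr s) S ++ S') E X)
             (St (map (subst_chr s') S ++ S') E X).
Proof.
  intros HE.
  destruct (fv_store_bounded S) as [n1 B1].
  destruct (bounded_list (fv_store S) B1) as [xs Hxs].
  destruct (fv_store_bounded S') as [n2 B2].
  destruct (fv_builtins_bounded E) as [n3 B3].
  destruct (globals_bounded X) as [n4 B4].
  destruct (fv_store_bounded (map (subst_chr s) S)) as [n5 B5].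
  destruct (fv_store_bounded (map (subst_chr s') S)) as [n6 B6].
  set (N := n2 + n3 + n4 + n5 + n6).
  set (EQ := fun s0 : var -> term Sg => map (fun x => BEq (Var (x + N)) (s0 x)) xs).
  assert (HEQ : forall (M : structure Sg) (v : valuation M) s0,
    holds_builtins v (EQ s0) <-> forall x, In x xs -> v (x + N) = eval v (s0 x)).
  { intros M v s0. unfold EQ, holds_builtins. rewrite Forall_map, Forall_forall. reflexivity. }
  assert (half : forall s0, (forall x, fv_store (map (subst_chr s0) S) x -> x < N) ->
    equiv_h CT (St (map (subst_chr s0) S ++ S') E X)
               (St (map (subst_chr (shift N)) S ++ S') (EQ s0 ++ E) X)).
  { intros s0 Hs0.
    assert (Hs1 : forall x z, In x xs -> fv_term (s0 x) z -> z < N).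
    { intros x z Hx Hz. apply Hs0. apply fv_subst_store. exists x. rewrite <- Hxs. auto. }
    apply equiv_h_trans with (St (map (subst_chr s0) S ++ S') (EQ s0 ++ E) X).
    - apply equiv_h_builtins; intros M HM v Hv.
      + exists (shift_valuation N v (fun x => eval v (s0 x))).
        assert (L : forall x, x < N ->
          shift_valuation N v (fun x => eval v (s0 x)) x = v x)
          by (intros; apply shift_valuation_lt; auto).
        split.
        * intros x [Hx|Hx]; apply L.
          -- apply fv_store_app in Hx. destruct Hx as [Hx|Hx]; auto.
             specialize (B2 _ Hx). lia.
          -- specialize (B4 _ Hx). lia.
        * apply holds_builtins_app. split.
          -- apply HEQ. intros x Hx. rewrite shift_valuation_add.
             apply eval_ext. intros z Hz. symmetry. apply L. eauto.
          -- apply (holds_builtins_ext v); auto. intros x Hx. symmetry. apply L.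
             specialize (B3 _ Hx). lia.
      + exists v. apply holds_builtins_app in Hv. tauto.
    - apply equiv_h_sym. eapply equiv_h_trans.
      + apply (@solve_subst (map (fun x => x + N) xs) (fun y => s0 (y - N))).
        * intros y y' Hy Hy' F. apply in_map_iff in Hy, Hy'.
          destruct Hy as (x & <- & Hx), Hy' as (x' & <- & Hx').
          replace (x + N - N) with x in F by lia. specialize (Hs1 _ _ Hx F). lia.
        * intros M HM v Hv y Hy. apply in_map_iff in Hy. destruct Hy as (x & <- & Hx).
          apply holds_builtins_app in Hv. replace (x + N - N) with x by lia.
          apply HEQ; tauto.
      + rewrite map_app, subst_store_comp.
        rewrite (subst_store_ext _ s0 S), (subst_store_ext _ Var S'), subst_store_var.
        * apply equiv_h_refl.
        * intros x Hx. destruct (in_dec Nat.eq_dec x _) as [i|]; auto.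
          apply in_map_iff in i. destruct i as (z & <- & _).
          specialize (B2 _ Hx). lia.
        * intros x Hx. unfold osubst, shift, renaming. simpl.
          destruct (in_dec Nat.eq_dec (x + N) _) as [i|n].
          -- f_equal. lia.
          -- exfalso. apply n. apply in_map_iff. exists x. split; auto. apply Hxs; auto. }
  eapply equiv_h_trans; [apply half; intros x Hx; specialize (B5 _ Hx); lia|].
  eapply equiv_h_trans; [|apply equiv_h_sym, half; intros x Hx; specialize (B6 _ Hx); lia].
  apply equiv_h_entails; intros M HM v Hv; apply holds_builtins_app in Hv;
    destruct Hv as [Hv1 Hv2]; apply holds_builtins_app; split; auto;
    apply HEQ; intros x Hx; rewrite (proj1 (HEQ M v _) Hv1 x Hx);
    [|symmetry]; apply HE; auto; apply Hxs; auto.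
Qed.

(** This is how a persistent head, or a whole persistent state, whose instance already lies in a
    larger store is laid beside that store before a derivation is run. *)
Lemma contract_incl S S' E X :
  Forall persistent S -> incl S S' -> equiv_h CT (St (S ++ S') E X) (St S' E X).
Proof.
  induction S as [|c S IH]; intros HS HI.
  - apply equiv_h_refl.
  - apply Forall_cons_iff in HS. destruct HS as [Hc HS].
    apply incl_cons_inv in HI. destruct HI as [Hi HI].
    eapply equiv_h_trans; [|apply IH; auto].
    assert (Hin : In c (S ++ S')) by (apply in_app_iff; auto).
    apply in_split in Hin. destruct Hin as (l1 & l2 & Heq).
    simpl. rewrite Heq.
    apply equiv_h_trans with (St (c :: c :: (l1 ++ l2)) E X).
    { apply equiv_h_perm. constructor. apply Permutation_sym, Permutation_middle. }
    eapply equiv_h_trans; [apply rst_step, eh_contract; auto|].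
    apply equiv_h_perm. apply Permutation_middle.
Qed.

(** * Transitions *)

Lemma steps_equiv Q st st' : equiv_h CT st st' -> steps_h CT Q st st'.
Proof. intros H. apply t_step. right. auto. Qed.

Lemma steps_step Q st st' : step_h CT Q st st' -> steps_h CT Q st st'.
Proof. intros H. apply t_step. left. auto. Qed.

Lemma steps_trans Q st st' st'' :
  steps_h CT Q st st' -> steps_h CT Q st' st'' -> steps_h CT Q st st''.
Proof. apply t_trans. Qed.

Lemma step_mono Q Q' st st' : incl Q Q' -> step_h CT Q st st' -> step_h CT Q' st st'.
Proof.
  intros HI H. induction H as [r0 r rho D E X Hr Hrho -> Hf|s s' t t' H1 H2 IH H3].
  - eapply step_rule; eauto.
  - eapply step_equiv; eauto.
Qed.

Lemma steps_mono Q Q' st st' : incl Q Q' -> steps_h CT Q st st' -> steps_h CT Q' st st'.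
Proof.
  intros HI H. induction H as [x y [H|H]|x y z _ IH1 _ IH2].
  - apply steps_step. eapply step_mono; eauto.
  - apply steps_equiv; auto.
  - eapply steps_trans; eauto.
Qed.

Lemma step_intro Q st st' r0 rho (S0 : list (chr Sg)) E X :
  In r0 Q -> Injective rho ->
  (forall x, lv (rename_rule rho r0) x -> ~ fv_store S0 x /\ ~ fv_builtins E x /\ ~ In x X) ->
  equiv_h CT st (St (kept (rename_rule rho r0) ++ removed (rename_rule rho r0) ++ S0)
                    (guard (rename_rule rho r0) ++ E) X) ->
  equiv_h CT (St (body_chr (rename_rule rho r0) ++ kept (rename_rule rho r0) ++ S0)
                 (body_builtin (rename_rule rho r0) ++ guard (rename_rule rho r0) ++ E) X) st' ->
  step_h CT Q st st'.
Proof.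
  intros Hr Hrho Hf H1 H2. eapply step_equiv; [exact H1| |exact H2].
  eapply step_rule; eauto.
Qed.

(** * Truth of states in a structure *)

Section Truth.
Context (M : structure Sg) (T : list (gatom M) -> Prop).

(** The conjunction of the store is replaced by a predicate [T] on multisets of ground
    atoms, which need not decide an atom at a time. *)
Definition true_state (u : valuation M) st : Prop :=
  exists w : valuation M, (forall x, In x (globals st) -> w x = u x) /\
    holds_builtins w (builtins st) /\ T (map (ginst w) (store st)).

(** What the equivalences ask of [T]: insensitivity to order and to repetition of persistent atoms.
    Multiplicities of linear atoms still count. *)
Definition multiset_pred : Prop :=
  (forall l l', Permutation l l' -> T l -> T l') /\
  (forall g l, gpers g -> (T (g :: g :: l) <-> T (g :: l))).

Lemma true_state_equiv u st st' :
  models_CT CT M -> multiset_pred -> equiv_h CT st st' ->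
  (true_state u st <-> true_state u st').
Proof.
  intros HM [Tp Tc] H.
  assert (base : forall s s' : state Sg, equiv_a_base CT s s' -> (true_state u s <-> true_state u s')).
  { intros s s' Hb. destruct Hb as [S S' E X X' HP HX|S y t D X|S S' X|S D E X HE|S E X y Hy1 Hy2];
      unfold true_state; simpl.
    - split; intros (w & H1 & H2 & H3); exists w.
      + split; [|split]; auto; [intros; apply H1, HX; auto|].
        eapply Tp; [apply Permutation_map; eauto|auto].
      + split; [|split]; auto; [intros; apply H1, HX; auto|].
        eapply Tp; [apply Permutation_map, Permutation_sym; eauto|auto].
    - assert (K : forall w : valuation M, w y = eval w t ->
        map (ginst w) (map (subst_chr (single y t)) S) = map (ginst w) S).
      { intros w Hw. rewrite ginst_store_subst. apply ginst_store_ext. intros x _.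
        unfold esubst, single. destruct (Nat.eq_dec x y) as [->|]; simpl; auto. }
      split; intros (w & H1 & H2 & H3); exists w; (split; [|split]); auto;
        assert (Hw := proj1 (proj1 (holds_builtins_cons _ _ _) H2)); simpl in Hw;
        [rewrite K | rewrite K in H3]; auto.
    - split; intros (w & H1 & H2 & H3); inversion H2; subst; simpl in *; tauto.
    - split; intros (w & H1 & H2 & H3).
      + destruct (proj1 (HE M HM w)) as (w' & Hw' & Hh).
        { exists w. auto. }
        exists w'. split; [|split]; auto.
        * intros x Hx. rewrite Hw'; auto.
        * rewrite (ginst_store_ext w' w S); auto.
      + destruct (proj2 (HE M HM w)) as (w' & Hw' & Hh).
        { exists w. auto. }
        exists w'. split; [|split]; auto.
        * intros x Hx. rewrite Hw'; auto.
        * rewrite (ginst_store_ext w' w S); auto.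
    - split; intros (w & H1 & H2 & H3).
      + set (w' := fun x => if Nat.eq_dec x y then u y else w x).
        assert (K : forall x, x <> y -> w' x = w x).
        { intros x Hx. unfold w'. destruct (Nat.eq_dec x y); tauto. }
        exists w'. split; [|split].
        * unfold w'. intros x Hx. destruct (Nat.eq_dec x y) as [->|]; auto.
          destruct Hx; [congruence|auto].
        * apply (holds_builtins_ext w); auto. intros x Hx. symmetry. apply K. congruence.
        * rewrite (ginst_store_ext w' w S); auto. intros x Hx. apply K. congruence.
      + exists w. auto. }
  assert (basea : forall s s' : state Sg, equiv_a CT s s' -> (true_state u s <-> true_state u s')).
  { intros s s' Ha. induction Ha; [auto|tauto|tauto|tauto]. }
  induction H as [s s' Hb| | |]; [|tauto|tauto|tauto].
  destruct Hb as [s s' Ha|c S D X Hc]; auto.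
  unfold true_state; simpl. split; intros (w & H1 & H2 & H3); exists w;
    (split; [|split]); auto; simpl in *;
    assert (K := Tc (ginst w c) (map (ginst w) S) (proj2 (gpers_ginst w c) Hc)); tauto.
Qed.

(** A valuation of the result of a transition has already chosen values for the local variables of
    the rule, so going backward no witness has to be found. The list [l] is the untouched
    context. *)
Definition backward_closed (Q : program Sg) : Prop :=
  forall r (w : valuation M) l, In r Q ->
    holds_builtins w (guard r) -> holds_builtins w (body_builtin r) ->
    T (map (ginst w) (body_chr r ++ kept r) ++ l) ->
    T (map (ginst w) (kept r ++ removed r) ++ l).

Lemma true_state_step_backward Q u st st' :
  models_CT CT M -> multiset_pred -> backward_closed Q ->
  step_h CT Q st st' -> true_state u st' -> true_state u st.
Proof.
  intros HM HT HB H. induction H as [r0 r rho D E X Hr Hrho -> Hf|s s' t t' H1 H2 IH H3].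
  - intros (w & Hw & H1 & H2). simpl in *.
    rewrite !holds_builtins_app, !holds_builtins_subst in H1.
    exists w. simpl. split; [|split]; auto.
    + rewrite holds_builtins_app, holds_builtins_subst. tauto.
    + rewrite !map_app, !ginst_store_subst in *. rewrite app_assoc, <- map_app in *.
      apply HB with (1 := Hr); tauto.
  - intros Ht. apply (true_state_equiv u HM HT H1). apply IH.
    apply (true_state_equiv u HM HT H3). auto.
Qed.

Lemma true_state_steps_backward Q u st st' :
  models_CT CT M -> multiset_pred -> backward_closed Q ->
  steps_h CT Q st st' -> true_state u st' -> true_state u st.
Proof.
  intros HM HT HB H. induction H as [x y [H|H]|x y z _ IH1 _ IH2]; auto.
  - eapply true_state_step_backward; eauto.
  - apply (true_state_equiv u HM HT H).
Qed.

End Truth.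

End Equivalence.

(** * Renaming and instantiation of rules *)

Lemma injective_inverse (f : nat -> nat) : Injective f -> exists g, forall x, g (f x) = x.
Proof.
  intros Hf. exists (fun y => epsilon (inhabits 0) (fun x => f x = y)).
  intros x. apply Hf. apply epsilon_spec with (P := fun z => f z = f x). eauto.
Qed.

Lemma rename_rule_comp {Sg : signature} phi rho (r : rule Sg) :
  rename_rule phi (rename_rule rho r) = rename_rule (fun x => phi (rho x)) r.
Proof.
  unfold rename_rule; simpl. rewrite !subst_store_comp, !subst_builtins_comp. reflexivity.
Qed.

Definition fv_rule {Sg : signature} (r : rule Sg) (x : var) : Prop := fv_head r x \/ lv r x.

Section Instances.
Context {Sg : signature} (CT : theory Sg).
Implicit Types (E D F : list (builtin Sg)) (S : list (chr Sg)) (X Y : list var)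
  (st : state Sg) (th : var -> term Sg).

Lemma fv_rule_guard (r : rule Sg) x : fv_builtins (guard r) x -> fv_rule r x.
Proof. unfold fv_rule, lv. tauto. Qed.

Lemma fv_rule_body_builtin (r : rule Sg) x : fv_builtins (body_builtin r) x -> fv_rule r x.
Proof. unfold fv_rule, lv. tauto. Qed.

Lemma fv_rule_body_chr (r : rule Sg) x : fv_store (body_chr r) x -> fv_rule r x.
Proof. unfold fv_rule, lv. tauto. Qed.

Lemma fv_rule_bounded (r : rule Sg) : exists n, forall x, fv_rule r x -> x < n.
Proof.
  destruct (fv_store_bounded (kept r)) as [n1 B1], (fv_store_bounded (removed r)) as [n2 B2],
    (fv_store_bounded (body_chr r)) as [n3 B3], (fv_builtins_bounded (guard r)) as [n4 B4],
    (fv_builtins_bounded (body_builtin r)) as [n5 B5].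
  exists (n1 + n2 + n3 + n4 + n5). intros x [[H|H]|[[H|[H|H]] _]];
    [specialize (B1 _ H)|specialize (B2 _ H)|specialize (B4 _ H)
    |specialize (B5 _ H)|specialize (B3 _ H)]; lia.
Qed.

(** A rule only fires on variables; to fire it on an instance [th], it is renamed by a fresh
    [phi] and the equations [phi x = th x] are added for its head variables. *)
Lemma step_instance Q r0 rho r th phi S F Y :
  In r0 Q -> Injective rho -> r = rename_rule rho r0 -> Injective phi ->
  (forall x, lv r x -> th x = Var (phi x) /\ ~ fv_store S (phi x) /\
     ~ fv_builtins F (phi x) /\ ~ In (phi x) Y /\
     forall z, fv_head r z -> ~ fv_term (th z) (phi x)) ->
  (forall x, fv_head r x -> th x = Var (phi x) \/
     ~ fv_store S (phi x) /\ ~ fv_builtins F (phi x) /\ ~ In (phi x) Y /\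
     forall z, fv_rule r z -> ~ fv_term (th z) (phi x)) ->
  step_h CT Q
    (St (map (subst_chr th) (kept r ++ removed r) ++ S)
        (map (subst_builtin th) (guard r) ++ F) Y)
    (St (map (subst_chr th) (body_chr r ++ kept r) ++ S)
        (map (subst_builtin th) (body_builtin r ++ guard r) ++ F) Y).
Proof.
  intros Hr Hrho Er Hphi Hlv Hhd.
  destruct (fv_rule_bounded r) as [n Bn].
  destruct (@bounded_list (fv_head r) n) as [hs Hhs].
  { intros x Hx. apply Bn. left; auto. }
  destruct (injective_inverse Hphi) as [g Hg].
  set (EQ := map (fun x => BEq (Var (phi x)) (th x)) hs : list (builtin Sg)).
  assert (HEQ : forall (M : structure Sg) (v : valuation M),
    holds_builtins v EQ <-> forall x, fv_head r x -> v (phi x) = eval v (th x)).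
  { intros M v. unfold EQ, holds_builtins. rewrite Forall_map, Forall_forall.
    split; intros H x Hx; apply H, Hhs, Hx. }
  assert (HV : forall (M : structure Sg) (v : valuation M) x,
    holds_builtins v EQ -> fv_rule r x -> eval v (th x) = v (phi x)).
  { intros M v x H [Hx|Hx].
    - symmetry. apply HEQ; auto.
    - rewrite (proj1 (Hlv x Hx)). reflexivity. }
  assert (HW : forall (M : structure Sg) (v : valuation M), exists w : valuation M,
    (forall y, fv_store S y \/ fv_builtins F y \/ In y Y \/
       (exists z, fv_rule r z /\ fv_term (th z) y) -> w y = v y) /\
    holds_builtins w EQ).
  { intros M v.
    (* Each [phi x], with [x] a head variable, receives the value of [th x]. Such a variable occurs
       nowhere else, unless [th x] is [Var (phi x)], and then its value does not change. *)
    set (w := fun y => if excluded_middle_informative (fv_head r (g y) /\ phi (g y) = y)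
                       then eval v (th (g y)) else v y).
    assert (Hw : forall y, fv_store S y \/ fv_builtins F y \/ In y Y \/
       (exists z, fv_rule r z /\ fv_term (th z) y) -> w y = v y).
    { intros y Hy. unfold w. destruct excluded_middle_informative as [[H1 H2]|]; auto.
      destruct (Hhd _ H1) as [->|(K1 & K2 & K3 & K4)].
      - simpl. congruence.
      - rewrite H2 in *. exfalso. destruct Hy as [Hy|[Hy|[Hy|(z & Hz & Hy)]]]; auto.
        eapply K4; eauto. }
    exists w. split; auto. apply HEQ. intros x Hx.
    transitivity (eval v (th x)).
    - unfold w. destruct excluded_middle_informative as [_|N]; rewrite Hg in *; auto.
      tauto.
    - apply eval_ext. intros z Hz. symmetry. apply Hw. right; right; right.
      exists x. split; auto. left; auto. }
  assert (HB : forall (M : structure Sg) (v : valuation M) D,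
    holds_builtins v EQ -> (forall x, fv_builtins D x -> fv_rule r x) ->
    (holds_builtins v (map (subst_builtin th) D) <->
     holds_builtins v (map (subst_builtin (renaming phi)) D))).
  { intros M v D H HD. rewrite !holds_builtins_subst.
    assert (K : forall x, fv_builtins D x -> esubst v th x = esubst v (renaming phi) x).
    { intros x Hx. unfold esubst, renaming. simpl. apply HV; auto. }
    split; apply holds_builtins_ext; auto. intros x Hx; symmetry; auto. }
  assert (HC : forall S0 D, (forall x, fv_store S0 x -> fv_rule r x) ->
    equiv_h CT (St (map (subst_chr th) S0 ++ S) (D ++ EQ ++ F) Y)
       (St (map (subst_chr (renaming phi)) S0 ++ S) (D ++ EQ ++ F) Y)).
  { intros S0 D HS. apply subst_cong. intros x Hx M HM v Hv.
    rewrite !holds_builtins_app in Hv. simpl. apply HV; [tauto|auto]. }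
  assert (HE : forall S0 D, (forall x, fv_store S0 x -> fv_rule r x) ->
    (forall x, fv_builtins D x -> fv_rule r x) ->
    equiv_h CT (St (map (subst_chr th) S0 ++ S) (map (subst_builtin th) D ++ F) Y)
       (St (map (subst_chr (renaming phi)) S0 ++ S)
           (map (subst_builtin (renaming phi)) D ++ EQ ++ F) Y)).
  { intros S0 D HS HD. eapply equiv_h_trans; [|apply HC; auto].
    apply equiv_h_builtins; intros M HM v Hv.
    - rewrite holds_builtins_app in Hv. destruct (HW M v) as (w & Hw1 & Hw2).
      exists w. split.
      + intros y [Hy|Hy]; apply Hw1; auto. apply fv_store_app in Hy.
        destruct Hy as [Hy|Hy]; auto. apply fv_subst_store in Hy.
        destruct Hy as (z & Hz & Hy). right; right; right; eauto.
      + rewrite !holds_builtins_app. split; [|split]; auto.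
        * apply (HB M w); auto. apply (holds_builtins_ext v); [|tauto].
          intros y Hy. symmetry. apply Hw1. apply fv_subst_builtins in Hy.
          destruct Hy as (z & Hz & Hy). right; right; right; eauto.
        * apply (holds_builtins_ext v); [|tauto]. intros y Hy. symmetry. auto.
    - rewrite !holds_builtins_app in Hv. exists v. split; auto.
      rewrite holds_builtins_app. split; [|tauto]. apply HB; tauto. }
  apply step_intro with (r0 := r0) (rho := fun x => phi (rho x)) (S0 := S) (E := EQ ++ F) (X := Y);
    auto.
  - intros x y H. auto.
  - rewrite <- rename_rule_comp, <- Er. intros y Hy. apply lv_rename in Hy; auto.
    destruct Hy as (x & Hx & ->). destruct (Hlv x Hx) as (K1 & K2 & K3 & K4 & K5).
    split; [|split]; auto. rewrite fv_builtins_app. intros [H|H]; auto.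
    apply fv_builtins_in in H. destruct H as (b & Hb & H).
    apply in_map_iff in Hb. destruct Hb as (z & <- & Hz). apply Hhs in Hz.
    simpl in H. destruct H as [H|H].
    + apply Hphi in H. subst z. destruct Hx as [_ Hx]. auto.
    + eapply K5; eauto.
  - rewrite <- rename_rule_comp, <- Er. simpl. rewrite !app_assoc, <- map_app, <- app_assoc.
    apply HE.
    + intros x Hx. left. apply fv_store_app in Hx. exact Hx.
    + apply fv_rule_guard.
  - rewrite <- rename_rule_comp, <- Er. simpl. apply equiv_h_sym.
    rewrite !app_assoc, <- !map_app, <- !app_assoc.
    apply HE.
    + intros x Hx. apply fv_store_app in Hx. destruct Hx as [Hx|Hx].
      * apply fv_rule_body_chr; auto.
      * left; left; auto.
    + intros x Hx. apply fv_builtins_app in Hx. destruct Hx as [Hx|Hx];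
        auto using fv_rule_guard, fv_rule_body_builtin.
Qed.

End Instances.

(** * Simulation by instances *)

Section Simulation.
Context {Sg : signature} (CT : theory Sg).
Variables (eta : var -> term Sg) (Sk : list (chr Sg)) (Y : list var).
Implicit Types (E D F : list (builtin Sg)) (S : list (chr Sg)) (X : list var)
  (st : state Sg) (th : var -> term Sg).

(** The local variables of [st] may be instantiated by arbitrary terms.  The built-ins that
    [st'] has in excess are not fixed: an equivalence may drop constraints on local variables
    of [st] which in [st'] constrain other variables. *)
Definition refines st st' : Prop :=
  exists th F, (forall x, In x (globals st) -> th x = eta x) /\
    equiv_h CT st' (St (map (subst_chr th) (store st) ++ Sk)
                       (map (subst_builtin th) (builtins st) ++ F) Y).

(** Variables outside the store and the globals can be instantiated afresh: they become [x + N],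
    where the witness for [E] is read, and the instance of [D] moves into the excess built-ins. *)
Lemma refines_builtins S D E X st :
  (forall M : structure Sg, models_CT CT M -> forall v : valuation M,
     holds_builtins v D -> exists w, (forall x, fv_store S x \/ In x X -> w x = v x) /\
       holds_builtins w E) ->
  refines (St S D X) st -> refines (St S E X) st.
Proof.
  intros HDE (th & F & Hth & Heq). simpl in *.
  destruct (fv_store_bounded (map (subst_chr th) S ++ Sk)) as [n1 B1].
  destruct (fv_builtins_bounded (map (subst_builtin th) D ++ F)) as [n2 B2].
  destruct (globals_bounded Y) as [n3 B3].
  (* Reflexive equations are only a way to bound the variables of the terms [th x] for [x] in
     [X]. *)
  destruct (fv_builtins_bounded (map (fun x => BEq (th x) (th x)) X)) as [n4 B4].
  set (N := n1 + n2 + n3 + n4).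
  set (th' := fun x => if excluded_middle_informative (fv_store S x \/ In x X)
                       then th x else Var (x + N)).
  assert (K1 : forall x, fv_store S x \/ In x X -> th' x = th x).
  { intros x Hx. unfold th'. destruct excluded_middle_informative; tauto. }
  exists th', (map (subst_builtin th) D ++ F). simpl. split.
  - intros x Hx. rewrite K1; auto.
  - rewrite (subst_store_ext th' th) by auto.
    eapply equiv_h_trans; [exact Heq|].
    apply equiv_h_builtins; intros M HM v Hv.
    + assert (Hv' := Hv). rewrite holds_builtins_app, holds_builtins_subst in Hv'.
      destruct (HDE M HM _ (proj1 Hv')) as (w & Hw1 & Hw2).
      assert (L : forall x, x < N -> shift_valuation N v w x = v x)
        by (intros; apply shift_valuation_lt; auto).
      exists (shift_valuation N v w). split.
      * intros x [Hx|Hx]; apply L; [specialize (B1 _ Hx)|specialize (B3 _ Hx)]; lia.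
      * rewrite holds_builtins_app. split.
        -- rewrite holds_builtins_subst. apply (holds_builtins_ext w); auto.
           intros x _. unfold esubst, th'.
           destruct excluded_middle_informative as [Hx|Hx].
           ++ rewrite Hw1; auto. apply eval_ext. intros z Hz. symmetry. apply L.
              destruct Hx as [Hx|Hx].
              ** assert (z < n1); [|lia]. apply B1, fv_store_app. left.
                 apply fv_subst_store. eauto.
              ** assert (z < n4); [|lia]. apply B4, fv_builtins_in.
                 exists (BEq (th x) (th x)). split; [apply in_map_iff; eauto|simpl; auto].
           ++ simpl. rewrite shift_valuation_add. auto.
        -- apply (holds_builtins_ext v); auto. intros x Hx. symmetry. apply L.
           specialize (B2 _ Hx). lia.
    + exists v. split; auto. apply holds_builtins_app in Hv. tauto.
Qed.

Lemma refines_equiv st1 st2 st :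
  equiv_h CT st1 st2 -> (refines st1 st <-> refines st2 st).
Proof.
  intros H.
  assert (base : forall s1 s2 : state Sg, equiv_a_base CT s1 s2 -> refines s1 st <-> refines s2 st).
  { intros s1 s2 Hb. destruct Hb as [S S' E X X' HP HX|S y t D X|S S' X|S D E X HE|S E X y Hy1 Hy2].
    - split; intros (th & F & Hth & Heq); exists th, F; simpl in *;
        (split; [intros x Hx; apply Hth, HX, Hx|]); eapply equiv_h_trans; try exact Heq;
        apply equiv_h_perm, Permutation_app_tail, Permutation_map; auto using Permutation_sym.
    - assert (K : forall th F, equiv_h CT
        (St (map (subst_chr th) S ++ Sk) (map (subst_builtin th) (BEq (Var y) t :: D) ++ F) Y)
        (St (map (subst_chr th) (map (subst_chr (single y t)) S) ++ Sk)
            (map (subst_builtin th) (BEq (Var y) t :: D) ++ F) Y)).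
      { intros th F. rewrite subst_store_comp. apply subst_cong. intros x _ M HM v Hv.
        unfold osubst, single. destruct (Nat.eq_dec x y) as [->|]; auto.
        simpl in Hv. apply holds_builtins_cons in Hv. simpl in Hv. tauto. }
      split; intros (th & F & Hth & Heq); exists th, F; simpl in *; split; auto;
        eapply equiv_h_trans; try exact Heq; [|apply equiv_h_sym]; apply K.
    - assert (K : forall th F (M : structure Sg) (v : valuation M),
        ~ holds_builtins v (map (subst_builtin th) [BFalse] ++ F)).
      { intros th F M v H0. apply holds_builtins_cons in H0. simpl in H0. tauto. }
      split; intros (th & F & Hth & Heq); exists th, F; simpl globals in *; split; auto;
        eapply equiv_h_trans; try exact Heq; apply equiv_h_unsat; intros M HM v; apply K.
    - split; apply refines_builtins; intros M HM v Hv.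
      + apply (proj1 (HE M HM v)). exists v. auto.
      + apply (proj2 (HE M HM v)). exists v. auto.
    - split; intros (th & F & Hth & Heq).
      + set (th' := fun x => if Nat.eq_dec x y then eta x else th x).
        assert (K : forall x, x <> y -> th' x = th x).
        { intros x Hx. unfold th'. destruct (Nat.eq_dec x y); tauto. }
        exists th', F. simpl in *. split.
        * intros x Hx. unfold th'. destruct (Nat.eq_dec x y) as [->|]; auto.
          destruct Hx as [<-|Hx]; [tauto|auto].
        * rewrite (subst_store_ext th' th), (subst_builtins_ext th' th); auto;
            intros x Hx; apply K; congruence.
      + exists th, F. simpl in *. split; auto. }
  assert (basea : forall s1 s2 : state Sg, equiv_a CT s1 s2 -> refines s1 st <-> refines s2 st).
  { intros s1 s2 Ha. induction Ha; [auto|tauto|tauto|tauto]. }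
  induction H as [s1 s2 Hb| | |]; [|tauto|tauto|tauto].
  destruct Hb as [s1 s2 Ha|c S D X Hc]; auto.
  assert (K : forall th F, equiv_h CT
    (St (map (subst_chr th) (c :: c :: S) ++ Sk) F Y) (St (map (subst_chr th) (c :: S) ++ Sk) F Y)).
  { intros th F. apply rst_step, eh_contract. apply persistent_subst; auto. }
  split; intros (th & F & Hth & Heq); exists th, F; split; auto;
    eapply equiv_h_trans; try exact Heq; [|apply equiv_h_sym]; apply K.
Qed.

Lemma refines_step Q st st' st1 :
  step_h CT Q st st' -> refines st st1 ->
  exists st1', step_h CT Q st1 st1' /\ refines st' st1'.
Proof.
  intros H. revert st1. induction H as [r0 r rho D E X Hr Hrho Er Hf|s s' t t' H1 H2 IH H3];
    intros st1 Href.
  2: { apply (refines_equiv st1 H1) in Href. destruct (IH st1 Href) as (st1' & K1 & K2).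
       exists st1'. split; auto. apply (refines_equiv st1' H3). auto. }
  destruct Href as (th & F & Hth & Heq). simpl in *.
  set (SR := map (subst_chr th) (kept r ++ removed r)).
  set (S := map (subst_chr th) D ++ Sk).
  (* The instance of the guard by [th] stays among the built-ins. A second instance by [th'], with
     fresh local variables, is added beside it; the first one makes it satisfiable by giving [x + N]
     the value of [th x]. *)
  set (FR := map (subst_builtin th) (guard r) ++ map (subst_builtin th) E ++ F).
  destruct (fv_store_bounded (SR ++ S)) as [n1 B1].
  destruct (fv_builtins_bounded FR) as [n2 B2].
  destruct (globals_bounded Y) as [n3 B3].
  set (N := n1 + n2 + n3).
  set (th' := fun x => if excluded_middle_informative (lv r x) then Var (x + N) else th x).
  assert (K1 : forall x, ~ lv r x -> th' x = th x).
  { intros x Hx. unfold th'. destruct excluded_middle_informative; tauto. }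
  assert (K1' : forall x, fv_head r x -> th' x = th x).
  { intros x Hx. apply K1. unfold lv. tauto. }
  assert (K2 : forall x, lv r x -> th' x = Var (x + N)).
  { intros x Hx. unfold th'. destruct excluded_middle_informative; tauto. }
  assert (BS : forall x, fv_store S x -> x < N).
  { intros x Hx. assert (x < n1); [|lia]. apply B1, fv_store_app. auto. }
  assert (BF : forall x, fv_builtins FR x -> x < N).
  { intros x Hx. specialize (B2 _ Hx). lia. }
  assert (BY : forall x, In x Y -> x < N).
  { intros x Hx. specialize (B3 _ Hx). lia. }
  assert (BH : forall x z, fv_head r x -> fv_term (th' x) z -> z < N).
  { intros x z Hx Hz. rewrite K1' in Hz; auto. assert (z < n1); [|lia].
    apply B1, fv_store_app. left. apply fv_subst_store. exists x. split; auto.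
    apply fv_store_app. exact Hx. }
  assert (SR' : SR = map (subst_chr th') (kept r ++ removed r)).
  { apply subst_store_ext. intros x Hx. symmetry. apply K1'. apply fv_store_app in Hx. exact Hx. }
  assert (Step : step_h CT Q
    (St (map (subst_chr th') (kept r ++ removed r) ++ S)
        (map (subst_builtin th') (guard r) ++ FR) Y)
    (St (map (subst_chr th') (body_chr r ++ kept r) ++ S)
        (map (subst_builtin th') (body_builtin r ++ guard r) ++ FR) Y)).
  { eapply step_instance with (phi := fun x => x + N); eauto.
    - intros x y. lia.
    - intros x Hx. split; [auto|]. split; [|split; [|split]].
      + intros H. specialize (BS _ H). lia.
      + intros H. specialize (BF _ H). lia.
      + intros H. specialize (BY _ H). lia.
      + intros z Hz H. specialize (BH _ _ Hz H). lia.
    - intros x Hx. right. split; [|split; [|split]].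
      + intros H. specialize (BS _ H). lia.
      + intros H. specialize (BF _ H). lia.
      + intros H. specialize (BY _ H). lia.
      + intros z [Hz|Hz] H.
        * specialize (BH _ _ Hz H). lia.
        * rewrite K2 in H by auto. simpl in H. assert (x = z) by lia. subst z.
          destruct Hz as [_ Hz]. auto. }
  eexists. split.
  - eapply step_equiv; [|exact Step|apply equiv_h_refl].
    eapply equiv_h_trans; [exact Heq|].
    rewrite !map_app, <- !app_assoc. fold S. rewrite app_assoc, <- map_app. fold SR. fold FR.
    rewrite app_assoc, <- map_app, <- SR'.
    apply equiv_h_builtins; intros M HM v Hv.
    + set (w := shift_valuation N v (fun x => eval v (th x))).
      assert (L : forall x, x < N -> w x = v x) by (intros; apply shift_valuation_lt; auto).
      exists w. split.
      * intros x [Hx|Hx]; apply L; auto. specialize (B1 _ Hx). lia.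
      * rewrite holds_builtins_app. split.
        -- unfold FR in Hv. rewrite holds_builtins_app in Hv. destruct Hv as [Hv _].
           rewrite holds_builtins_subst in *. apply (holds_builtins_ext (esubst v th)); auto.
           intros x Hx. unfold esubst, th'. destruct excluded_middle_informative as [|Hn].
           ++ simpl. unfold w. rewrite shift_valuation_add. auto.
           ++ apply eval_ext. intros z Hz. symmetry. apply L, BF, fv_builtins_app. left.
              apply fv_subst_builtins. eauto.
        -- apply (holds_builtins_ext v); auto. intros x Hx. symmetry. auto.
    + exists v. split; auto. apply holds_builtins_app in Hv. tauto.
  - exists th', (map (subst_builtin th) (guard r) ++ F). simpl. split.
    + intros x Hx. rewrite K1; auto. intros H. destruct (Hf x H) as (_ & _ & H'). auto.
    + assert (KD : map (subst_chr th') D = map (subst_chr th) D).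
      { apply subst_store_ext. intros x Hx. apply K1. intros H. destruct (Hf x H). auto. }
      assert (KE : map (subst_builtin th') E = map (subst_builtin th) E).
      { apply subst_builtins_ext. intros x Hx. apply K1. intros H. destruct (Hf x H) as (_ & H' & _). auto. }
      unfold S, FR. rewrite !map_app, KD, KE, <- !app_assoc.
      apply equiv_h_entails; intros M HM v; rewrite !holds_builtins_app; tauto.
Qed.

Lemma refines_steps Q st st' st1 :
  steps_h CT Q st st' -> refines st st1 ->
  exists st1', steps_h CT Q st1 st1' /\ refines st' st1'.
Proof.
  intros H. revert st1. induction H as [x y [H|H]|x y z _ IH1 _ IH2]; intros st1 Href.
  - destruct (refines_step H Href) as (st1' & K1 & K2). exists st1'.
    split; auto. apply steps_step; auto.
  - exists st1. split; [apply steps_equiv, equiv_h_refl|]. apply (refines_equiv st1 H). auto.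
  - destruct (IH1 st1 Href) as (s1 & K1 & K2). destruct (IH2 s1 K2) as (s2 & K3 & K4).
    exists s2. split; auto. eapply steps_trans; eauto.
Qed.

End Simulation.

(** Replays a derivation in a context and with other global variables. At the start [eta]
    instantiates every variable; at the end only the global ones are still under control. *)
Lemma steps_refine {Sg : signature} (CT : theory Sg) Q st st' eta Sk F Y :
  steps_h CT Q st st' ->
  exists th F', (forall x, In x (globals st') -> th x = eta x) /\
    steps_h CT Q
      (St (map (subst_chr eta) (store st) ++ Sk) (map (subst_builtin eta) (builtins st) ++ F) Y)
      (St (map (subst_chr th) (store st') ++ Sk) (map (subst_builtin th) (builtins st') ++ F') Y).
Proof.
  intros H.
  destruct (@refines_steps Sg CT eta Sk Y Q st st'
    (St (map (subst_chr eta) (store st) ++ Sk) (map (subst_builtin eta) (builtins st) ++ F) Y) H)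
    as (st1' & K1 & K2).
  - exists eta, F. split; [auto|apply equiv_h_refl].
  - destruct K2 as (th & F' & Hth & Heq). exists th, F'. split; auto.
    eapply steps_trans; [exact K1|]. apply steps_equiv; auto.
Qed.

Lemma rename_rule_id {Sg : signature} (r : rule Sg) : rename_rule (fun x => x) r = r.
Proof.
  destruct r. unfold rename_rule. change (renaming (fun x => x)) with (@Var Sg). simpl.
  rewrite !subst_store_var, !subst_builtins_var. reflexivity.
Qed.

Lemma step_rule_id {Sg : signature} (CT : theory Sg) Q (r : rule Sg) S X :
  In r Q -> (forall x, lv r x -> ~ fv_store S x /\ ~ In x X) ->
  step_h CT Q (St (kept r ++ removed r ++ S) (guard r) X)
              (St (body_chr r ++ kept r ++ S) (body_builtin r ++ guard r) X).
Proof.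
  intros Hr Hf. eapply step_intro with (r0 := r) (rho := fun x => x) (S0 := S) (E := []) (X := X);
    auto.
  - intros x y e. exact e.
  - rewrite rename_rule_id. intros x Hx. destruct (Hf x Hx). split; [|split]; auto.
    intros F. inversion F.
  - rewrite rename_rule_id, app_nil_r. apply equiv_h_refl.
  - rewrite rename_rule_id, app_nil_r. apply equiv_h_refl.
Qed.

Lemma fv_head_list {Sg : signature} (r : rule Sg) : exists X, forall x, In x X <-> fv_head r x.
Proof.
  destruct (fv_rule_bounded r) as [n Bn]. apply (bounded_list (fv_head r) (n := n)).
  intros x Hx. apply Bn. left; auto.
Qed.

(** * Transitions in a context *)

Section Plug.
Context {Sg : signature} (CT : theory Sg).
Variables (eta : var -> term Sg) (N : nat) (Sk : list (chr Sg)) (Ek : list (builtin Sg))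
  (Y : list var).
Hypotheses (Heta : forall x y, fv_term (eta x) y -> y < N)
  (HSk : forall y, fv_store Sk y -> y < N)
  (HEk : forall y, fv_builtins Ek y -> y < N)
  (HY : forall y, In y Y -> y < N).
Implicit Types (E D F : list (builtin Sg)) (S : list (chr Sg)) (X : list var)
  (st : state Sg).

(** Global variables are instantiated by terms below [N], local ones move beyond [N], out of reach
    of the context. An equivalence that alters local variables therefore never touches the
    context. *)
Definition plug_subst X : var -> term Sg :=
  fun x => if in_dec Nat.eq_dec x X then eta x else Var (x + N).

Definition plug st : state Sg :=
  St (map (subst_chr (plug_subst (globals st))) (store st) ++ Sk)
     (map (subst_builtin (plug_subst (globals st))) (builtins st) ++ Ek) Y.

Lemma plug_subst_in X x : In x X -> plug_subst X x = eta x.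
Proof. intros H. unfold plug_subst. destruct in_dec; tauto. Qed.

Lemma plug_subst_notin X x : ~ In x X -> plug_subst X x = Var (x + N).
Proof. intros H. unfold plug_subst. destruct in_dec; tauto. Qed.

Lemma fv_plug_subst X x y : fv_term (plug_subst X x) y -> y < N \/ (y = x + N /\ ~ In x X).
Proof.
  unfold plug_subst. destruct in_dec as [i|n].
  - intros H. left. eapply Heta; eauto.
  - simpl. auto.
Qed.

Lemma plug_builtins S D E X :
  (forall M : structure Sg, models_CT CT M -> forall v : valuation M,
     holds_builtins v D -> exists w, (forall x, fv_store S x \/ In x X -> w x = v x) /\
       holds_builtins w E) ->
  forall M : structure Sg, models_CT CT M -> forall v : valuation M,
  holds_builtins v (map (subst_builtin (plug_subst X)) D ++ Ek) ->
  exists w, (forall x, fv_store (map (subst_chr (plug_subst X)) S ++ Sk) x \/ In x Y -> w x = v x) /\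
    holds_builtins w (map (subst_builtin (plug_subst X)) E ++ Ek).
Proof.
  intros HDE M HM v Hv. rewrite holds_builtins_app, holds_builtins_subst in Hv.
  destruct (HDE M HM _ (proj1 Hv)) as (w & Hw1 & Hw2).
  assert (L : forall x, x < N -> shift_valuation N v w x = v x)
    by (intros; apply shift_valuation_lt; auto).
  exists (shift_valuation N v w). split.
  - intros y [Hy|Hy]; auto. apply fv_store_app in Hy. destruct Hy as [Hy|Hy]; auto.
    apply fv_subst_store in Hy. destruct Hy as (x & Hx & Hy).
    destruct (fv_plug_subst _ _ _ Hy) as [H|[-> H]]; auto.
    rewrite shift_valuation_add, Hw1 by auto. unfold esubst.
    rewrite plug_subst_notin by auto. reflexivity.
  - rewrite holds_builtins_app, holds_builtins_subst. split.
    + apply (holds_builtins_ext w); auto. intros x _. unfold esubst.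
      destruct (in_dec Nat.eq_dec x X) as [i|n].
      * rewrite Hw1 by auto. unfold esubst. rewrite plug_subst_in by auto.
        apply eval_ext. intros z Hz. symmetry. eauto.
      * rewrite plug_subst_notin by auto. simpl. rewrite shift_valuation_add. auto.
    + apply (holds_builtins_ext v); [|tauto]. intros x Hx. symmetry. auto.
Qed.

Lemma plug_equiv st st' : equiv_h CT st st' -> equiv_h CT (plug st) (plug st').
Proof.
  assert (base : forall s s' : state Sg, equiv_a_base CT s s' -> equiv_h CT (plug s) (plug s')).
  { intros s s' Hb. destruct Hb as [S S' E X X' HP HX|S y t D X|S S' X|S D E X HE|S E X y Hy1 Hy2];
      unfold plug; simpl store; simpl builtins; simpl globals.
    - rewrite (subst_store_ext (plug_subst X') (plug_subst X)),
        (subst_builtins_ext (plug_subst X') (plug_subst X)).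
      + apply equiv_h_perm, Permutation_app_tail, Permutation_map; auto.
      + intros x _. unfold plug_subst. assert (K := HX x).
        destruct (in_dec Nat.eq_dec x X'), (in_dec Nat.eq_dec x X); tauto.
      + intros x _. unfold plug_subst. assert (K := HX x).
        destruct (in_dec Nat.eq_dec x X'), (in_dec Nat.eq_dec x X); tauto.
    - rewrite subst_store_comp. apply subst_cong. intros x _ M HM v Hv.
      unfold osubst, single. destruct (Nat.eq_dec x y) as [->|]; auto.
      simpl in Hv. apply holds_builtins_cons in Hv. simpl in Hv. tauto.
    - assert (K : forall (M : structure Sg) (v : valuation M),
        ~ holds_builtins v (map (subst_builtin (plug_subst X)) [BFalse] ++ Ek)).
      { intros M v H0. apply holds_builtins_cons in H0. simpl in H0. tauto. }
      apply equiv_h_unsat; intros M HM v; apply K.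
    - apply equiv_h_builtins; intros M HM v Hv.
      + eapply plug_builtins; [|exact HM|exact Hv]. intros M' HM' v' Hv'. apply (proj1 (HE M' HM' v')).
        exists v'. auto.
      + eapply plug_builtins; [|exact HM|exact Hv]. intros M' HM' v' Hv'. apply (proj2 (HE M' HM' v')).
        exists v'. auto.
    - assert (K : forall x, x <> y -> plug_subst (y :: X) x = plug_subst X x).
      { intros x Hx. unfold plug_subst.
        destruct (in_dec Nat.eq_dec x (y :: X)) as [[e|i]|n], (in_dec Nat.eq_dec x X); auto; try tauto.
        - congruence.
        - simpl in n. tauto. }
      rewrite (subst_store_ext (plug_subst (y :: X)) (plug_subst X)),
        (subst_builtins_ext (plug_subst (y :: X)) (plug_subst X)).
      + apply equiv_h_refl.
      + intros x Hx. apply K. congruence.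
      + intros x Hx. apply K. congruence. }
  assert (basea : forall s s' : state Sg, equiv_a CT s s' -> equiv_h CT (plug s) (plug s')).
  { intros s s' Ha. induction Ha; eauto using equiv_h_refl, equiv_h_sym, equiv_h_trans. }
  intros H. induction H as [s s' Hb| | |]; eauto using equiv_h_refl, equiv_h_sym, equiv_h_trans.
  destruct Hb as [s s' Ha|c S D X Hc]; auto.
  unfold plug. simpl. apply rst_step, eh_contract. apply persistent_subst; auto.
Qed.

Lemma plug_step Q st st' : step_h CT Q st st' -> step_h CT Q (plug st) (plug st').
Proof.
  intros H. induction H as [r0 r rho D E X Hr Hrho Er Hf|s s' t t' H1 H2 IH H3].
  - assert (Hl : forall x, lv r x -> ~ In x X) by (intros x Hx; apply Hf; auto).
    assert (K := @step_instance Sg CT Q r0 rho r (plug_subst X) (fun x => x + N)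
      (map (subst_chr (plug_subst X)) D ++ Sk) (map (subst_builtin (plug_subst X)) E ++ Ek) Y
      Hr Hrho Er).
    unfold plug. simpl. rewrite !map_app, <- !app_assoc in *.
    apply K.
    + intros x y. lia.
    + intros x Hx. destruct (Hf x Hx) as (F1 & F2 & F3).
      split; [|split; [|split; [|split]]].
      * apply plug_subst_notin; auto.
      * rewrite fv_store_app, fv_subst_store. intros [(z & Hz & H)|H].
        -- destruct (fv_plug_subst _ _ _ H) as [|[e _]]; [lia|].
           assert (x = z) by lia. congruence.
        -- specialize (HSk H). lia.
      * rewrite fv_builtins_app, fv_subst_builtins. intros [(z & Hz & H)|H].
        -- destruct (fv_plug_subst _ _ _ H) as [|[e _]]; [lia|].
           assert (x = z) by lia. congruence.
        -- specialize (HEk H). lia.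
      * intros H. specialize (HY _ H). lia.
      * intros z Hz H. destruct (fv_plug_subst _ _ _ H) as [|[e _]]; [lia|].
        assert (x = z) by lia. subst z. destruct Hx; auto.
    + intros x Hx. destruct (in_dec Nat.eq_dec x X) as [i|n].
      2: { left. apply plug_subst_notin; auto. }
      right.
      assert (G : forall z, ~ fv_term (plug_subst X z) (x + N)).
      { intros z H. destruct (fv_plug_subst _ _ _ H) as [|[e F]]; [lia|].
        assert (x = z) by lia. subst z. auto. }
      split; [|split; [|split]]; auto.
      * rewrite fv_store_app, fv_subst_store. intros [(z & Hz & H)|H].
        -- eapply G; eauto.
        -- specialize (HSk H). lia.
      * rewrite fv_builtins_app, fv_subst_builtins. intros [(z & Hz & H)|H].
        -- eapply G; eauto.
        -- specialize (HEk H). lia.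
      * intros H. specialize (HY _ H). lia.
  - eapply step_equiv; [apply plug_equiv; eauto|eauto|apply plug_equiv; auto].
Qed.

Lemma plug_steps Q st st' : steps_h CT Q st st' -> steps_h CT Q (plug st) (plug st').
Proof.
  intros H. induction H as [x y [H|H]|x y z _ IH1 _ IH2].
  - apply steps_step, plug_step; auto.
  - apply steps_equiv, plug_equiv; auto.
  - eapply steps_trans; eauto.
Qed.

End Plug.

(** * From satisfiability to the hybrid semantics *)

Lemma simplification_rules_spec {Sg : signature} (P : program Sg) : hybrid_program P ->
  forall r, In r (simplification_rules P) -> hybrid_rule r /\ removed r <> [].
Proof.
  intros HP r H. apply filter_In in H. destruct H as [H1 H2]. split.
  - exact (proj1 (Forall_forall _ _) HP r H1).
  - unfold is_simplification in H2. destruct (removed r); [discriminate|]. discriminate.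
Qed.

Section Completeness.
Context {Sg : signature} (CT : theory Sg) (P : program Sg).
Implicit Types st : state Sg.

Lemma multiset_pred_gholds (M : structure Sg) : multiset_pred (Forall (@gholds Sg M)).
Proof.
  split.
  - intros l l' HP H. eapply Permutation_Forall; eauto.
  - intros g l _. rewrite !Forall_cons_iff. tauto.
Qed.

Lemma true_state_step_forward (M : structure Sg) u st st' :
  models_CP CT P M -> step_h CT P st st' ->
  true_state (Forall (@gholds Sg M)) u st -> true_state (Forall (@gholds Sg M)) u st'.
Proof.
  intros [HM HP] H. assert (HT := multiset_pred_gholds M).
  induction H as [r0 r rho D E X Hr Hrho Er Hf|s s' t t' H1 H2 IH H3].
  2: { intros Ht. apply (true_state_equiv u HM HT H3). apply IH.
       apply (true_state_equiv u HM HT H1). auto. }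
  intros (w & Hw & Hb & Hs). simpl in *. subst r.
  rewrite gholds_store in Hs. unfold holds_store in Hs. rewrite !Forall_app in Hs.
  destruct Hs as (HK & HH & HD). rewrite holds_builtins_app in Hb. destruct Hb as [HG HE].
  assert (inst : forall S, holds_store w (map (subst_chr (renaming rho)) S) ->
    holds_store (esubst w (renaming rho)) S).
  { intros S HS. apply gholds_store. rewrite <- ginst_store_subst. apply gholds_store, HS. }
  destruct (HP r0 Hr (esubst w (renaming rho))) as [HR _].
  { split; [apply inst, HK|apply holds_builtins_subst, HG]. }
  destruct (HR (inst _ HH)) as (w0 & Hw0 & HG0 & HC0 & HB0).
  destruct (injective_inverse Hrho) as [g Hg].
  (* The witness of the reading is moved to the renamed local variables; these are fresh for [D],
     [E] and [X], so the rest of the state keeps its value. *)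
  set (w' := fun y => if excluded_middle_informative (lv (rename_rule rho r0) y)
                      then w0 (g y) else w y).
  assert (K1 : forall y, ~ lv (rename_rule rho r0) y -> w' y = w y).
  { intros y Hy. unfold w'. destruct excluded_middle_informative; tauto. }
  assert (K2 : forall x, fv_rule r0 x -> esubst w' (renaming rho) x = w0 x).
  { intros x Hx. unfold esubst, renaming. simpl. destruct Hx as [Hx|Hx].
    - rewrite Hw0 by auto. apply (K1 (rho x)). intros [_ F]. apply F, (proj2 (fv_head_rename _ _ _)).
      exists x. auto.
    - unfold w'. destruct excluded_middle_informative as [|n].
      + rewrite Hg. auto.
      + exfalso. apply n. apply lv_rename; eauto. }
  exists w'. simpl. split; [|split].
  - intros x Hx. rewrite K1; auto. intros F. destruct (Hf x F); tauto.
  - rewrite !holds_builtins_app, !holds_builtins_subst. split; [|split].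
    + apply (holds_builtins_ext w0); auto. intros x Hx. symmetry. apply K2, fv_rule_body_builtin, Hx.
    + apply (holds_builtins_ext w0); auto. intros x Hx. symmetry. apply K2, fv_rule_guard, Hx.
    + apply (holds_builtins_ext w); auto. intros x Hx. symmetry. apply K1.
      intros F. destruct (Hf x F); tauto.
  - rewrite !map_app, !Forall_app. split; [|split].
    + rewrite ginst_store_subst, (ginst_store_ext _ w0).
      * apply gholds_store; auto.
      * intros x Hx. apply K2, fv_rule_body_chr, Hx.
    + rewrite (ginst_store_ext _ w).
      * apply gholds_store. exact HK.
      * intros x Hx. apply K1. intros [_ F]. apply F. left. exact Hx.
    + rewrite (ginst_store_ext _ w).
      * apply gholds_store. exact HD.
      * intros x Hx. apply K1. intros F. destruct (Hf x F); tauto.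
Qed.

Lemma true_state_steps_forward (M : structure Sg) u st st' :
  models_CP CT P M -> steps_h CT P st st' ->
  true_state (Forall (@gholds Sg M)) u st -> true_state (Forall (@gholds Sg M)) u st'.
Proof.
  intros HM H. induction H as [x y [H|H]|x y z _ IH1 _ IH2]; auto.
  - eapply true_state_step_forward; eauto.
  - apply (true_state_equiv u (proj1 HM) (multiset_pred_gholds M) H).
Qed.

(** Inconsistent states are equivalent whatever their stores, so pure persistence is not invariant
    in general. For a state with a true instance it is: it amounts to truth for the predicate that
    all ground atoms are persistent, and truth is invariant. *)
Lemma purely_persistent_equiv (M : structure Sg) u st st' :
  models_CT CT M -> equiv_h CT st st' ->
  true_state (Forall (@gholds Sg M)) u st ->
  purely_persistent st' -> purely_persistent st.
Proof.
  intros HM H Ht Hp.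
  set (T := fun l : list (gatom M) => Forall (@gpers Sg M) l).
  assert (HT : multiset_pred T).
  { split.
    - intros l l' HP. apply Permutation_Forall; auto.
    - intros g l _. unfold T. rewrite !Forall_cons_iff. tauto. }
  assert (K : forall s, purely_persistent s <-> forall w : valuation M, T (map (ginst w) (store s))).
  { intros s. unfold purely_persistent, T. split.
    - intros Hs w. rewrite Forall_map. revert Hs. apply Forall_impl.
      intros c. apply gpers_ginst.
    - intros Hs. destruct (dom_inhabited M) as [d]. specialize (Hs (fun _ => d)).
      rewrite Forall_map in Hs. revert Hs. apply Forall_impl. intros c. apply gpers_ginst. }
  apply (true_state_equiv u HM (multiset_pred_gholds M) H) in Ht.
  assert (Ht' : true_state T u st').
  { destruct Ht as (w & H1 & H2 & _). exists w. split; [|split]; auto. apply K; auto. }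
  apply (true_state_equiv u HM HT H) in Ht'.
  destruct Ht' as (w & _ & _ & H3). unfold T in H3. rewrite Forall_map in H3.
  unfold purely_persistent. revert H3. apply Forall_impl. intros c. apply gpers_ginst.
Qed.

Definition reaches_persistent : state Sg -> Prop :=
  mu (fun B s' => diamond CT (simplification_rules P) B s' \/
      (purely_persistent s' /\ ~ equiv_h CT s' bot)).

Lemma reaches_diamond st st' :
  step_h CT (simplification_rules P) st st' -> reaches_persistent st' -> reaches_persistent st.
Proof.
  intros Hs Hr A HA. apply HA. left. exists st'. split; auto. apply (Hr A); auto.
Qed.

Lemma reaches_base st : purely_persistent st -> ~ equiv_h CT st bot -> reaches_persistent st.
Proof. intros H1 H2 A HA. apply HA. right. auto. Qed.

Lemma reaches_inv st : reaches_persistent st ->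
  (exists st', step_h CT (simplification_rules P) st st' /\ reaches_persistent st') \/
  (purely_persistent st /\ ~ equiv_h CT st bot).
Proof.
  intros H. apply (H (fun s => (exists st', step_h CT (simplification_rules P) s st' /\
    reaches_persistent st') \/ (purely_persistent s /\ ~ equiv_h CT s bot))).
  intros y [(s' & [(s'' & K1 & K2)|[K1 K2]] & K3)|[K1 K2]]; auto; left; exists s'; split; auto.
  - eapply reaches_diamond; eauto.
  - apply reaches_base; auto.
Qed.

Lemma reaches_steps st : reaches_persistent st ->
  exists st', purely_persistent st' /\ ~ equiv_h CT st' bot /\
    steps_h CT (simplification_rules P) st st'.
Proof.
  intros H. apply H. intros y [(s' & (t & K1 & K2 & K3) & K4)|[K1 K2]].
  - exists t. split; [|split]; auto. eapply steps_trans; [|eauto]. apply steps_step; auto.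
  - exists y. split; [|split]; auto. apply steps_equiv, equiv_h_refl.
Qed.

Lemma true_not_bot (M : structure Sg) u st :
  models_CT CT M -> true_state (Forall (@gholds Sg M)) u st -> ~ equiv_h CT st bot.
Proof.
  intros HM Ht H. apply (true_state_equiv u HM (multiset_pred_gholds M) H) in Ht.
  destruct Ht as (w & _ & K & _). inversion K; auto.
Qed.

Lemma simplification_rules_incl : incl (simplification_rules P) P.
Proof. apply incl_filter. Qed.

(** The least fixpoint counts transitions only, whereas derivations interleave equivalences. These
    are absorbed into the next transition or, at the end, into the base case, where truth in the
    model excludes [bot]. *)
Lemma steps_reaches (M : structure Sg) u st st' :
  models_CP CT P M -> steps_h CT (simplification_rules P) st st' ->
  true_state (Forall (@gholds Sg M)) u st -> reaches_persistent st' -> reaches_persistent st.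
Proof.
  intros HM H. induction H as [x y [H|H]|x y z H1 IH1 _ IH2]; intros Ht Hr.
  - eapply reaches_diamond; eauto.
  - destruct (reaches_inv Hr) as [(s & K1 & K2)|[K1 K2]].
    + eapply reaches_diamond; [|exact K2]. eapply step_equiv; eauto using equiv_h_refl.
    + apply reaches_base.
      * eapply purely_persistent_equiv; eauto. apply HM.
      * eapply true_not_bot; eauto. apply HM.
  - apply IH1; auto. apply IH2; auto.
    eapply true_state_steps_forward; [exact HM| |exact Ht].
    eapply steps_mono; [apply simplification_rules_incl|exact H1].
Qed.

Lemma satisfiable_in_semantics L Q E X :
  data_sufficient CT P (St (L ++ Q) E X) -> satisfiable_CP CT P L Q E ->
  hybrid_semantics CT P (St (L ++ Q) E X).
Proof.
  intros Hd (M & HM & v & HL & HQ & HE).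
  (* The set that witnesses the greatest fixpoint: both data-sufficiency and truth in [M] pass to
     successors. *)
  exists (fun s => data_sufficient CT P s /\ true_state (Forall (@gholds Sg M)) v s). split.
  - intros s [Hs Ht]. split.
    + intros s' Hstep. split.
      * intros t Ht'. apply Hs. eapply steps_trans; [|eauto]. apply steps_step; auto.
      * eapply true_state_step_forward; eauto.
    + destruct (Hs s) as (t & Hp & Hst).
      { apply steps_equiv, equiv_h_refl. }
      eapply steps_reaches; eauto. apply reaches_base; auto.
      eapply true_not_bot; [apply HM|]. eapply true_state_steps_forward; [exact HM| |exact Ht].
      eapply steps_mono; [apply simplification_rules_incl|exact Hst].
  - split; auto. exists v. simpl. split; [|split]; auto.
    apply gholds_store. apply Forall_app. auto.
Qed.

End Completeness.

(** * Truth of linear constraints *)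

Definition fin_index {n} (i : Fin.t n) : var := proj1_sig (Fin.to_nat i).

Definition fin_extend {D : Type} {n} (a : Fin.t n -> D) (d : var -> D) : var -> D :=
  fun x => match lt_dec x n with left h => a (Fin.of_nat_lt h) | right _ => d x end.

Lemma fin_index_lt {n} (i : Fin.t n) : fin_index i < n.
Proof. exact (proj2_sig (Fin.to_nat i)). Qed.

Lemma fin_extend_index {D : Type} {n} (a : Fin.t n -> D) d i :
  fin_extend a d (fin_index i) = a i.
Proof.
  unfold fin_extend, fin_index. destruct (lt_dec _ n) as [h|h].
  - f_equal. rewrite <- (Fin.of_nat_to_nat_inv i). apply Fin.of_nat_ext.
  - destruct h. exact (proj2_sig (Fin.to_nat i)).
Qed.

Lemma fin_extend_ge {D : Type} {n} (a : Fin.t n -> D) d x : n <= x -> fin_extend a d x = d x.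
Proof. intros H. unfold fin_extend. destruct (lt_dec x n); auto; lia. Qed.

Lemma fin_list n : exists l : list (Fin.t n), forall i, In i l.
Proof.
  induction n as [|n (l & Hl)].
  - exists []. intros i. exact (Fin.case0 (fun i => In i []) i).
  - exists (Fin.F1 :: map Fin.FS l). intros i. apply (Fin.caseS' i).
    + simpl; auto.
    + intros j. right. apply in_map, Hl.
Qed.

(** * Atoms with equal ground instances *)

Section Matching.
Context {Sg : signature} (CT : theory Sg) {M : structure Sg}.

(** Every atom of [p] is a substitution instance of this one, so replacing the arguments of an atom
    is a change of substitution. *)
Definition generic_chr (p : csym Sg) : chr Sg := Chr p (fun i => Var (fin_index i)).

Lemma subst_generic_chr (p : csym Sg) a d :
  subst_chr (fin_extend a d) (generic_chr p) = Chr p a.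
Proof.
  simpl. f_equal. apply functional_extensionality. intros i. apply fin_extend_index.
Qed.

(** Equal ground atoms have the same symbol, and the equations between their arguments hold under
    [u]. A store that contains these equations cannot distinguish the two lists, so a rule can be
    matched although its head agrees with the store only semantically. *)
Lemma match_atoms (u : valuation M) (l1 l2 : list (chr Sg)) :
  map (ginst u) l1 = map (ginst u) l2 ->
  exists EQ, holds_builtins u EQ /\
    (forall y, fv_builtins EQ y -> fv_store l1 y \/ fv_store l2 y) /\
    forall S F Y, incl EQ F -> equiv_h CT (St (l1 ++ S) F Y) (St (l2 ++ S) F Y).
Proof.
  revert l2. induction l1 as [|c1 l1 IH]; intros [|c2 l2] H; try discriminate.
  - exists []. split; [constructor|split]; auto using equiv_h_refl.
    intros y Hy. inversion Hy.
  - injection H as H1 H2. destruct (IH l2 H2) as (EQ & K1 & K2 & K3).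
    destruct c1 as [p a], c2 as [p' a']. simpl in H1.
    assert (e : p = p') by exact (f_equal (@projT1 _ _) H1). subst p'.
    apply inj_pair2 in H1.
    destruct (fin_list (carity Sg p)) as [fl Hfl].
    exists (map (fun i => BEq (a i) (a' i)) fl ++ EQ). split; [|split].
    + apply holds_builtins_app. split; auto. unfold holds_builtins.
      rewrite Forall_map, Forall_forall. intros i _. exact (f_equal (fun f => f i) H1).
    + intros y Hy. rewrite !fv_store_cons. apply fv_builtins_app in Hy.
      destruct Hy as [Hy|Hy]; [|specialize (K2 y Hy); tauto].
      apply fv_builtins_in in Hy. destruct Hy as (b & Hb & Hy).
      apply in_map_iff in Hb. destruct Hb as (i & <- & _). simpl in *.
      destruct Hy; eauto.
    + intros S F Y HI. apply incl_app_inv in HI. destruct HI as [I1 I2].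
      apply equiv_h_trans with (St (Chr p a' :: l1 ++ S) F Y).
      * rewrite <- (subst_generic_chr p a Var), <- (subst_generic_chr p a' Var).
        apply (@subst_cong Sg CT [generic_chr p] (l1 ++ S)).
        intros x Hx N HN v Hv. apply fv_store_in in Hx.
        destruct Hx as (c & [<-|[]] & i & Hi). simpl in Hi. subst x.
        rewrite !fin_extend_index.
        unfold holds_builtins in Hv. rewrite Forall_forall in Hv.
        apply (Hv (BEq (a i) (a' i))). apply I1, in_map_iff. eauto.
      * apply equiv_h_trans with (St (l1 ++ Chr p a' :: S) F Y).
        { apply equiv_h_perm, Permutation_middle. }
        eapply equiv_h_trans; [apply K3; auto|].
        apply equiv_h_perm. simpl. apply Permutation_sym, Permutation_middle.
Qed.

End Matching.

(** * Multisets of linear atoms that rewrite to the empty multiset *)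

Section LinearTruth.
Context {Sg : signature} (CT : theory Sg) (Q : program Sg) (M : structure Sg).

Definition glinear (g : gatom M) : bool := negb (persistent_sym Sg (projT1 g)).

Definition gtrue_persistent (g : gatom M) : Prop := gpers g -> gholds g.

(** The witness [w] also fixes the local variables of the rule, unlike in a transition. *)
Inductive linear_truth : list (gatom M) -> Prop :=
| lt_nil : linear_truth []
| lt_perm l l' : Permutation l l' -> linear_truth l -> linear_truth l'
| lt_rule r (w : valuation M) l :
    In r Q -> holds_builtins w (guard r) -> holds_builtins w (body_builtin r) ->
    Forall gtrue_persistent (map (ginst w) (body_chr r ++ kept r)) ->
    linear_truth (filter glinear (map (ginst w) (body_chr r)) ++ l) ->
    linear_truth (map (ginst w) (removed r) ++ l).

Definition store_truth (l : list (gatom M)) : Prop :=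
  Forall gtrue_persistent l /\ linear_truth (filter glinear l).

Hypothesis HQ : forall r, In r Q -> hybrid_rule r /\ removed r <> [].

Lemma glinear_ginst_persistent (w : valuation M) S :
  Forall persistent S -> filter glinear (map (ginst w) S) = [].
Proof.
  induction 1 as [|c S Hc _ IH]; simpl; auto.
  destruct c as [p a]. unfold glinear at 1. simpl in *. rewrite Hc. simpl. auto.
Qed.

Lemma glinear_ginst_linear (w : valuation M) S :
  Forall linear S -> filter glinear (map (ginst w) S) = map (ginst w) S.
Proof.
  induction 1 as [|c S Hc _ IH]; simpl; auto.
  destruct c as [p a]. unfold glinear at 1. simpl in *. rewrite Hc. simpl. f_equal; auto.
Qed.

Lemma gtrue_persistent_linear (w : valuation M) S :
  Forall linear S -> Forall gtrue_persistent (map (ginst w) S).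
Proof.
  intros H. rewrite Forall_map. revert H. apply Forall_impl.
  intros [p a] Hc. unfold gtrue_persistent, gpers. simpl in *. congruence.
Qed.

Lemma filter_permutation {A} (f : A -> bool) l l' :
  Permutation l l' -> Permutation (filter f l) (filter f l').
Proof.
  induction 1 as [|x l l' _ IH|x y l|l1 l2 l3 _ IH1 _ IH2]; simpl; auto.
  - destruct (f x); auto.
  - destruct (f x), (f y); auto. apply perm_swap.
  - eapply perm_trans; eauto.
Qed.

Lemma store_truth_multiset : multiset_pred store_truth.
Proof.
  split.
  - intros l l' HP [H1 H2]. split.
    + eapply Permutation_Forall; eauto.
    + eapply lt_perm; [apply filter_permutation; eauto|auto].
  - intros g l Hg. unfold store_truth. simpl.
    assert (e : glinear g = false) by (unfold glinear; rewrite Hg; reflexivity).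
    rewrite e, !Forall_cons_iff. tauto.
Qed.

Lemma store_truth_backward : backward_closed store_truth Q.
Proof.
  intros r w l Hr HG HC [H1 H2]. destruct (HQ r Hr) as [(_ & Hk & Hh) _].
  unfold store_truth. rewrite !map_app, Forall_app in *. split.
  - split; [|tauto]. apply Forall_app. split; [|apply gtrue_persistent_linear; auto].
    destruct H1 as [H1 _]. apply Forall_app in H1. tauto.
  - rewrite !filter_app, (glinear_ginst_persistent _ Hk), (glinear_ginst_linear _ Hh) in *.
    simpl. eapply lt_rule; eauto.
    + rewrite map_app. tauto.
    + rewrite app_nil_r in H2. auto.
Qed.

(** The rewriting of [l] to the empty multiset runs unchanged beside [l']. *)
Lemma linear_truth_app l l' : linear_truth l -> linear_truth l' -> linear_truth (l ++ l').
Proof.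
  intros H H'. induction H as [|l1 l2 HP _ IH|r w l Hr HG HC HB _ IH]; auto.
  - eapply lt_perm; [apply Permutation_app_tail; eauto|auto].
  - rewrite <- app_assoc. eapply lt_rule; eauto. rewrite app_assoc. auto.
Qed.

Lemma linear_truth_linear l : linear_truth l -> Forall (fun g => glinear g = true) l.
Proof.
  induction 1 as [|l1 l2 HP _ IH|r w l Hr HG HC HB _ IH].
  - constructor.
  - eapply Permutation_Forall; eauto.
  - apply Forall_app in IH. apply Forall_app. split; [|tauto].
    destruct (HQ r Hr) as [(_ & _ & Hh) _]. rewrite Forall_map. revert Hh.
    apply Forall_impl. intros [p a] Hc. unfold glinear. simpl in *. rewrite Hc. auto.
Qed.

Hypothesis HM : models_CT CT M.

(** A simplification removes at least one linear atom, so a state with a true instance free of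
    linear atoms has no transition; what remains are equivalences, which preserve truth. Phrasing
    the property by [true_state] makes it invariant under them. *)
Lemma stuck_without_linear u st st' :
  steps_h CT Q st st' ->
  true_state (fun l => Forall gtrue_persistent l /\ filter glinear l = []) u st ->
  true_state (fun l => Forall gtrue_persistent l /\ filter glinear l = []) u st'.
Proof.
  set (T := fun l => Forall gtrue_persistent l /\ filter glinear l = []).
  assert (HT : multiset_pred T).
  { split.
    - intros l l' HP [H1 H2]. split.
      + eapply Permutation_Forall; eauto.
      + apply (filter_permutation glinear) in HP. rewrite H2 in HP.
        apply Permutation_nil; auto.
    - intros g l Hg. unfold T. simpl.
      assert (e : glinear g = false) by (unfold glinear; rewrite Hg; reflexivity).
      rewrite e, !Forall_cons_iff. tauto. }
  assert (Hstep : forall s s', step_h CT Q s s' -> true_state T u s -> False).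
  { intros s s' H. induction H as [r0 r rho D E X Hr Hrho Er Hf|s s' t t' H1 H2 IH H3].
    - intros (w & _ & _ & _ & Hl). subst r. destruct (HQ r0 Hr) as [(_ & _ & Hh) Hn].
      simpl in Hl. rewrite !map_app, !filter_app in Hl.
      rewrite (@glinear_ginst_linear w (map (subst_chr (renaming rho)) (removed r0))) in Hl.
      + apply app_eq_nil in Hl. destruct Hl as [_ Hl]. apply app_eq_nil in Hl.
        destruct Hl as [Hl _]. destruct (removed r0); auto. discriminate.
      + rewrite Forall_map. revert Hh. apply Forall_impl. intros c. apply linear_subst.
    - intros Ht. apply IH. apply (true_state_equiv u HM HT H1). auto. }
  intros H. induction H as [x y [H|H]|x y z _ IH1 _ IH2]; auto.
  - intros Ht. exfalso. eauto.
  - apply (true_state_equiv u HM HT H).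
Qed.

Lemma filter_partition {A} (f : A -> bool) l :
  Permutation l (filter f l ++ filter (fun x => negb (f x)) l).
Proof.
  induction l as [|x l IH]; simpl; auto. destruct (f x); simpl; auto.
  apply Permutation_cons_app. auto.
Qed.

Definition linearb (c : chr Sg) : bool :=
  match c with Chr p _ => negb (persistent_sym Sg p) end.

Lemma filter_glinear_map (w : valuation M) S :
  filter glinear (map (ginst w) S) = map (ginst w) (filter linearb S).
Proof.
  induction S as [|[p a] S IH]; simpl; auto. unfold glinear at 1. simpl.
  destruct (negb (persistent_sym Sg p)); simpl; rewrite IH; auto.
Qed.

Hypothesis Hconf : confluent CT Q.

(** If the multiset is true by first applying the rule [r], a reduct of the state and the
    result of applying [r] have a common reduct by confluence; truth is inherited by it from
    the latter and from it by the former. *)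
Lemma linear_truth_stable l :
  linear_truth l -> forall (u : valuation M) st,
    holds_builtins u (builtins st) ->
    Forall gtrue_persistent (map (ginst u) (store st)) ->
    Permutation l (filter glinear (map (ginst u) (store st))) ->
    forall st', steps_h CT Q st st' -> true_state store_truth u st'.
Proof.
  induction 1 as [|l1 l2 HP _ IH|r w l Hr HG HC HB _ IH]; intros u st Hb Hp Hl st' Hst.
  - apply Permutation_nil in Hl.
    destruct (@stuck_without_linear u st st' Hst) as (v & H1 & H2 & H3 & H4).
    + exists u. auto.
    + exists v. split; [|split; [|split]]; auto. rewrite H4. constructor.
  - apply (IH u st); auto. eapply perm_trans; eauto.
  - destruct (HQ r Hr) as [(_ & Hk & Hh) _].
    destruct st as [S E X]. simpl in *.
    destruct (fv_store_bounded S) as [n1 B1].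
    destruct (fv_builtins_bounded E) as [n2 B2].
    (* The globals of [st'] are made global in the enlarged states as well, so that the valuation
       obtained at the end agrees with [u] on them. *)
    set (Y := X ++ globals st').
    destruct (globals_bounded Y) as [n3 B3].
    set (N := n1 + n2 + n3).
    set (phi := fun x => x + N).
    (* One valuation for both: [u] on the state and the witness [w] on the renamed rule. *)
    set (u' := shift_valuation N u w).
    assert (U1 : forall x, x < N -> u' x = u x) by (intros; apply shift_valuation_lt; auto).
    assert (U2 : esubst u' (renaming phi) = w).
    { apply functional_extensionality. intros x. apply shift_valuation_add. }
    assert (Hphi : Injective phi) by (intros x y; unfold phi; lia).
    set (r' := rename_rule phi r).
    assert (GI : forall S0, map (ginst u') (map (subst_chr (renaming phi)) S0) = map (ginst w) S0).
    { intros S0. rewrite ginst_store_subst, U2. auto. }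
    assert (HI : forall E0, holds_builtins u' (map (subst_builtin (renaming phi)) E0) <->
      holds_builtins w E0).
    { intros E0. rewrite holds_builtins_subst, U2. tauto. }
    assert (US : map (ginst u') S = map (ginst u) S).
    { apply ginst_store_ext. intros x Hx. apply U1. specialize (B1 _ Hx). lia. }
    rewrite <- US, filter_glinear_map in Hl.
    (* Pulls the ground multiset back to the store: [Hs] are the atoms instantiated to the removed
       head, [Ds] those instantiated to the rest [l]. *)
    destruct (Permutation_map_inv _ _ Hl) as (Sl & e & HSl).
    symmetry in e. apply map_eq_app in e. destruct e as (Hs & Ds & -> & eH & eD).
    set (Sp := filter (fun c => negb (linearb c)) S).
    assert (HPS : Permutation S ((Hs ++ Ds) ++ Sp)).
    { eapply perm_trans; [apply (filter_partition linearb)|].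
      apply Permutation_app_tail. auto. }
    assert (BS : forall x, fv_store (Hs ++ Ds ++ Sp) x -> x < N).
    { intros x Hx. assert (x < n1); [|lia]. apply B1. apply fv_store_in in Hx.
      destruct Hx as (c & Hc & Hx). apply fv_store_in. exists c. split; auto.
      eapply Permutation_in; [apply Permutation_sym, HPS|]. rewrite <- app_assoc. auto. }
    rewrite <- GI in eH.
    destruct (match_atoms CT u' Hs (removed r') eH) as (EQ & Q1 & Q2 & Q3).
    (* The ground rule need not apply to the state itself. Adding the kept head, the guard and the
       matching equations, all true under [u'], makes it apply; the linear part stays the same
       because the kept head is persistent. *)
    set (st0 := St (S ++ kept r') (E ++ guard r' ++ EQ) Y).
    set (st1 := St (body_chr r' ++ kept r' ++ Ds ++ Sp) (body_builtin r' ++ guard r' ++ E ++ EQ) Y).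
    assert (Step : step_h CT Q st0 st1).
    { eapply step_intro with (r0 := r) (rho := phi) (S0 := Ds ++ Sp) (E := E ++ EQ) (X := Y); auto.
      - intros x Hx. assert (Hx' := Hx). apply lv_rename in Hx'; auto.
        destruct Hx' as (z & Hz & ->). unfold phi in *. split; [|split].
        + intros F. assert (z + N < N); [|lia]. apply BS. rewrite fv_store_app. auto.
        + rewrite fv_builtins_app. intros [F|F].
          * specialize (B2 _ F). lia.
          * apply Q2 in F. destruct F as [F|F].
            -- assert (z + N < N); [|lia]. apply BS. rewrite fv_store_app. auto.
            -- destruct Hx as [_ Hx]. apply Hx. right. exact F.
        + intros F. specialize (B3 _ F). lia.
      - fold r'. unfold st0.
        apply equiv_h_trans with (St (Hs ++ kept r' ++ Ds ++ Sp) (guard r' ++ E ++ EQ) Y).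
        + eapply equiv_h_trans.
          * apply equiv_h_perm.
            eapply perm_trans; [apply Permutation_app_tail, HPS|].
            rewrite <- !app_assoc. apply Permutation_app_head.
            rewrite app_assoc. apply Permutation_app_comm.
          * apply equiv_h_entails; intros M' HM' v; rewrite !holds_builtins_app; tauto.
        + eapply equiv_h_trans; [apply Q3|].
          * intros b Hb0. rewrite !in_app_iff. auto.
          * apply equiv_h_perm. apply Permutation_app_swap_app.
      - apply equiv_h_refl. }
    (* The given derivation is replayed from [st0], which makes its result comparable by confluence
       with [st1]. *)
    destruct (@steps_refine Sg CT Q (St S E X) st' Var (kept r') (guard r' ++ EQ) Y Hst)
      as (th & F' & Hth & Hst').
    simpl in Hst'. rewrite subst_store_var, subst_builtins_var in Hst'.
    destruct (Hconf (steps_step Step) Hst') as (st2 & S1 & S2).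
    assert (PS : Forall gtrue_persistent (map (ginst u') (Hs ++ Ds ++ Sp))).
    { rewrite <- US in Hp. eapply Permutation_Forall; [|exact Hp].
      apply Permutation_map. rewrite app_assoc. auto. }
    rewrite map_app, Forall_app in PS. destruct PS as [_ PS].
    rewrite map_app, Forall_app in HB. destruct HB as [HB HK].
    assert (T2 : true_state store_truth u' st2).
    { apply (IH u' st1); auto; simpl.
      - rewrite !holds_builtins_app, !HI. split; [|split; [|split]]; auto.
        apply (holds_builtins_ext u); auto. intros x Hx. symmetry. apply U1.
        specialize (B2 _ Hx). lia.
      - rewrite map_app, Forall_app, GI. split; auto.
        rewrite map_app, Forall_app, GI. split; auto.
      - rewrite !map_app, !filter_app, !GI.
        rewrite (glinear_ginst_persistent w Hk). simpl.
        rewrite (filter_glinear_map u' Ds), (filter_glinear_map u' Sp).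
        assert (e1 : filter linearb Ds = Ds).
        { apply forallb_filter_id. apply forallb_forall. intros c Hc.
          assert (Hc' : In c (filter linearb S)).
          { eapply Permutation_in; [apply Permutation_sym, HSl|]. apply in_app_iff. auto. }
          apply filter_In in Hc'. tauto. }
        assert (e2 : filter linearb Sp = []).
        { unfold Sp. clear. induction S as [|c S IH]; simpl; auto.
          destruct (linearb c) eqn:e; simpl; auto. rewrite e. auto. }
        rewrite e1, e2, eD. simpl. rewrite app_nil_r. auto. }
    apply (true_state_steps_backward HM store_truth_multiset store_truth_backward S2) in T2.
    destruct T2 as (v & V1 & V2 & V3). simpl in V1, V2, V3.
    (* Reading the replayed state through [th] gives an instance of [st'] itself; dropping the added
       persistent atoms leaves its linear part unchanged. *)
    exists (esubst v th). split; [|split].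
    + intros x Hx. unfold esubst. rewrite Hth by auto. simpl.
      assert (HxY : In x Y) by (apply in_app_iff; auto).
      rewrite V1 by auto. apply U1. specialize (B3 _ HxY). lia.
    + apply holds_builtins_app in V2. apply holds_builtins_subst. tauto.
    + rewrite <- ginst_store_subst. destruct V3 as [V3 V4].
      rewrite map_app, filter_app in V4. rewrite map_app, Forall_app in V3.
      rewrite (@glinear_ginst_persistent v (map (subst_chr (renaming phi)) (kept r))), app_nil_r in V4.
      * split; tauto.
      * apply persistent_subst_store. auto.
Qed.

End LinearTruth.

(** * The chase *)

Definition fv_state {Sg : signature} (s : state Sg) (x : var) : Prop :=
  fv_store (store s) x \/ fv_builtins (builtins s) x.

(** [New s s' v x] names the local variable [x] of [s'] when the derivation from [s] to [s']
    is performed with the variables of [s] interpreted by [v]. *)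
Inductive name (Sg : signature) : Type :=
| Base (x : var)
| New (s s' : state Sg) (v : var -> name Sg) (x : var).
Arguments Base {Sg} x.

(** Ground statements of the chase: an atom with names for its variables, or [ID u], saying that [u]
    belongs to the domain. *)
Inductive item (Sg : signature) : Type :=
| IB (b : builtin Sg) (v : var -> name Sg)
| IC (c : chr Sg) (v : var -> name Sg)
| ID (u : name Sg).

Definition extend_names {Sg : signature} (s s' : state Sg) (v : var -> name Sg) (x : var) : name Sg :=
  if excluded_middle_informative (fv_state s' x /\ ~ In x (globals s'))
  then New s s' v x else v x.

Inductive result {Sg : signature} (s s' : state Sg) (v : var -> name Sg) : item Sg -> Prop :=
| result_builtin b : In b (builtins s') -> result s s' v (IB b (extend_names s s' v))
| result_chr c : In c (store s') -> result s s' v (IC c (extend_names s s' v))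
| result_name x : fv_state s' x -> ~ In x (globals s') -> result s s' v (ID (New s s' v x)).

Definition base_names {Sg : signature} (m : nat) (x : var) : name Sg :=
  if x <? m then Base x else Base 0.

(** Requiring all variables of [s] to be global leaves none of them existential, so whether a
    derivation fires depends on ground facts alone. The last two constructors identify the
    presentations of one ground atom by different variables. *)
Inductive fact {Sg : signature} (CT : theory Sg) (P : program Sg) (t0 : state Sg) (m0 : nat)
  : item Sg -> Prop :=
| fact_base_name x : x < m0 -> fact CT P t0 m0 (ID (Base x))
| fact_base_builtin b : In b (builtins t0) -> fact CT P t0 m0 (IB b (base_names m0))
| fact_base_chr c : In c (store t0) -> fact CT P t0 m0 (IC c (base_names m0))
| fact_result s s' v i :
    purely_persistent s -> (forall x, fv_state s x -> In x (globals s)) ->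
    purely_persistent s' -> steps_h CT P s s' ->
    (forall x, fact CT P t0 m0 (ID (v x))) ->
    (forall b, In b (builtins s) -> fact CT P t0 m0 (IB b v)) ->
    (forall c, In c (store s) -> fact CT P t0 m0 (IC c v)) ->
    result s s' v i -> fact CT P t0 m0 i
| fact_builtin_rename b rho rho' v v' :
    fact CT P t0 m0 (IB (subst_builtin (renaming rho) b) v) ->
    (forall x, fv_builtin b x -> v (rho x) = v' (rho' x)) ->
    fact CT P t0 m0 (IB (subst_builtin (renaming rho') b) v')
| fact_chr_rename c rho rho' v v' :
    fact CT P t0 m0 (IC (subst_chr (renaming rho) c) v) ->
    (forall x, fv_chr c x -> v (rho x) = v' (rho' x)) ->
    fact CT P t0 m0 (IC (subst_chr (renaming rho') c) v').

Section Chase.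
Context {Sg : signature} (CT : theory Sg) (P : program Sg).
Variable R : state Sg -> Prop.
Hypothesis R_steps : forall s t, R s -> steps_h CT P s t -> R t.
(** This syntactic condition expresses consistency, because [R] is closed under equivalence and an
    unsatisfiable state is equivalent to one whose built-in is [BFalse]. *)
Hypothesis R_consistent : forall s, R s -> ~ In BFalse (builtins s).
Variables (t0 : state Sg) (m0 : nat).
Hypothesis Ht0 : purely_persistent t0.
Hypothesis Rt0 : R t0.
Hypothesis Hm0 : 0 < m0.
Hypothesis Bt0 : forall x, fv_state t0 x \/ In x (globals t0) -> x < m0.

Notation fact := (fact CT P t0 m0).

Lemma fact_builtin_agree b v v' :
  fact (IB b v) -> (forall x, fv_builtin b x -> v x = v' x) -> fact (IB b v').
Proof.
  intros H Hv. rewrite <- (subst_builtin_var b) in *.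
  apply (@fact_builtin_rename Sg CT P t0 m0 b (fun x => x) (fun x => x) v v'); auto.
  intros x Hx. apply Hv. apply fv_subst_builtin. exists x. simpl. auto.
Qed.

Lemma fact_chr_agree c v v' :
  fact (IC c v) -> (forall x, fv_chr c x -> v x = v' x) -> fact (IC c v').
Proof.
  intros H Hv. rewrite <- (subst_chr_var c) in *.
  apply (@fact_chr_rename Sg CT P t0 m0 c (fun x => x) (fun x => x) v v'); auto.
  intros x Hx. apply Hv. apply fv_subst_chr. exists x. simpl. auto.
Qed.

Lemma fact_builtin_to_rename b v rho v' :
  fact (IB b v) -> (forall x, fv_builtin b x -> v x = v' (rho x)) ->
  fact (IB (subst_builtin (renaming rho) b) v').
Proof.
  intros H Hv. apply (@fact_builtin_rename Sg CT P t0 m0 b (fun x => x) rho v v'); auto.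
  change (renaming (fun x => x)) with (@Var Sg). rewrite subst_builtin_var. auto.
Qed.

Lemma fact_builtin_of_rename b v rho v' :
  fact (IB (subst_builtin (renaming rho) b) v') ->
  (forall x, fv_builtin b x -> v' (rho x) = v x) -> fact (IB b v).
Proof.
  intros H Hv. rewrite <- (subst_builtin_var b).
  apply (@fact_builtin_rename Sg CT P t0 m0 b rho (fun x => x) v' v); auto.
Qed.

Lemma fact_chr_to_rename c v rho v' :
  fact (IC c v) -> (forall x, fv_chr c x -> v x = v' (rho x)) ->
  fact (IC (subst_chr (renaming rho) c) v').
Proof.
  intros H Hv. apply (@fact_chr_rename Sg CT P t0 m0 c (fun x => x) rho v v'); auto.
  change (renaming (fun x => x)) with (@Var Sg). rewrite subst_chr_var. auto.
Qed.

Lemma fact_chr_of_rename c v rho v' :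
  fact (IC (subst_chr (renaming rho) c) v') ->
  (forall x, fv_chr c x -> v' (rho x) = v x) -> fact (IC c v).
Proof.
  intros H Hv. rewrite <- (subst_chr_var c).
  apply (@fact_chr_rename Sg CT P t0 m0 c rho (fun x => x) v' v); auto.
Qed.

(** ** Finitely many facts come from one reachable state *)

Definition covered (S : list (chr Sg)) (E : list (builtin Sg)) (N : name Sg -> Prop)
  (iota : name Sg -> var) (i : item Sg) : Prop :=
  match i with
  | IB b v => (forall x, fv_builtin b x -> N (v x)) /\
      In (subst_builtin (renaming (fun x => iota (v x))) b) E
  | IC c v => (forall x, fv_chr c x -> N (v x)) /\
      In (subst_chr (renaming (fun x => iota (v x))) c) S
  | ID u => N u
  end.

(** A reachable purely persistent state whose variables are named by [nm]; [iota] is the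
    inverse of [nm] on the set [cnames] of the names used.  [cfired] prevents a name from being
    used before the facts on it are present. *)
Record cover := {
  cstore : list (chr Sg);
  cbuiltins : list (builtin Sg);
  cnames : name Sg -> Prop;
  iota : name Sg -> var;
  nm : var -> name Sg;
  cbound : nat;
  creach : R (St cstore cbuiltins (globals t0));
  cpers : Forall persistent cstore;
  cname : forall u, cnames u -> fact (ID u) /\ iota u < cbound /\ nm (iota u) = u;
  cnm : forall y, fact (ID (nm y));
  cfv : forall y, fv_store cstore y \/ fv_builtins cbuiltins y \/ In y (globals t0) ->
    cnames (nm y) /\ iota (nm y) = y;
  csound_b : forall b, In b cbuiltins -> fact (IB b nm);
  csound_c : forall c, In c cstore -> fact (IC c nm);
  cfired : forall s s' v x, cnames (New s s' v x) ->
    forall i, result s s' v i -> covered cstore cbuiltins cnames iota i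
}.



Arguments cname : clear implicits.
Arguments cfv : clear implicits.
Arguments csound_b : clear implicits.
Arguments csound_c : clear implicits.
Arguments cfired : clear implicits.

Definition covers (C : cover) (i : item Sg) : Prop :=
  covered (cstore C) (cbuiltins C) (cnames C) (iota C) i.

Definition cover_le (C C' : cover) : Prop :=
  (forall u, cnames C u -> cnames C' u /\ iota C' u = iota C u) /\
  incl (cstore C) (cstore C') /\ incl (cbuiltins C) (cbuiltins C').

Lemma cover_le_refl C : cover_le C C.
Proof. split; [|split]; auto using incl_refl. Qed.

Lemma cover_le_trans C C' C'' : cover_le C C' -> cover_le C' C'' -> cover_le C C''.
Proof.
  intros (H1 & H2 & H3) (K1 & K2 & K3). split; [|split]; eauto using incl_tran.
  intros u Hu. destruct (H1 u Hu) as [L1 L2], (K1 u L1) as [L3 L4]. split; congruence.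
Qed.

Lemma covered_mono S E (N : name Sg -> Prop) io S' E' (N' : name Sg -> Prop) io' i :
  (forall u, N u -> N' u /\ io' u = io u) -> incl S S' -> incl E E' ->
  covered S E N io i -> covered S' E' N' io' i.
Proof.
  intros H1 H2 H3. destruct i as [b v|c v|u]; simpl.
  - intros [K1 K2]. split; [intros x Hx; apply H1; auto|].
    rewrite (subst_builtin_ext _ (renaming (fun x => io (v x)))); auto.
    intros x Hx. unfold renaming. f_equal. apply H1; auto.
  - intros [K1 K2]. split; [intros x Hx; apply H1; auto|].
    rewrite (subst_chr_ext _ (renaming (fun x => io (v x)))); auto.
    intros x Hx. unfold renaming. f_equal. apply H1; auto.
  - intros K. apply H1; auto.
Qed.

Lemma covers_mono C C' i : cover_le C C' -> covers C i -> covers C' i.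
Proof. intros (H1 & H2 & H3). apply covered_mono; auto. Qed.

Definition base_iota (u : name Sg) : var := match u with Base x => x | New _ _ _ _ => 0 end.

Lemma base_names_lt x : x < m0 -> base_names m0 x = @Base Sg x.
Proof. intros H. unfold base_names. destruct (Nat.ltb_spec x m0); auto; lia. Qed.

Lemma base_names_fact x : fact (ID (base_names m0 x)).
Proof. unfold base_names. destruct (Nat.ltb_spec x m0); apply fact_base_name; auto. Qed.

Lemma initial_cover : exists C : cover,
  (forall x, x < m0 -> cnames C (Base x) /\ iota C (Base x) = x) /\
  cstore C = store t0 /\ cbuiltins C = builtins t0.
Proof.
  unshelve eexists {| cstore := store t0; cbuiltins := builtins t0;
    cnames := fun u => exists x, x < m0 /\ u = Base x;
    iota := base_iota; nm := base_names m0; cbound := m0 |}.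
  - destruct t0; auto.
  - exact Ht0.
  - intros u (x & Hx & ->). split; [|split]; simpl; auto using fact_base_name, base_names_lt.
  - apply base_names_fact.
  - intros y Hy. assert (y < m0).
    { apply Bt0. unfold fv_state. tauto. }
    rewrite base_names_lt by auto. simpl. eauto.
  - apply fact_base_builtin.
  - apply fact_base_chr.
  - intros s s' v x (y & _ & H). discriminate.
  - simpl. split; auto. intros x Hx. split; eauto.
Qed.

Lemma extend_names_in s s' v x : In x (globals s') -> extend_names s s' v x = v x :> name Sg.
Proof. intros H. unfold extend_names. destruct excluded_middle_informative; tauto. Qed.

Lemma extend_names_new s s' v x : fv_state s' x -> ~ In x (globals s') ->
  extend_names s s' v x = New s s' v x :> name Sg.
Proof. intros H H'. unfold extend_names. destruct excluded_middle_informative; tauto. Qed.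

Lemma extend_names_fact s s' v :
  purely_persistent s -> (forall x, fv_state s x -> In x (globals s)) ->
  purely_persistent s' -> steps_h CT P s s' ->
  (forall x, fact (ID (v x))) ->
  (forall b, In b (builtins s) -> fact (IB b v)) ->
  (forall c, In c (store s) -> fact (IC c v)) ->
  (forall x, fact (ID (extend_names s s' v x))) /\
  (forall b, In b (builtins s') -> fact (IB b (extend_names s s' v))) /\
  (forall c, In c (store s') -> fact (IC c (extend_names s s' v))).
Proof.
  intros H1 H2 H3 H4 H5 H6 H7. split; [|split].
  - intros x. unfold extend_names. destruct excluded_middle_informative as [[K1 K2]|]; auto.
    eapply fact_result with (s := s) (s' := s'); eauto. apply result_name; auto.
  - intros b Hb. eapply fact_result with (s := s) (s' := s'); eauto. apply result_builtin; auto.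
  - intros b Hb. eapply fact_result with (s := s) (s' := s'); eauto. apply result_chr; auto.
Qed.

(** The instance of [s] is contained in the reachable state of [C], so the derivation can be run
    beside that state, and its local variables [x] settle at [x + N]. The union of both is again
    reachable. *)
Lemma cover_fire C s s' v :
  purely_persistent s -> (forall x, fv_state s x -> In x (globals s)) ->
  purely_persistent s' -> steps_h CT P s s' ->
  (forall x, fact (ID (v x))) ->
  (forall b, In b (builtins s) -> fact (IB b v)) ->
  (forall c, In c (store s) -> fact (IC c v)) ->
  (forall x, In x (globals s ++ globals s') -> covers C (ID (v x))) ->
  (forall b, In b (builtins s) -> covers C (IB b v)) ->
  (forall c, In c (store s) -> covers C (IC c v)) ->
  exists C', cover_le C C' /\ forall i, result s s' v i -> covers C' i.
Proof.
  intros H1 H2 H3 H4 H5 H6 H7 C1 C2 C3.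
  (* A name of this firing that is already in use shows that the firing has been performed.
     Otherwise all its names are new, and [iota] can be extended without conflict. *)
  destruct (classic (exists x, cnames C (New s s' v x))) as [(x & Hx)|Hnew].
  { exists C. split; [apply cover_le_refl|]. intros i Hi. apply (cfired C _ _ _ _ Hx _ Hi). }
  destruct (extend_names_fact H1 H2 H3 H4 H5 H6 H7) as (X1 & X2 & X3).
  set (N := cbound C + 1).
  (* [plug] asks for a renaming below [N] on all variables, including those whose names are not
     covered; these are sent to 0, and the 1 in [N] keeps 0 below it. *)
  set (er := fun x => let y := iota C (v x) in if y <? cbound C then y else 0).
  set (loc := fun x => fv_state s' x /\ ~ In x (globals s')).
  assert (Her : forall x, er x < N).
  { intros x. unfold er, N. destruct (Nat.ltb_spec (iota C (v x)) (cbound C)); lia. }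
  assert (Her' : forall x, cnames C (v x) -> er x = iota C (v x)).
  { intros x Hx. destruct (cname C _ Hx) as (_ & L & _). unfold er.
    destruct (Nat.ltb_spec (iota C (v x)) (cbound C)); lia. }
  assert (BC : forall y, fv_store (cstore C) y \/ fv_builtins (cbuiltins C) y \/ In y (globals t0) -> y < cbound C).
  { intros y Hy. destruct (cfv C y Hy) as [K1 K2]. destruct (cname C _ K1) as (_ & L & _). lia. }
  set (pl := plug (renaming er) N (cstore C) (cbuiltins C) (globals t0)).
  set (rho' := fun x => if in_dec Nat.eq_dec x (globals s') then er x else x + N).
  assert (Epl : plug_subst (renaming er) N (globals s') = renaming (Sg := Sg) rho').
  { apply functional_extensionality. intros x. unfold plug_subst, renaming, rho'.
    destruct in_dec; auto. }
  set (S' := map (subst_chr (renaming rho')) (store s') ++ cstore C).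
  set (E' := map (subst_builtin (renaming rho')) (builtins s') ++ cbuiltins C).
  assert (Reach : R (St S' E' (globals t0))).
  { apply R_steps with (St (cstore C) (cbuiltins C) (globals t0)); [apply creach|].
    apply steps_trans with (pl s).
    - apply steps_equiv, equiv_h_sym. unfold pl, plug.
      assert (Hs : forall x, fv_state s x ->
        plug_subst (renaming er) N (globals s) x = renaming (Sg := Sg) (fun x => iota C (v x)) x).
      { intros x Hx. rewrite plug_subst_in by auto. unfold renaming. f_equal.
        apply Her'. apply C1. apply in_app_iff. auto. }
      rewrite (subst_store_ext _ _ _ (fun x Hx => Hs x (or_introl Hx))),
        (subst_builtins_ext _ _ _ (fun x Hx => Hs x (or_intror Hx))).
      eapply equiv_h_trans; [apply contract_incl|].
      + apply persistent_subst_store. exact H1.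
      + intros c Hc. apply in_map_iff in Hc. destruct Hc as (c0 & <- & Hc).
        apply (C3 c0 Hc).
      + apply equiv_h_entails; intros M HM w; rewrite holds_builtins_app; [tauto|].
        intros Hw. split; auto. unfold holds_builtins in *. rewrite Forall_forall in *.
        intros b Hb. apply in_map_iff in Hb. destruct Hb as (b0 & <- & Hb).
        apply Hw, (C2 b0 Hb).
    - unfold S', E'. rewrite <- Epl. change (steps_h CT P (pl s) (pl s')).
      apply plug_steps; auto.
      + simpl. intros x y ->. auto.
      + intros y Hy. unfold N. assert (y < cbound C) by auto. lia.
      + intros y Hy. unfold N. assert (y < cbound C) by auto. lia.
      + intros y Hy. unfold N. assert (y < cbound C) by auto. lia. }
  set (N' := fun u => cnames C u \/ exists x, loc x /\ u = New s s' v x).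
  set (iota' := fun u => if excluded_middle_informative (exists x, loc x /\ u = New s s' v x)
    then match u with New _ _ _ x => x + N | Base _ => 0 end else iota C u).
  set (nm' := fun y => if N <=? y then
      if excluded_middle_informative (loc (y - N)) then New s s' v (y - N) else nm C y
    else nm C y).
  assert (I1 : forall u, cnames C u -> iota' u = iota C u).
  { intros u Hu. unfold iota'. destruct excluded_middle_informative as [(x & _ & ->)|]; auto.
    exfalso. eauto. }
  assert (I2 : forall x, loc x -> iota' (New s s' v x) = x + N).
  { intros x Hx. unfold iota'. destruct excluded_middle_informative as [_|n]; auto.
    exfalso. eauto. }
  assert (M1 : forall y, y < N -> nm' y = nm C y).
  { intros y Hy. unfold nm'. destruct (Nat.leb_spec N y); auto; lia. }
  assert (M2 : forall x, loc x -> nm' (x + N) = New s s' v x).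
  { intros x Hx. unfold nm'. destruct (Nat.leb_spec N (x + N)); [|lia].
    replace (x + N - N) with x by lia. destruct excluded_middle_informative; tauto. }
  assert (Hloc : forall x, fv_state s' x -> In x (globals s') \/ loc x).
  { intros x Hx. unfold loc. destruct (classic (In x (globals s'))); auto. }
  assert (Hgl : forall x, In x (globals s') -> cnames C (v x)).
  { intros x Hx. apply (C1 x). apply in_app_iff. auto. }
  assert (Hname : forall x, fv_state s' x ->
    N' (extend_names s s' v x) /\ iota' (extend_names s s' v x) = rho' x /\
    nm' (rho' x) = extend_names s s' v x).
  { intros x Hx. unfold rho'. destruct (Hloc x Hx) as [Hin|[Hf Hn]].
    - assert (K := Hgl x Hin). rewrite extend_names_in by auto.
      destruct in_dec; [|tauto]. split; [left; auto|].
      rewrite I1 by auto. split; [symmetry; auto|]. rewrite M1 by auto.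
      rewrite Her' by auto. apply (cname C); auto.
    - rewrite extend_names_new by auto. destruct in_dec; [tauto|].
      assert (L : loc x) by (split; auto).
      split; [right; eauto|]. split; auto. }
  assert (Hres : forall i, result s s' v i -> covered S' E' N' iota' i).
  { intros i Hi. destruct Hi as [b Hb|c Hc|x Hx Hn]; simpl.
    - assert (Hb' : forall x, fv_builtin b x -> fv_state s' x).
      { intros x Hx. right. apply fv_builtins_in. eauto. }
      split; [intros x Hx; apply Hname; auto|].
      apply in_app_iff. left. apply in_map_iff. exists b. split; auto.
      apply subst_builtin_ext. intros x Hx. unfold renaming. f_equal. symmetry. apply Hname; auto.
    - assert (Hb' : forall x, fv_chr c x -> fv_state s' x).
      { intros x Hx. left. apply fv_store_in. eauto. }
      split; [intros x Hx; apply Hname; auto|].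
      apply in_app_iff. left. apply in_map_iff. exists c. split; auto.
      apply subst_chr_ext. intros x Hx. unfold renaming. f_equal. symmetry. apply Hname; auto.
    - right. exists x. split; auto. split; auto. }
  destruct (fv_store_bounded (store s')) as [n1 B1].
  destruct (fv_builtins_bounded (builtins s')) as [n2 B2].
  assert (BL : forall x, loc x -> x < n1 + n2).
  { intros x [[Hx|Hx] _]; [specialize (B1 _ Hx)|specialize (B2 _ Hx)]; lia. }
  assert (Old : forall y, fv_store (cstore C) y \/ fv_builtins (cbuiltins C) y \/ In y (globals t0) ->
    N' (nm' y) /\ iota' (nm' y) = y).
  { intros y Hy. assert (y < N) by (unfold N; specialize (BC y Hy); lia).
    destruct (cfv C y Hy) as [K1 K2]. rewrite M1 by auto. split; [left; auto|].
    rewrite I1; auto. }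
  unshelve eexists {| cstore := S'; cbuiltins := E'; cnames := N'; iota := iota'; nm := nm';
    cbound := N + (n1 + n2) |}.
  - exact Reach.
  - unfold S'. apply Forall_app. split; [apply persistent_subst_store; exact H3|apply cpers].
  - intros u [Hu|(x & Hx & ->)].
    + destruct (cname C u Hu) as (K1 & K2 & K3). rewrite I1 by auto.
      split; [|split]; auto; [unfold N; lia|].
      rewrite M1; [auto|unfold N; lia].
    + rewrite I2 by auto. split; [|split]; auto.
      * rewrite <- extend_names_new by apply Hx. apply X1.
      * specialize (BL x Hx). lia.
  - intros y. unfold nm'. destruct (N <=? y); [|apply cnm].
    destruct excluded_middle_informative as [K|]; [|apply cnm].
    rewrite <- extend_names_new by apply K. apply X1.
  - assert (G : forall x y, fv_state s' x -> fv_term (renaming (Sg := Sg) rho' x) y ->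
      N' (nm' y) /\ iota' (nm' y) = y).
    { intros x y Hx Hy. simpl in Hy. subst y. destruct (Hname x Hx) as (K1 & K2 & K3).
      rewrite K3. auto. }
    intros y [Hy|[Hy|Hy]]; auto.
    + unfold S' in Hy. apply fv_store_app in Hy. destruct Hy as [Hy|Hy]; auto.
      apply fv_subst_store in Hy. destruct Hy as (x & Hx & Hy). apply (G x); auto. left; auto.
    + unfold E' in Hy. apply fv_builtins_app in Hy. destruct Hy as [Hy|Hy]; auto.
      apply fv_subst_builtins in Hy. destruct Hy as (x & Hx & Hy). apply (G x); auto. right; auto.
  - intros b Hb. unfold E' in Hb. apply in_app_iff in Hb. destruct Hb as [Hb|Hb].
    + apply in_map_iff in Hb. destruct Hb as (b0 & <- & Hb).
      eapply fact_builtin_to_rename; [apply (X2 b0 Hb)|]. intros x Hx. symmetry. apply Hname.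
      right. apply fv_builtins_in. eauto.
    + eapply fact_builtin_agree; [apply (csound_b C _ Hb)|]. intros x Hx. symmetry. apply M1.
      assert (x < cbound C); [|unfold N; lia]. apply BC. right; left. apply fv_builtins_in. eauto.
  - intros c Hc. unfold S' in Hc. apply in_app_iff in Hc. destruct Hc as [Hc|Hc].
    + apply in_map_iff in Hc. destruct Hc as (c0 & <- & Hc).
      eapply fact_chr_to_rename; [apply (X3 c0 Hc)|]. intros x Hx. symmetry. apply Hname.
      left. apply fv_store_in. eauto.
    + eapply fact_chr_agree; [apply (csound_c C _ Hc)|]. intros x Hx. symmetry. apply M1.
      assert (x < cbound C); [|unfold N; lia]. apply BC. left. apply fv_store_in. eauto.
  - intros s1 s1' v1 x [Hx|(z & Hz & e)] i Hi.
    + eapply covered_mono; [| | |apply (cfired C _ _ _ _ Hx _ Hi)].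
      * intros u Hu. split; [left; auto|auto].
      * unfold S'. apply incl_appr, incl_refl.
      * unfold E'. apply incl_appr, incl_refl.
    + injection e as -> -> -> ->. auto.
  - simpl. split; [|exact Hres]. split; [|split]; simpl.
    + intros u Hu. split; [left; auto|auto].
    + unfold S'. apply incl_appr, incl_refl.
    + unfold E'. apply incl_appr, incl_refl.
Qed.

(** Items are covered one after the other by growing covers. The fixed [C0] stays below all of them
    since the base facts are covered only above the initial cover. *)
Lemma cover_list C0 (l : list (item Sg)) :
  (forall i, In i l -> forall C, cover_le C0 C -> exists C', cover_le C C' /\ covers C' i) ->
  forall C, cover_le C0 C -> exists C', cover_le C C' /\ forall i, In i l -> covers C' i.
Proof.
  induction l as [|i l IH]; intros H C HC.
  - exists C. split; [apply cover_le_refl|]. intros i [].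
  - destruct (H i (or_introl eq_refl) C HC) as (C1 & L1 & K1).
    destruct (IH (fun j Hj => H j (or_intror Hj)) C1) as (C2 & L2 & K2).
    { eapply cover_le_trans; eauto. }
    exists C2. split; [eapply cover_le_trans; eauto|].
    intros j [<-|Hj]; auto. eapply covers_mono; eauto.
Qed.

Lemma cover_fact C0 :
  (forall x, x < m0 -> cnames C0 (Base x) /\ iota C0 (Base x) = x) ->
  cstore C0 = store t0 -> cbuiltins C0 = builtins t0 ->
  forall i, fact i -> forall C, cover_le C0 C -> exists C', cover_le C C' /\ covers C' i.
Proof.
  intros K1 K2 K3.
  assert (B0 : forall i, covers C0 i ->
    forall C, cover_le C0 C -> exists C', cover_le C C' /\ covers C' i).
  { intros i Hi C HC. exists C. split; [apply cover_le_refl|]. eapply covers_mono; eauto. }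
  assert (N0 : forall x, fv_state t0 x -> base_names m0 x = @Base Sg x /\ cnames C0 (Base x) /\
    iota C0 (base_names m0 x) = x).
  { intros x Hx. assert (L : x < m0) by auto. rewrite base_names_lt by auto.
    destruct (K1 x L). auto. }
  induction 1 as [x Hx|b Hb|c Hc|s s' v i H1 H2 H3 H4 H5 IH5 H6 IH6 H7 IH7 Hi
    |b rho rho' v v' H IH Hv|c rho rho' v v' H IH Hv].
  - apply B0. simpl. apply K1; auto.
  - apply B0. simpl. assert (Hf : forall x, fv_builtin b x -> fv_state t0 x).
    { intros x Hx. right. apply fv_builtins_in. eauto. }
    split.
    + intros x Hx. destruct (N0 x (Hf x Hx)) as (-> & ? & _). auto.
    + rewrite (subst_builtin_ext _ Var), subst_builtin_var, K3; auto.
      intros x Hx. unfold renaming. f_equal. apply N0; auto.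
  - apply B0. simpl. assert (Hf : forall x, fv_chr c x -> fv_state t0 x).
    { intros x Hx. left. apply fv_store_in. eauto. }
    split.
    + intros x Hx. destruct (N0 x (Hf x Hx)) as (-> & ? & _). auto.
    + rewrite (subst_chr_ext _ Var), subst_chr_var, K2; auto.
      intros x Hx. unfold renaming. f_equal. apply N0; auto.
  - intros C HC.
    destruct (@cover_list C0 (map (fun x => ID (v x)) (globals s ++ globals s') ++
      map (fun b => IB b v) (builtins s) ++ map (fun c => IC c v) (store s))) with (C := C)
      as (C1 & L1 & G1); auto.
    { intros j Hj. rewrite !in_app_iff, !in_map_iff in Hj.
      destruct Hj as [(x & <- & _)|[(b & <- & Hb)|(c & <- & Hc)]]; auto. }
    destruct (@cover_fire C1 s s' v) as (C2 & L2 & G2); auto.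
    + intros x Hx. apply G1. rewrite !in_app_iff. left. apply in_map_iff. eauto.
    + intros b Hb. apply G1. rewrite !in_app_iff. right; left. apply in_map_iff. eauto.
    + intros c Hc. apply G1. rewrite !in_app_iff. right; right. apply in_map_iff. eauto.
    + exists C2. split; [eapply cover_le_trans; eauto|auto].
  - intros C HC. destruct (IH C HC) as (C' & L & G1 & G2). exists C'. split; auto.
    simpl. rewrite subst_builtin_comp in *. split.
    + intros x Hx. apply fv_subst_builtin in Hx. destruct Hx as (y & Hy & Hx).
      simpl in Hx. subst x. rewrite <- Hv by auto. apply G1. apply fv_subst_builtin.
      exists y. simpl. auto.
    + rewrite (subst_builtin_ext _ (osubst (renaming (fun x => iota C' (v x))) (renaming rho))); auto.
      intros x Hx. unfold osubst, renaming. simpl. f_equal. f_equal. symmetry. auto.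
  - intros C HC. destruct (IH C HC) as (C' & L & G1 & G2). exists C'. split; auto.
    simpl. rewrite subst_chr_comp in *. split.
    + intros x Hx. apply fv_subst_chr in Hx. destruct Hx as (y & Hy & Hx).
      simpl in Hx. subst x. rewrite <- Hv by auto. apply G1. apply fv_subst_chr.
      exists y. simpl. auto.
    + rewrite (subst_chr_ext _ (osubst (renaming (fun x => iota C' (v x))) (renaming rho))); auto.
      intros x Hx. unfold osubst, renaming. simpl. f_equal. f_equal. symmetry. auto.
Qed.

Lemma cover_facts (l : list (item Sg)) :
  (forall i, In i l -> fact i) -> exists C, forall i, In i l -> covers C i.
Proof.
  intros H. destruct initial_cover as (C0 & K1 & K2 & K3).
  destruct (@cover_list C0 l) with (C := C0) as (C & _ & G).
  - intros i Hi. apply cover_fact; auto.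
  - apply cover_le_refl.
  - eauto.
Qed.

Lemma fact_consistent v : ~ fact (IB BFalse v).
Proof.
  intros H. destruct (@cover_facts [IB BFalse v]) as (C & G).
  - intros i [<-|[]]. auto.
  - destruct (G _ (or_introl eq_refl)) as [_ K]. eapply R_consistent; [apply (creach C)|exact K].
Qed.

(** ** The model of the facts *)

Definition legit (v : var -> name Sg) : Prop := forall x, fact (ID (v x)).

(** Adding a consequence of [E] is a state equivalence, hence a derivation that the chase fires; the
    existential variables of [F] receive new names. Thus [CT] needs no closure rule of its own. The
    variables in [W] are made global so that their names are kept. *)
Lemma fact_conseq S E F (W : list var) v :
  legit v -> Forall persistent S ->
  (forall b, In b E -> fact (IB b v)) -> (forall c, In c S -> fact (IC c v)) ->
  (forall M : structure Sg, models_CT CT M -> forall w : valuation M, holds_builtins w E ->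
     exists w', (forall x, fv_store S x \/ fv_builtins E x \/ In x W -> w' x = w x) /\
       holds_builtins w' F) ->
  exists v', legit v' /\ (forall x, fv_store S x \/ fv_builtins E x \/ In x W -> v' x = v x) /\
    forall b, In b F -> fact (IB b v').
Proof.
  intros Hv HS HE HC Hsem.
  destruct (fv_store_bounded S) as [n1 B1], (fv_builtins_bounded E) as [n2 B2],
    (globals_bounded W) as [n3 B3].
  destruct (@bounded_list (fun x => fv_store S x \/ fv_builtins E x \/ In x W) (n1 + n2 + n3))
    as (X & HX).
  { intros x [H|[H|H]]; [specialize (B1 _ H)|specialize (B2 _ H)|specialize (B3 _ H)]; lia. }
  set (s := St S E X). set (s' := St S (E ++ F) X).
  destruct (@extend_names_fact s s' v) as (K1 & K2 & K3); auto.
  - intros x [H|H]; apply HX; auto.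
  - apply steps_equiv, equiv_h_builtins; intros M HM w Hw.
    + destruct (Hsem M HM w Hw) as (w' & H1 & H2). exists w'. split.
      * intros x [H|H]; apply H1; auto. apply HX; auto.
      * apply holds_builtins_app. split; auto. apply (holds_builtins_ext w); auto.
        intros x Hx. symmetry. auto.
    + exists w. split; auto. apply holds_builtins_app in Hw. tauto.
  - exists (extend_names s s' v). split; [auto|split].
    + intros x Hx. apply extend_names_in. apply HX; auto.
    + intros b Hb. apply K2. simpl. apply in_app_iff. auto.
Qed.

Lemma fact_entail E b v :
  legit v -> (forall b', In b' E -> fact (IB b' v)) ->
  (forall (M : structure Sg) (w : valuation M), holds_builtins w E -> holds_builtin w b) ->
  fact (IB b v).
Proof.
  intros Hv HE Hsem. destruct (fv_builtin_bounded b) as [n Bn].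
  destruct (@fact_conseq [] E [b] (seq 0 n) v) as (v' & _ & K2 & K3); auto.
  - intros c [].
  - intros M _ w Hw. exists w. split; auto. constructor; [eauto|constructor].
  - eapply fact_builtin_agree; [apply K3; simpl; auto|].
    intros x Hx. apply K2. right; right. apply in_seq. specialize (Bn _ Hx). lia.
Qed.

(** Replacing equals by equals in a persistent store is an equivalence of states, which the chase
    fires. *)
Lemma fact_chr_entail c th th' E v :
  legit v -> persistent c -> fact (IC (subst_chr th c) v) ->
  (forall b, In b E -> fact (IB b v)) ->
  (forall x, fv_chr c x -> forall (M : structure Sg) (w : valuation M), holds_builtins w E ->
     eval w (th x) = eval w (th' x)) ->
  fact (IC (subst_chr th' c) v).
Proof.
  intros Hv Hc HC HE Hsem.
  destruct (fv_builtins_bounded E) as [n1 B1], (fv_chr_bounded (subst_chr th c)) as [n2 B2],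
    (fv_chr_bounded (subst_chr th' c)) as [n3 B3].
  set (X := seq 0 (n1 + n2 + n3)).
  set (s := St [subst_chr th c] E X). set (s' := St [subst_chr th' c] E X).
  destruct (@extend_names_fact s s' v) as (K1 & K2 & K3); auto.
  - constructor; [|constructor]. apply persistent_subst; auto.
  - intros x [H|H]; apply in_seq.
    + apply fv_store_cons in H. destruct H as [H|H]; [specialize (B2 _ H); lia|inversion H].
    + specialize (B1 _ H). lia.
  - constructor; [|constructor]. apply persistent_subst; auto.
  - apply steps_equiv. apply (@subst_cong Sg CT [c] [] E X th th').
    intros x Hx M _ w Hw. apply (Hsem x); auto.
    apply fv_store_cons in Hx. destruct Hx as [Hx|Hx]; [auto|inversion Hx].
  - intros c0 [<-|[]]. auto.
  - eapply fact_chr_agree; [apply K3; simpl; auto|].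
    intros x Hx. apply extend_names_in. apply in_seq. specialize (B3 _ Hx). lia.
Qed.

(** * Equality of names and the quotient by it *)

Definition eqn (u u' : name Sg) : Prop :=
  fact (IB (BEq (Var 0) (Var 1)) (fun x => match x with 0 => u | _ => u' end)).

Lemma eqn_var x y v : fact (IB (BEq (Var x) (Var y)) v) <-> eqn (v x) (v y).
Proof.
  unfold eqn.
  change (BEq (Var x) (Var y)) with
    (subst_builtin (Sg := Sg) (renaming (fun z => match z with 0 => x | _ => y end)) (BEq (Var 0) (Var 1))).
  split; intros H.
  - eapply fact_builtin_of_rename; [exact H|]. simpl. intros z [->| ->]; auto.
  - eapply fact_builtin_to_rename; [exact H|]. simpl. intros z [->| ->]; auto.
Qed.

Lemma eqn_refl u : fact (ID u) -> eqn u u.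
Proof.
  intros Hu. apply (eqn_var 0 0 (fun _ => u)). apply (@fact_entail []).
  - intros x. auto.
  - intros b [].
  - intros M w _. simpl. auto.
Qed.

Lemma eqn_sym u u' : fact (ID u) -> fact (ID u') -> eqn u u' -> eqn u' u.
Proof.
  intros Hu Hu' H. set (v := fun x => match x with 0 => u | _ => u' end).
  apply (eqn_var 1 0 v). apply (@fact_entail [BEq (Var 0) (Var 1)]).
  - intros [|x]; simpl; auto.
  - intros b [<-|[]]. exact H.
  - intros M w Hw. inversion Hw; subst. simpl in *. auto.
Qed.

Lemma eqn_trans u1 u2 u3 : fact (ID u1) -> fact (ID u2) -> fact (ID u3) ->
  eqn u1 u2 -> eqn u2 u3 -> eqn u1 u3.
Proof.
  intros H1 H2 H3 H12 H23. set (v := fun x => match x with 0 => u1 | 1 => u2 | _ => u3 end).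
  apply (eqn_var 0 2 v). apply (@fact_entail [BEq (Var 0) (Var 1); BEq (Var 1) (Var 2)]).
  - intros [|[|x]]; simpl; auto.
  - intros b [<-|[<-|[]]]; apply eqn_var; auto.
  - intros M w Hw. inversion Hw as [|? ? E1 Hw']; subst. inversion Hw' as [|? ? E2 _]; subst.
    simpl in *. congruence.
Qed.

Lemma legit_shift n v v' : legit v -> legit v' -> legit (shift_valuation n v v').
Proof. intros H H' x. unfold shift_valuation. destruct (n <=? x); auto. Qed.

(** Both namings are joined in one, [v'] on the shifted copies of the variables; the equalities
    between them then become built-ins and congruence an entailment. *)
Lemma fact_builtin_eqn b v v' :
  legit v -> legit v' -> fact (IB b v) -> (forall x, fv_builtin b x -> eqn (v x) (v' x)) ->
  fact (IB b v').
Proof.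
  intros Hv Hv' H Heq. destruct (fv_builtin_bounded b) as [n Bn].
  destruct (bounded_list (fv_builtin b) Bn) as (xs & Hxs).
  set (J := shift_valuation n v v').
  assert (HJ : legit J) by (apply legit_shift; auto).
  apply (@fact_builtin_of_rename b v' (fun x => x + n) J).
  2: { intros x _. apply shift_valuation_add. }
  apply (@fact_entail (b :: map (fun x => BEq (Var x) (Var (x + n))) xs)); auto.
  - intros b' [<-|Hb'].
    + eapply fact_builtin_agree; [exact H|]. intros x Hx. symmetry.
      apply shift_valuation_lt; auto.
    + apply in_map_iff in Hb'. destruct Hb' as (x & <- & Hx). apply eqn_var.
      apply Hxs in Hx. unfold J. rewrite shift_valuation_lt, shift_valuation_add; auto.
  - intros M w Hw. apply holds_builtins_cons in Hw. destruct Hw as [Hw1 Hw2].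
    apply holds_builtin_subst. apply (holds_builtin_ext w); auto.
    intros x Hx. unfold holds_builtins in Hw2. rewrite Forall_forall in Hw2.
    apply (Hw2 (BEq (Var x) (Var (x + n)))). apply in_map_iff. exists x. split; auto.
    apply Hxs; auto.
Qed.

Lemma fact_chr_eqn c v v' : persistent c ->
  legit v -> legit v' -> fact (IC c v) -> (forall x, fv_chr c x -> eqn (v x) (v' x)) ->
  fact (IC c v').
Proof.
  intros Hc Hv Hv' H Heq. destruct (fv_chr_bounded c) as [n Bn].
  destruct (bounded_list (fv_chr c) Bn) as (xs & Hxs).
  set (J := shift_valuation n v v').
  assert (HJ : legit J) by (apply legit_shift; auto).
  apply (@fact_chr_of_rename c v' (fun x => x + n) J).
  2: { intros x _. apply shift_valuation_add. }
  apply (@fact_chr_entail c Var _ (map (fun x => BEq (Var x) (Var (x + n))) xs)); auto.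
  - rewrite subst_chr_var. eapply fact_chr_agree; [exact H|]. intros x Hx. symmetry.
    apply shift_valuation_lt; auto.
  - intros b' Hb'. apply in_map_iff in Hb'. destruct Hb' as (x & <- & Hx). apply eqn_var.
    apply Hxs in Hx. unfold J. rewrite shift_valuation_lt, shift_valuation_add; auto.
  - intros x Hx M w Hw. unfold holds_builtins in Hw. rewrite Forall_forall in Hw.
    apply (Hw (BEq (Var x) (Var (x + n)))). apply in_map_iff. exists x. split; auto.
    apply Hxs; auto.
Qed.

Definition eqn_class (u : name Sg) : name Sg -> Prop := fun u' => fact (ID u') /\ eqn u u'.

(** Equality is interpreted as identity, so names that the chase equates must be one element.
    Classes are predicates, which extensionality identifies. *)
Definition carrier : Type := {c : name Sg -> Prop | exists u, fact (ID u) /\ c = eqn_class u}.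

Definition rep (d : carrier) : name Sg :=
  proj1_sig (constructive_indefinite_description _ (proj2_sig d)).

Lemma rep_fact d : fact (ID (rep d)).
Proof. unfold rep. destruct constructive_indefinite_description as (u & H1 & H2). auto. Qed.

Lemma rep_class d : proj1_sig d = eqn_class (rep d).
Proof. unfold rep. destruct constructive_indefinite_description as (u & H1 & H2). auto. Qed.

Lemma rep_eqn d d' : d = d' <-> eqn (rep d) (rep d').
Proof.
  split.
  - intros ->. apply eqn_refl, rep_fact.
  - intros H. destruct d as [c Hc], d' as [c' Hc'].
    assert (K := rep_class (exist _ c Hc)). assert (K' := rep_class (exist _ c' Hc')).
    simpl in K, K'.
    assert (R1 := rep_fact (exist _ c Hc)). assert (R2 := rep_fact (exist _ c' Hc')).
    assert (e : c = c').
    { rewrite K, K'. apply functional_extensionality. intros u.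
      apply propositional_extensionality. unfold eqn_class.
      split; intros [H1 H2]; split; auto.
      - apply (eqn_trans R2 R1 H1); auto. apply eqn_sym; auto.
      - apply (eqn_trans R1 R2 H1); auto. }
    subst c'. f_equal. apply proof_irrelevance.
Qed.

Definition class_of (u : name Sg) (H : fact (ID u)) : carrier :=
  exist _ (eqn_class u) (ex_intro _ u (conj H eq_refl)).

Lemma rep_class_of u H : eqn (rep (@class_of u H)) u.
Proof.
  assert (K := rep_class (class_of H)). simpl in K.
  assert (K' : eqn_class u u) by (split; auto using eqn_refl).
  rewrite K in K'. apply K'.
Qed.

Definition reps {n} (a : Fin.t n -> carrier) (d : name Sg) : var -> name Sg :=
  fin_extend (fun i => rep (a i)) (fun _ => d).

Lemma reps_legit n (a : Fin.t n -> carrier) d : fact (ID d) -> legit (reps a d).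
Proof.
  intros H x. unfold reps, fin_extend. destruct (lt_dec x n); auto. apply rep_fact.
Qed.

(** The arguments sit at the variables below the arity. The variable numbered by the arity falls
    under the default of [reps] and stands for the result [d]. *)
Definition app_fact (f : fsym Sg) (a : Fin.t (farity Sg f) -> carrier) (d : carrier) : Prop :=
  fact (IB (BEq (Var (farity Sg f)) (App f (fun i => Var (fin_index i)))) (reps a (rep d))).

(** That some variable equals [f] of the arguments is logically valid, so the chase names such a
    value. *)
Lemma app_fact_ex f a : exists d, @app_fact f a d.
Proof.
  set (k := farity Sg f). set (t := App f (fun i => Var (fin_index i)) : term Sg).
  assert (B0 : fact (ID (Base 0))) by (apply fact_base_name; auto).
  assert (Ft : forall x, fv_term t x -> x < k).
  { intros x (i & Hi). simpl in Hi. subst x. apply fin_index_lt. }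
  destruct (@fact_conseq [] [] [BEq (Var k) t] (seq 0 k) (reps a (Base 0))) as (v & V1 & V2 & V3); auto.
  - apply reps_legit; auto.
  - intros b [].
  - intros c [].
  - intros M _ w _. exists (fun x => if Nat.eq_dec x k then eval w t else w x). split.
    + intros x [Hx|[Hx|Hx]]; [inversion Hx|inversion Hx|]. apply in_seq in Hx.
      destruct (Nat.eq_dec x k); auto; lia.
    + constructor; [|constructor]. simpl. destruct (Nat.eq_dec k k); [|tauto].
      change (eval w t = eval (fun x => if Nat.eq_dec x k then eval w t else w x) t).
      apply eval_ext. intros x Hx. specialize (Ft x Hx).
      destruct (Nat.eq_dec x k); auto; lia.
  - exists (class_of (V1 k)).
    apply (@fact_builtin_eqn _ v (reps a (rep (class_of (V1 k))))); auto.
    + apply reps_legit, rep_fact.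
    + apply V3. simpl; auto.
    + intros x Hx. destruct Hx as [Hx|Hx].
      * simpl in Hx. subst x. unfold reps. rewrite fin_extend_ge by auto.
        apply eqn_sym; auto using rep_fact, rep_class_of.
      * assert (L := Ft x Hx). rewrite V2 by (right; right; apply in_seq; lia).
        destruct Hx as (i & Hi). simpl in Hi. subst x. unfold reps.
        rewrite !fin_extend_index. apply eqn_refl, rep_fact.
Qed.

Definition chase_model : structure Sg := {|
  dom := carrier;
  dom_inhabited := inhabits (class_of (fact_base_name CT P t0 Hm0));
  ifun := fun f a => proj1_sig (constructive_indefinite_description _ (@app_fact_ex f a));
  ibuiltin := fun p a => fact (IB (BPred p (fun i => Var (fin_index i))) (reps a (Base 0)));
  ichr := fun c a => fact (IC (generic_chr c) (reps a (Base 0)))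
|}.

Definition names (v : valuation chase_model) : var -> name Sg := fun x => rep (v x).

Lemma names_legit v : legit (names v).
Proof. intros x. apply rep_fact. Qed.

Definition with_args {n} (N : nat) (w : var -> name Sg) (a : Fin.t n -> carrier) : var -> name Sg :=
  shift_valuation N w (reps a (Base 0)).

Lemma with_args_legit n N w (a : Fin.t n -> carrier) : legit w -> legit (with_args N w a).
Proof.
  intros H. apply legit_shift; auto. apply reps_legit. apply fact_base_name; auto.
Qed.

Lemma with_args_index n N w (a : Fin.t n -> carrier) i :
  with_args N w a (fin_index i + N) = rep (a i).
Proof. unfold with_args. rewrite shift_valuation_add.
  exact (fin_extend_index (fun i => rep (a i)) _ i). Qed.

(** Interpretation by choice and equations of the chase agree. The naming [w] is general because the
    induction adds variables for the values of the arguments, from whose equations the one for the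
    compound term follows. *)
Lemma eval_fact (v : valuation chase_model) t : forall w, legit w ->
  (forall x, fv_term t x -> w x = names v x) ->
  forall y, w y = rep (eval v t) -> fact (IB (BEq (Var y) t) w).
Proof.
  induction t as [x|f a IH]; intros w Hw Ht y Hy.
  - apply eqn_var. rewrite Hy, Ht by (simpl; auto). apply eqn_refl, rep_fact.
  - destruct (fv_term_bounded (App f a)) as [n Bn].
    set (N := n + y + 1).
    set (d := fun i => eval v (a i)).
    set (J := with_args N w d).
    assert (HJ : legit J) by (apply with_args_legit; auto).
    assert (JL : forall x, x < N -> J x = w x) by (intros; apply shift_valuation_lt; auto).
    destruct (fin_list (farity Sg f)) as (fl & Hfl).
    apply (@fact_builtin_agree _ J).
    2: { intros x [Hx|Hx]; apply JL; unfold N; [simpl in Hx; lia|].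
         specialize (Bn _ Hx). lia. }
    apply (@fact_entail (BEq (Var y) (App f (fun i => Var (fin_index i + N))) ::
      map (fun i => BEq (Var (fin_index i + N)) (a i)) fl)); auto.
    + intros b [<-|Hb].
      * assert (K := proj2_sig (constructive_indefinite_description _ (@app_fact_ex f d))).
        change (proj1_sig (constructive_indefinite_description _ (@app_fact_ex f d)))
          with (ifun chase_model f d) in K.
        set (rho := fun x => if x <? farity Sg f then x + N else y).
        change (App f (fun i => Var (fin_index i + N))) with
          (subst_term (Sg := Sg) (fun x => Var (x + N)) (App f (fun i => Var (fin_index i)))).
        assert (e : BEq (Var y) (subst_term (fun x => Var (x + N)) (App f (fun i => Var (fin_index i)))) =
          subst_builtin (renaming (Sg := Sg) rho)
            (BEq (Var (farity Sg f)) (App f (fun i => Var (fin_index i))))).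
        { simpl. unfold renaming at 1, rho at 1. rewrite Nat.ltb_irrefl. f_equal.
          f_equal. apply functional_extensionality. intros i. unfold renaming, rho.
          destruct (Nat.ltb_spec (fin_index i) (farity Sg f)); auto.
          assert (L := fin_index_lt i). lia. }
        rewrite e. eapply fact_builtin_to_rename; [exact K|].
        intros x [Hx|(i & Hx)]; simpl in Hx; subst x; unfold rho.
        -- rewrite Nat.ltb_irrefl. rewrite JL by (unfold N; lia). rewrite Hy.
           unfold reps. rewrite fin_extend_ge by auto. reflexivity.
        -- destruct (Nat.ltb_spec (fin_index i) (farity Sg f)).
           2: { assert (L := fin_index_lt i). lia. }
           unfold J. rewrite with_args_index. unfold reps. rewrite fin_extend_index. auto.
      * apply in_map_iff in Hb. destruct Hb as (i & <- & _). apply IH; auto.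
        -- intros x Hx. rewrite JL; [apply Ht; simpl; eauto|].
           unfold N. assert (x < n); [|lia]. apply Bn. simpl; eauto.
        -- apply with_args_index.
    + intros M u Hu. apply holds_builtins_cons in Hu. destruct Hu as [Hu1 Hu2].
      simpl in Hu1 |- *. rewrite Hu1. f_equal. apply functional_extensionality. intros i.
      unfold holds_builtins in Hu2. rewrite Forall_forall in Hu2.
      apply (Hu2 (BEq (Var (fin_index i + N)) (a i))). apply in_map_iff. eauto.
Qed.

Lemma args_facts n N (a : Fin.t n -> term Sg) (v : valuation chase_model) :
  (forall i x, fv_term (a i) x -> x < N) ->
  forall i, fact (IB (BEq (Var (fin_index i + N)) (a i))
    (with_args N (names v) (fun i => eval v (a i)))).
Proof.
  intros HN i. apply (@eval_fact v).
  - apply with_args_legit, names_legit.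
  - intros x Hx. apply shift_valuation_lt. eauto.
  - apply (@with_args_index n N (names v) (fun i => eval v (a i))).
Qed.

Lemma fin_rename {n} N (a : Fin.t n -> carrier) (v : var -> name Sg) x :
  (exists i : Fin.t n, x = fin_index i) -> reps a (Base 0) x = with_args N v a (x + N).
Proof.
  intros (i & ->). rewrite with_args_index.
  exact (fin_extend_index (fun i => rep (a i)) _ i).
Qed.

Lemma holds_builtin_fact (v : valuation chase_model) b :
  holds_builtin v b <-> fact (IB b (names v)).
Proof.
  destruct b as [| |t u|p a].
  - simpl. split; auto. intros _. apply (@fact_entail []).
    + apply names_legit.
    + intros b [].
    + simpl. auto.
  - simpl. split; [tauto|]. apply fact_consistent.
  - destruct (fv_builtin_bounded (BEq t u)) as [N BN].
    set (args := fun x => match x with 0 => rep (eval v t) | _ => rep (eval v u) end).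
    set (J := shift_valuation N (names v) args).
    assert (HJ : legit J).
    { apply legit_shift; [apply names_legit|]. intros [|x]; apply rep_fact. }
    assert (JL : forall x, x < N -> J x = names v x) by (intros; apply shift_valuation_lt; auto).
    assert (J0 : J (0 + N) = rep (eval v t)) by exact (shift_valuation_add N (names v) args 0).
    assert (J1 : J (1 + N) = rep (eval v u)) by exact (shift_valuation_add N (names v) args 1).
    assert (Ft : fact (IB (BEq (Var (0 + N)) t) J)).
    { apply (eval_fact v); auto. intros x Hx. apply JL, BN. simpl. auto. }
    assert (Fu : fact (IB (BEq (Var (1 + N)) u) J)).
    { apply (eval_fact v); auto. intros x Hx. apply JL, BN. simpl. auto. }
    assert (Ag : fact (IB (BEq t u) (names v)) <-> fact (IB (BEq t u) J)).
    { split; intros H; eapply fact_builtin_agree; try exact H; intros x Hx;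
        [symmetry|]; apply JL, BN; auto. }
    rewrite Ag. simpl. rewrite rep_eqn, <- J0, <- J1, <- eqn_var. split; intros H.
    + apply (@fact_entail [BEq (Var (0 + N)) t; BEq (Var (1 + N)) u; BEq (Var (0 + N)) (Var (1 + N))]); auto.
      * intros b [<-|[<-|[<-|[]]]]; auto.
      * intros M w Hw. rewrite !holds_builtins_cons in Hw. simpl in *. intuition congruence.
    + apply (@fact_entail [BEq (Var (0 + N)) t; BEq (Var (1 + N)) u; BEq t u]); auto.
      * intros b [<-|[<-|[<-|[]]]]; auto.
      * intros M w Hw. rewrite !holds_builtins_cons in Hw. simpl in *. intuition congruence.
  - destruct (fv_builtin_bounded (BPred p a)) as [N BN].
    destruct (fin_list (barity Sg p)) as (fl & Hfl).
    set (d := fun i => eval v (a i)).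
    set (J := with_args N (names v) d).
    assert (HJ : legit J) by (apply with_args_legit, names_legit).
    assert (Fa : forall i, fact (IB (BEq (Var (fin_index i + N)) (a i)) J)).
    { apply args_facts. intros i x Hx. apply BN. simpl. eauto. }
    set (g := BPred p (fun i => Var (fin_index i)) : builtin Sg).
    assert (Fg : forall x, fv_builtin g x -> reps d (Base 0) x = J (x + N)).
    { intros x (i & Hx). simpl in Hx. apply fin_rename. eauto. }
    assert (Ag : fact (IB (BPred p a) (names v)) <-> fact (IB (BPred p a) J)).
    { split; intros H; eapply fact_builtin_agree; try exact H; intros x Hx;
        [symmetry|]; apply shift_valuation_lt, BN; auto. }
    set (eqs := map (fun i => BEq (Var (fin_index i + N)) (a i)) fl).
    assert (Feqs : forall b, In b eqs -> fact (IB b J)).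
    { intros b Hb. apply in_map_iff in Hb. destruct Hb as (i & <- & _). auto. }
    assert (Sem : forall (M : structure Sg) (w : valuation M), holds_builtins w eqs ->
      (fun i => w (fin_index i + N)) = (fun i => eval w (a i))).
    { intros M w Hw. apply functional_extensionality. intros i.
      unfold holds_builtins in Hw. rewrite Forall_forall in Hw.
      apply (Hw (BEq (Var (fin_index i + N)) (a i))). apply in_map_iff. eauto. }
    rewrite Ag. change (holds_builtin v (BPred p a)) with (fact (IB g (reps d (Base 0)))).
    split; intros H.
    + apply (@fact_entail (subst_builtin (shift N) g :: eqs)); auto.
      * intros b [<-|Hb]; auto. eapply fact_builtin_to_rename; [exact H|exact Fg].
      * intros M w Hw. apply holds_builtins_cons in Hw. destruct Hw as [Hw1 Hw2].
        simpl in *. rewrite <- (Sem M w Hw2). exact Hw1.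
    + eapply fact_builtin_of_rename; [|intros x Hx; symmetry; apply Fg; auto].
      apply (@fact_entail (BPred p a :: eqs)); auto.
      * intros b [<-|Hb]; auto.
      * intros M w Hw. apply holds_builtins_cons in Hw. destruct Hw as [Hw1 Hw2].
        simpl in *. rewrite <- (Sem M w Hw2) in Hw1. exact Hw1.
Qed.

Lemma holds_chr_fact (v : valuation chase_model) c : persistent c ->
  (holds_chr v c <-> fact (IC c (names v))).
Proof.
  destruct c as [p a]. intros Hc.
  destruct (fv_chr_bounded (Chr p a)) as [N BN].
  destruct (fin_list (carity Sg p)) as (fl & Hfl).
  set (d := fun i => eval v (a i)).
  set (J := with_args N (names v) d).
  assert (HJ : legit J) by (apply with_args_legit, names_legit).
  assert (Fa : forall i, fact (IB (BEq (Var (fin_index i + N)) (a i)) J)).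
  { apply args_facts. intros i x Hx. apply BN. simpl. eauto. }
  assert (Fg : forall x, fv_chr (generic_chr p) x -> reps d (Base 0) x = J (x + N)).
  { intros x (i & Hx). simpl in Hx. apply fin_rename. eauto. }
  assert (Ag : fact (IC (Chr p a) (names v)) <-> fact (IC (Chr p a) J)).
  { split; intros H; eapply fact_chr_agree; try exact H; intros x Hx;
      [symmetry|]; apply shift_valuation_lt, BN; auto. }
  set (eqs := map (fun i => BEq (Var (fin_index i + N)) (a i)) fl).
  assert (Feqs : forall b, In b eqs -> fact (IB b J)).
  { intros b Hb. apply in_map_iff in Hb. destruct Hb as (i & <- & _). auto. }
  assert (Sem : forall x, fv_chr (generic_chr p) x ->
    forall (M : structure Sg) (w : valuation M), holds_builtins w eqs ->
    eval w (shift N x) = eval w (fin_extend a Var x)).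
  { intros x (i & Hx) M w Hw. simpl in Hx. subst x. rewrite fin_extend_index.
    unfold holds_builtins in Hw. rewrite Forall_forall in Hw.
    apply (Hw (BEq (Var (fin_index i + N)) (a i))). apply in_map_iff. eauto. }
  rewrite Ag. change (holds_chr v (Chr p a)) with (fact (IC (generic_chr p) (reps d (Base 0)))).
  split; intros H.
  - rewrite <- (subst_generic_chr p a Var).
    apply (@fact_chr_entail _ (shift N) _ eqs); auto.
    eapply fact_chr_to_rename; [exact H|exact Fg].
  - eapply fact_chr_of_rename; [|intros x Hx; symmetry; apply Fg; auto].
    apply (@fact_chr_entail _ (fin_extend a Var) _ eqs); auto.
    + rewrite subst_generic_chr. auto.
    + intros x Hx M w Hw. symmetry. apply Sem; auto.
Qed.

Definition classes (w : var -> name Sg) (H : legit w) : valuation chase_model :=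
  fun x => class_of (H x).

Lemma holds_builtin_classes w (H : legit w) b : holds_builtin (classes H) b <-> fact (IB b w).
Proof.
  rewrite holds_builtin_fact. split; intros K; (eapply fact_builtin_eqn; [| |exact K|]);
    auto using names_legit; intros x _; [|apply eqn_sym]; auto using rep_class_of, rep_fact;
    try apply rep_class_of; apply rep_fact.
Qed.

Lemma holds_chr_classes w (H : legit w) c : persistent c ->
  (holds_chr (classes H) c <-> fact (IC c w)).
Proof.
  intros Hc.
  rewrite holds_chr_fact by auto. split; intros K; (eapply fact_chr_eqn; [auto| | |exact K|]);
    auto using names_legit; intros x _; [|apply eqn_sym]; auto using rep_class_of, rep_fact;
    try apply rep_class_of; apply rep_fact.
Qed.

Lemma classes_rep w (H : legit w) x (d : carrier) : w x = rep d -> classes H x = d.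
Proof.
  intros E. apply rep_eqn. eapply eqn_trans; [apply rep_fact| |apply rep_fact|apply rep_class_of|].
  - apply H.
  - rewrite E. apply eqn_refl, rep_fact.
Qed.

Lemma chase_model_CT : models_CT CT chase_model.
Proof.
  intros a Ha v Hv.
  destruct (fv_builtins_bounded (premise a)) as [n1 B1], (fv_builtins_bounded (conclusion a)) as [n2 B2],
    (globals_bounded (exvars a)) as [n3 B3].
  set (N := n1 + n2 + n3).
  (* The existential variables of an axiom may also occur in its premise, where the names are fixed;
     they are renamed apart and renamed back in [u']. *)
  set (rho := fun x => if in_dec Nat.eq_dec x (exvars a) then x + N else x).
  destruct (@fact_conseq [] (premise a) (map (subst_builtin (renaming rho)) (conclusion a))
    (seq 0 N) (names v)) as (u & U1 & U2 & U3).
  - apply names_legit.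
  - constructor.
  - intros b Hb. apply holds_builtin_fact. unfold holds_builtins in Hv.
    rewrite Forall_forall in Hv. auto.
  - intros c [].
  - intros M HM w Hw. destruct (HM a Ha w Hw) as (w' & W1 & W2).
    exists (shift_valuation N w w'). split.
    + intros x Hx. apply shift_valuation_lt. destruct Hx as [Hx|[Hx|Hx]].
      * inversion Hx.
      * specialize (B1 _ Hx). unfold N. lia.
      * apply in_seq in Hx. lia.
    + apply holds_builtins_subst. apply (holds_builtins_ext w'); auto.
      intros x Hx. unfold esubst, renaming, rho. simpl. destruct in_dec as [i|n].
      * rewrite shift_valuation_add. auto.
      * rewrite shift_valuation_lt; auto. specialize (B2 _ Hx). unfold N. lia.
  - set (u' := fun x => if in_dec Nat.eq_dec x (exvars a) then u (x + N) else names v x).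
    assert (L : legit u').
    { intros x. unfold u'. destruct in_dec; auto. apply names_legit. }
    exists (classes L). split.
    + intros x Hx. apply classes_rep. unfold u'. destruct in_dec; tauto.
    + unfold holds_builtins. apply Forall_forall. intros b Hb. apply holds_builtin_classes.
      eapply fact_builtin_of_rename; [apply U3, in_map, Hb|].
      intros x Hx. unfold rho, u'. destruct in_dec; auto. apply U2. right; right.
      apply in_seq. assert (x < n2); [|unfold N; lia]. apply B2, fv_builtins_in. eauto.
Qed.

(** ** Propagation rules *)

Hypothesis HP : hybrid_program P.
Hypothesis R_normal : forall s, R s ->
  exists t, purely_persistent t /\ steps_h CT (simplification_rules P) s t.

Notation struth := (store_truth (simplification_rules P) (M := chase_model)).

Lemma store_truth_persistent (v : valuation chase_model) S :
  Forall persistent S -> (forall c, In c S -> holds_chr v c) -> struth (map (ginst v) S).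
Proof.
  intros HS H. split.
  - rewrite Forall_map. apply Forall_forall. intros c Hc _. apply gholds_ginst. auto.
  - rewrite glinear_ginst_persistent by auto. constructor.
Qed.

(** The head of the rule is covered by a reachable state; firing the rule there and
    normalising yields a derivation between purely persistent states, so the chase contains
    its result, and truth goes backward along the normalisation. *)
Lemma chase_model_propagation r (v : valuation chase_model) :
  In r P -> removed r = [] -> holds_store v (kept r) -> holds_builtins v (guard r) ->
  exists w : valuation chase_model, (forall x, fv_head r x -> w x = v x) /\
    holds_builtins w (guard r) /\ holds_builtins w (body_builtin r) /\
    struth (map (ginst w) (body_chr r)).
Proof.
  intros Hr Er HK HG.
  destruct (proj1 (Forall_forall _ _) HP r Hr) as (_ & Hk & _).
  unfold holds_store in HK. unfold holds_builtins in HG. rewrite Forall_forall in HK, HG.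
  destruct (@cover_facts (map (fun c => IC c (names v)) (kept r) ++
    map (fun b => IB b (names v)) (guard r))) as (C & HC).
  { intros i Hi. apply in_app_iff in Hi. rewrite !in_map_iff in Hi.
    destruct Hi as [(c & <- & Hc)|(b & <- & Hb)].
    - apply holds_chr_fact; auto. rewrite Forall_forall in Hk. auto.
    - apply holds_builtin_fact; auto. }
  assert (CK : forall c, In c (kept r) -> covers C (IC c (names v))).
  { intros c Hc. apply HC, in_app_iff. left. apply in_map_iff. eauto. }
  assert (CG : forall b, In b (guard r) -> covers C (IB b (names v))).
  { intros b Hb. apply HC, in_app_iff. right. apply in_map_iff. eauto. }
  clear HC.
  destruct (fv_head_list r) as (Xh & HXh).
  assert (Hhd : forall x, fv_head r x <-> fv_store (kept r) x).
  { intros x. unfold fv_head. rewrite Er. split; auto. intros [H|H]; auto. inversion H. }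
  assert (BC : forall y, fv_store (cstore C) y \/ fv_builtins (cbuiltins C) y \/ In y (globals t0) -> y < cbound C).
  { intros y Hy. destruct (cfv C y Hy) as [K1 K2]. destruct (cname C _ K1) as (_ & L & _). lia. }
  destruct (@bounded_list (fun y => fv_store (cstore C) y \/ fv_builtins (cbuiltins C) y \/ In y (globals t0))
    (cbound C) BC) as (Y & HY).
  set (io := fun x => iota C (names v x)).
  set (N := cbound C + 1).
  set (er := fun x => if io x <? cbound C then io x else 0).
  assert (Ber : forall x, er x < N).
  { intros x. unfold er, N. destruct (Nat.ltb_spec (io x) (cbound C)); lia. }
  assert (Her : forall x, cnames C (names v x) -> er x = io x).
  { intros x Hx. destruct (cname C _ Hx) as (_ & L & _). unfold er.
    destruct (Nat.ltb_spec (io x) (cbound C)); auto. unfold io in *. lia. }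
  assert (Nh : forall x, fv_head r x -> cnames C (names v x) /\ In (io x) Y).
  { intros x Hx. apply Hhd in Hx. apply fv_store_in in Hx. destruct Hx as (c & Hc & Hx).
    destruct (CK c Hc) as [K1 K2]. split; auto. apply HY. left.
    apply fv_store_in. eexists. split; [exact K2|]. apply fv_subst_chr. exists x. simpl. auto. }
  assert (Ng : forall x, fv_builtins (guard r) x -> cnames C (names v x)).
  { intros x Hx. apply fv_builtins_in in Hx. destruct Hx as (b & Hb & Hx).
    destruct (CG b Hb) as [K1 K2]. auto. }
  (* Guard variables outside the head are local to the rule; they move beyond [N] instead of keeping
     their place in the cover. *)
  set (th := plug_subst (renaming er) N Xh : var -> term Sg).
  assert (Th1 : forall x, fv_head r x -> th x = Var (io x)).
  { intros x Hx. unfold th. rewrite plug_subst_in by (apply HXh; auto).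
    unfold renaming. f_equal. apply Her. apply Nh; auto. }
  assert (Th2 : forall x, ~ fv_head r x -> th x = Var (x + N)).
  { intros x Hx. unfold th. apply plug_subst_notin. rewrite HXh. auto. }
  set (s1 := St (kept r) (guard r) Xh).
  set (s2 := St (body_chr r ++ kept r) (body_builtin r ++ guard r) Xh).
  assert (Step : step_h CT P s1 s2).
  { assert (K := @step_rule_id Sg CT P r [] Xh Hr). rewrite Er in K. simpl in K.
    rewrite !app_nil_r in K. apply K. intros x Hx. split.
    - intros F. inversion F.
    - rewrite HXh. apply Hx. }
  set (pl := plug (renaming er) N (cstore C) (cbuiltins C)).
  (* The globals are left open for two uses. With those of [t0] the result is reachable and thus has
     a normal form; with all variables [Y] of the cover the derivation can be fired in the chase and
     preserves the names of the cover. *)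
  assert (Fire : forall X, (forall y, In y X -> y < cbound C) ->
    steps_h CT P (St (cstore C) (cbuiltins C) X) (pl X s2)).
  { intros X HX. apply steps_trans with (pl X s1).
    - apply steps_equiv, equiv_h_sym. unfold pl, plug, s1. simpl.
      fold th. rewrite (subst_store_ext th (renaming io)).
      2: { intros x Hx. apply Th1, Hhd, Hx. }
      eapply equiv_h_trans; [apply contract_incl|].
      + apply persistent_subst_store; auto.
      + intros c Hc. apply in_map_iff in Hc. destruct Hc as (c0 & <- & Hc). apply CK; auto.
      + apply equiv_h_builtins; intros M HM w Hw.
        * exists w. split; auto. apply holds_builtins_app in Hw. tauto.
        * set (w' := shift_valuation N w (fun x => w (io x))).
          assert (L : forall x, x < cbound C -> w' x = w x).
          { intros x Hx. apply shift_valuation_lt. unfold N. lia. }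
          exists w'. split; [intros x [Hx|Hx]; auto|].
          rewrite holds_builtins_app, holds_builtins_subst. split.
          -- assert (Hw' : holds_builtins w (map (subst_builtin (renaming io)) (guard r))).
             { unfold holds_builtins in *. rewrite Forall_forall in *. intros b Hb.
               apply in_map_iff in Hb. destruct Hb as (b0 & <- & Hb). apply Hw, CG, Hb. }
             apply holds_builtins_subst in Hw'.
             apply (holds_builtins_ext (esubst w (renaming io))); auto.
             intros x Hx. unfold esubst. destruct (classic (fv_head r x)) as [Hd|Hd].
             ++ rewrite Th1 by auto. unfold renaming. simpl. symmetry. apply L.
                destruct (cname C _ (Ng x Hx)) as (_ & ? & _). auto.
             ++ rewrite Th2 by auto. unfold renaming. simpl. symmetry. exact (shift_valuation_add N w (fun x => w (io x)) x).
          -- apply (holds_builtins_ext w); auto. intros x Hx. symmetry. auto.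
    - apply steps_step, plug_step; auto.
      + simpl. intros x y ->. auto.
      + intros y Hy. unfold N. assert (y < cbound C) by auto. lia.
      + intros y Hy. unfold N. assert (y < cbound C) by auto. lia.
      + intros y Hy. unfold N. assert (y < cbound C) by auto. lia. }
  assert (Reach : R (pl (globals t0) s2)).
  { eapply R_steps; [apply (creach C)|]. apply Fire. auto. }
  destruct (R_normal Reach) as (t & Ht & Hst).
  (* Normalisation is known for the globals of [t0]; it is transported to the globals [Y]. *)
  destruct (@steps_refine Sg CT _ (pl (globals t0) s2) t Var [] [] Y Hst) as (th2 & F' & _ & Hst').
  rewrite subst_store_var, subst_builtins_var, !app_nil_r in Hst'.
  set (s3 := St (cstore C) (cbuiltins C) Y).
  set (s4 := St (map (subst_chr th2) (store t)) (map (subst_builtin th2) (builtins t) ++ F') Y).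
  change (steps_h CT (simplification_rules P) (pl Y s2) s4) in Hst'.
  assert (P4 : purely_persistent s4) by (apply persistent_subst_store; exact Ht).
  destruct (@extend_names_fact s3 s4 (nm C)) as (X1 & X2 & X3); auto.
  { apply cpers. }
  { intros x Hx. apply HY. unfold fv_state in Hx. simpl in Hx. tauto. }
  { eapply steps_trans; [apply Fire; intros y Hy; apply BC, HY, Hy|].
    eapply steps_mono; [apply simplification_rules_incl|exact Hst']. }
  { apply cnm. }
  { apply csound_b. }
  { apply csound_c. }
  set (e := classes X1).
  assert (T4 : true_state struth e s4).
  { exists e. split; [|split]; auto.
    - unfold holds_builtins. apply Forall_forall. intros b Hb. apply holds_builtin_classes. auto.
    - apply store_truth_persistent; [exact P4|]. intros c Hc. apply holds_chr_classes; auto.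
      unfold purely_persistent in P4. rewrite Forall_forall in P4. auto. }
  apply (true_state_steps_backward chase_model_CT
    (@store_truth_multiset Sg (simplification_rules P) chase_model)
    (store_truth_backward (simplification_rules_spec HP)) Hst') in T4.
  destruct T4 as (w & W1 & W2 & W3). unfold pl, plug in W1, W2, W3. simpl in W1, W2, W3.
  fold th in W2, W3.
  rewrite holds_builtins_app, holds_builtins_subst in W2. destruct W2 as [W2 _].
  apply holds_builtins_app in W2.
  rewrite (map_app (subst_chr th)), <- app_assoc, map_app, ginst_store_subst in W3.
  exists (esubst w th). split; [|split; [|split]]; try tauto.
  - intros x Hx. unfold esubst. rewrite Th1 by auto. simpl.
    destruct (Nh x Hx) as [K1 K2]. rewrite W1 by auto. unfold e. apply classes_rep.
    rewrite extend_names_in by auto. apply (cname C); auto.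
  - destruct W3 as [W3 W4]. apply Forall_app in W3. rewrite filter_app in W4. split; [tauto|].
    rewrite (@glinear_ginst_persistent Sg chase_model w (map (subst_chr th) (kept r) ++ cstore C)), app_nil_r in W4; auto.
    apply Forall_app. split; [apply persistent_subst_store; auto|apply cpers].
Qed.

End Chase.

(** * Interpreting the linear symbols *)

(** States contain terms, not domain elements, so a ground context is represented by atoms over
    variables from [n] on, fresh for whatever lies below. *)
Lemma realize_atoms {Sg : signature} {M : structure Sg} (l : list (gatom M)) :
  forall n (v : valuation M), exists (S : list (chr Sg)) (u : valuation M),
    map (ginst u) S = l /\ (forall x, x < n -> u x = v x) /\
    (forall x, fv_store S x -> n <= x).
Proof.
  induction l as [|[p a] l IH]; intros n v.
  - exists [], v. split; [|split]; auto. intros x H. inversion H.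
  - set (v' := shift_valuation n v (fin_extend a v)).
    destruct (IH (n + carity Sg p) v') as (S & u & H1 & H2 & H3).
    exists (Chr p (fun i => Var (fin_index i + n)) :: S), u. split; [|split].
    + simpl. f_equal; auto. f_equal. apply functional_extensionality. intros i.
      rewrite H2.
      * unfold v'. rewrite shift_valuation_add. apply fin_extend_index.
      * assert (K := fin_index_lt i). lia.
    + intros x Hx. rewrite H2 by lia. apply shift_valuation_lt; auto.
    + intros x Hx. apply fv_store_cons in Hx. destruct Hx as [(i & Hx)|Hx].
      * simpl in Hx. lia.
      * specialize (H3 _ Hx). lia.
Qed.

Section Completion.
Context {Sg : signature} (CT : theory Sg) (P : program Sg) (M : structure Sg).
Hypothesis HP : hybrid_program P.
Hypothesis HM : models_CT CT M.
Hypothesis Hconf : confluent CT (simplification_rules P).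

Notation ltruth := (@linear_truth Sg (simplification_rules P) M).
Notation struth := (@store_truth Sg (simplification_rules P) M).

Hypothesis Hprop : forall r (v : valuation M), In r P -> removed r = [] ->
  holds_store v (kept r) -> holds_builtins v (guard r) ->
  exists w : valuation M, (forall x, fv_head r x -> w x = v x) /\
    holds_builtins w (guard r) /\ holds_builtins w (body_builtin r) /\
    struth (map (ginst w) (body_chr r)).

(** The domain is literally that of [M], so valuations of one structure are valuations of the
    other. *)
Definition completion : structure Sg := {|
  dom := dom M;
  dom_inhabited := dom_inhabited M;
  ifun := ifun M;
  ibuiltin := ibuiltin M;
  ichr := fun p a => if persistent_sym Sg p then ichr M p a
                     else exists l, ltruth (existT _ p a :: l)
|}.

Lemma completion_eval (v : valuation M) t : @eval Sg completion v t = eval v t.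
Proof.
  induction t as [x|f a IH]; simpl; auto.
  f_equal. apply functional_extensionality. exact IH.
Qed.

Lemma completion_args (v : valuation M) n (a : Fin.t n -> term Sg) :
  (fun i => @eval Sg completion v (a i)) = (fun i => eval v (a i)).
Proof. apply functional_extensionality. intros i. apply completion_eval. Qed.

Lemma completion_builtins (v : valuation M) E :
  @holds_builtins Sg completion v E <-> holds_builtins v E.
Proof.
  unfold holds_builtins.
  split; apply Forall_impl; intros [| |t u|p a]; simpl;
    rewrite ?completion_eval, ?completion_args; auto.
Qed.

Lemma completion_persistent (v : valuation M) c : persistent c ->
  (@holds_chr Sg completion v c <-> holds_chr v c).
Proof. destruct c as [p a]. simpl. intros ->. rewrite completion_args. tauto. Qed.

Lemma completion_linear (v : valuation M) c : linear c ->
  (@holds_chr Sg completion v c <-> exists l, ltruth (ginst v c :: l)).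
Proof. destruct c as [p a]. simpl. intros ->. rewrite completion_args. tauto. Qed.

Lemma linear_truth_in g l : ltruth l -> In g l -> exists l', ltruth (g :: l').
Proof.
  intros Hl Hg. apply in_split in Hg. destruct Hg as (l1 & l2 & ->).
  exists (l1 ++ l2). eapply lt_perm; [|exact Hl]. apply Permutation_sym, Permutation_middle.
Qed.

(** The separate contexts of the atoms are concatenated, as true multisets add up. *)
Lemma linear_truth_union l :
  Forall (fun g => exists l', ltruth (g :: l')) l -> exists l', ltruth (l ++ l').
Proof.
  induction 1 as [|g l (l1 & H1) _ (l2 & H2)].
  - exists []. constructor.
  - exists (l1 ++ l2). eapply lt_perm; [|exact (linear_truth_app H1 H2)].
    simpl. constructor. rewrite !app_assoc. apply Permutation_app_tail, Permutation_app_comm.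
Qed.

Lemma completion_store (v : valuation M) S l :
  Forall (gtrue_persistent (M := M)) (map (ginst v) S) ->
  ltruth (filter (glinear (M := M)) (map (ginst v) S) ++ l) ->
  @holds_store Sg completion v S.
Proof.
  intros H1 H2. unfold holds_store. apply Forall_forall. intros c Hc.
  rewrite Forall_forall in H1.
  destruct c as [p a] eqn:Ec. rewrite <- Ec in *. destruct (persistent_sym Sg p) eqn:e.
  - assert (Hp : persistent c) by (subst c; exact e).
    apply completion_persistent; auto. apply gholds_ginst. apply H1; [|apply gpers_ginst; auto].
    apply in_map; auto.
  - assert (Hp : linear c) by (subst c; exact e).
    apply completion_linear; auto. eapply linear_truth_in; [exact H2|]. apply in_app_iff. left.
    apply filter_In. split; [apply in_map; auto|]. subst c. unfold glinear. simpl. rewrite e. auto.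
Qed.

Lemma completion_store_inv (v : valuation M) S :
  @holds_store Sg completion v S ->
  Forall (gtrue_persistent (M := M)) (map (ginst v) S) /\
  exists l, ltruth (filter (glinear (M := M)) (map (ginst v) S) ++ l).
Proof.
  intros H. unfold holds_store in H. rewrite Forall_forall in H. split.
  - rewrite Forall_map. apply Forall_forall. intros c Hc Hp. apply gpers_ginst in Hp.
    apply gholds_ginst. apply completion_persistent; auto.
  - apply linear_truth_union. apply Forall_forall. intros g Hg.
    apply filter_In in Hg. destruct Hg as [Hg Hl]. apply in_map_iff in Hg.
    destruct Hg as (c & <- & Hc). apply completion_linear; auto.
    destruct c as [p a]. unfold glinear in Hl. simpl in *.
    destruct (persistent_sym Sg p); auto; discriminate.
Qed.

Lemma completion_CT : models_CT CT completion.
Proof.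
  intros a Ha v Hv. apply completion_builtins in Hv.
  destruct (HM Ha Hv) as (w & W1 & W2). exists w. split; auto.
  apply completion_builtins. auto.
Qed.

Lemma completion_CP : models_CP CT P completion.
Proof.
  split; [exact completion_CT|]. intros r Hr v [HK HG].
  assert (Hyb := proj1 (Forall_forall _ _) HP r Hr). destruct Hyb as (_ & Hk & Hh).
  apply completion_builtins in HG.
  assert (HK' : holds_store (M := M) v (kept r)).
  { unfold holds_store in *. rewrite Forall_forall in *. intros c Hc.
    apply completion_persistent; auto. }
  split.
  - intros HH. destruct (removed r) as [|c0 l0] eqn:Er.
    + destruct (Hprop r Hr Er HK' HG) as (w & W1 & W2 & W3 & W4).
      exists w. split; auto. rewrite !completion_builtins. split; [|split]; auto.
      destruct W4 as [W4 W5].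
      apply (@completion_store w _ []); [exact W4|]. rewrite app_nil_r. exact W5.
    + rewrite <- Er in *. assert (Hne : removed r <> []) by congruence. clear c0 l0 Er.
      assert (HrS : In r (simplification_rules P)).
      { apply filter_In. split; auto. unfold is_simplification. destruct (removed r); tauto. }
      destruct (@linear_truth_union (map (ginst (M := M) v) (removed r))) as (l & Hl).
      { rewrite Forall_map. unfold holds_store in HH. rewrite Forall_forall in *.
        intros c Hc. apply completion_linear; auto. }
      destruct (fv_rule_bounded r) as [n Bn].
      (* The rest [l] of a true multiset containing the removed head becomes a store [S] over
         variables fresh for the rule, so that the rule can fire beside it. *)
      destruct (realize_atoms l n v) as (S & u & S1 & S2 & S3).
      assert (U : forall x, fv_rule r x -> u x = v x) by auto.
      destruct (fv_head_list r) as (X & HX).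
      assert (Hl' := linear_truth_linear (simplification_rules_spec HP) Hl).
      apply Forall_app in Hl'. destruct Hl' as [_ Hl'].
      (* Stability for the single step that fires the rule. With the head variables global, the
         resulting valuation agrees with [v] on them and is the witness that the reading asks
         for. *)
      assert (T : true_state struth u (St (body_chr r ++ kept r ++ S) (body_builtin r ++ guard r) X)).
      { apply (linear_truth_stable (simplification_rules_spec HP) HM Hconf Hl)
          with (st := St (kept r ++ removed r ++ S) (guard r) X).
        - simpl. apply (holds_builtins_ext (M := M) v); auto. intros x Hx. symmetry.
          apply U, fv_rule_guard, Hx.
        - simpl. rewrite !map_app, !Forall_app. split; [|split].
          + rewrite (ginst_store_ext (M := M) u v).
            * apply Forall_forall. intros g Hg _. apply in_map_iff in Hg.
              destruct Hg as (c & <- & Hc). apply gholds_ginst.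
              unfold holds_store in HK'. rewrite Forall_forall in HK'. auto.
            * intros x Hx. apply U. left; left; auto.
          + apply gtrue_persistent_linear; auto.
          + rewrite S1. revert Hl'. apply Forall_impl. intros g Hg Hg'.
            unfold glinear in Hg. unfold gpers in Hg'. rewrite Hg' in Hg. discriminate.
        - simpl. rewrite !map_app, !filter_app, (glinear_ginst_persistent u Hk),
            (glinear_ginst_linear u Hh), S1. simpl.
          rewrite (forallb_filter_id (glinear (M := M)) l).
          + rewrite (ginst_store_ext (M := M) u v); [apply Permutation_refl|].
            intros x Hx. apply U. left; right; auto.
          + apply forallb_forall. apply Forall_forall. auto.
        - apply steps_step, step_rule_id; auto. intros x Hx. split.
          + intros F. specialize (S3 _ F). assert (x < n) by (apply Bn; right; auto). lia.
          + rewrite HX. apply Hx. }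
      destruct T as (w & W1 & W2 & W3). simpl in *.
      apply holds_builtins_app in W2.
      exists w. split; [|split; [|split]].
      * intros x Hx. rewrite W1 by (apply HX; auto). apply U. left; auto.
      * apply completion_builtins. tauto.
      * apply completion_builtins. tauto.
      * destruct W3 as [W3 W4]. rewrite !map_app, !Forall_app in W3.
        rewrite !map_app, !filter_app, (glinear_ginst_persistent w Hk) in W4.
        eapply completion_store; [tauto|exact W4].
  - intros (w & W1 & W2 & W3 & W4). rewrite completion_builtins in W2, W3.
    apply completion_store_inv in W4. destruct W4 as (W4 & l & W5).
    assert (K : forall S, (forall x, fv_store S x -> fv_head r x) ->
      map (ginst (M := M) v) S = map (ginst (M := M) w) S).
    { intros S HS. apply (ginst_store_ext (M := M)). intros x Hx. symmetry. auto. }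
    destruct (removed r) as [|c0 l0] eqn:Er; [constructor|].
    assert (HrS : In r (simplification_rules P)).
    { apply filter_In. split; auto. unfold is_simplification. rewrite Er. auto. }
    (* Conversely, a true multiset around the body yields one around the removed head by [lt_rule],
       with the same context [l]. *)
    assert (Hl : ltruth (map (ginst (M := M) w) (removed r) ++ l)).
    { eapply lt_rule; eauto. rewrite map_app, Forall_app. split; auto.
      rewrite <- K by (intros x Hx; left; auto).
      rewrite Forall_map. apply Forall_forall. intros c Hc _. apply gholds_ginst.
      unfold holds_store in HK'. rewrite Forall_forall in HK'. auto. }
    rewrite <- Er in *. apply (@completion_store v _ l).
    + apply gtrue_persistent_linear; auto.
    + rewrite (@glinear_ginst_linear Sg M v _ Hh), K; auto. intros x Hx. right; auto.
Qed.

End Completion.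

(** * From the hybrid semantics to satisfiability *)

Section Soundness.
Context {Sg : signature} (CT : theory Sg) (P : program Sg).

Lemma unsat_equiv_bot (s : state Sg) :
  (forall M : structure Sg, models_CT CT M -> forall v : valuation M,
     ~ holds_builtins v (builtins s)) -> equiv_h CT s bot.
Proof.
  intros H. destruct s as [S E X]. simpl in H.
  apply equiv_h_trans with (St [] [BFalse] X).
  - apply equiv_h_unsat; auto. intros M _ v F. inversion F; auto.
  - clear. induction X as [|y X IH]; [apply equiv_h_refl|].
    eapply equiv_h_trans; [|exact IH]. apply equiv_h_sym, equiv_h_of_a_base, ea_global.
    + intros F. inversion F.
    + intros F. inversion F as [? ? F'|? ? F']; inversion F'.
Qed.

(** A state not equivalent to [bot] has satisfiable built-ins. Truth with the constant predicate
    [True] for the store is satisfiability of the built-ins, and it goes backward along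
    derivations. *)
Lemma reaches_consistent (s : state Sg) :
  reaches_persistent CT P s -> exists M : structure Sg, models_CT CT M /\
    exists v : valuation M, true_state (fun _ => True) v s.
Proof.
  intros H. destruct (reaches_steps H) as (t & _ & Hb & Hst).
  destruct (classic (exists M : structure Sg, models_CT CT M /\
    exists v : valuation M, holds_builtins v (builtins t))) as [(M & HM & v & Hv)|N].
  - exists M. split; auto. exists v.
    eapply true_state_steps_backward; [exact HM| | |exact Hst|].
    + split; intros; tauto.
    + intros r w l _ _ _ _. auto.
    + exists v. auto.
  - exfalso. apply Hb, unsat_equiv_bot. intros M HM v Hv. apply N. eauto.
Qed.

Lemma semantics_satisfiable L Q E X :
  hybrid_program P -> confluent CT (simplification_rules P) ->
  hybrid_semantics CT P (St (L ++ Q) E X) -> satisfiable_CP CT P L Q E.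
Proof.
  intros HP Hconf (A & HA & H0).
  set (s0 := St (L ++ Q) E X) in *.
  (* A post-fixed point need not be closed under equivalence; its closure under equivalence is, and
     then also under derivations. *)
  set (R := fun s : state Sg => exists s1, A s1 /\ equiv_h CT s1 s).
  assert (Rs : forall s t, R s -> steps_h CT P s t -> R t).
  { intros s t Hs Hst. induction Hst as [x y [H|H]|x y z _ IH1 _ IH2]; auto.
    - destruct Hs as (s1 & H1 & H2). exists y. split; [|apply equiv_h_refl].
      apply (proj1 (HA s1 H1)). eapply step_equiv; [exact H2|exact H|apply equiv_h_refl].
    - destruct Hs as (s1 & H1 & H2). exists s1. split; auto. eapply equiv_h_trans; eauto. }
  assert (Rc : forall s, R s -> ~ In BFalse (builtins s)).
  { intros s (s1 & H1 & H2) HF.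
    destruct (reaches_consistent (proj2 (HA s1 H1))) as (M & HM & v & Hv).
    apply (true_state_equiv v HM (T := fun _ => True)) with (2 := H2) in Hv.
    - destruct Hv as (w & _ & Hw & _). unfold holds_builtins in Hw.
      rewrite Forall_forall in Hw. exact (Hw _ HF).
    - split; intros; tauto. }
  assert (Rn : forall s, R s -> exists t, purely_persistent t /\
    steps_h CT (simplification_rules P) s t).
  { intros s (s1 & H1 & H2).
    destruct (reaches_steps (proj2 (HA s1 H1))) as (t & Ht & _ & Hst).
    exists t. split; auto. eapply steps_trans; [|exact Hst].
    apply steps_equiv, equiv_h_sym, H2. }
  assert (R0 : R s0) by (exists s0; split; [auto|apply equiv_h_refl]).
  destruct (Rn s0 R0) as (t0 & Ht0 & Hst0).
  assert (Rt0 : R t0).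
  { eapply Rs; [exact R0|]. eapply steps_mono; [apply simplification_rules_incl|exact Hst0]. }
  destruct (fv_store_bounded (store t0)) as [n1 B1], (fv_builtins_bounded (builtins t0)) as [n2 B2],
    (globals_bounded (globals t0)) as [n3 B3].
  (* The final 1 provides the name [Base 0] even if [t0] has no variables; it is the default name
     and makes the domain inhabited. *)
  set (m0 := n1 + n2 + n3 + 1).
  assert (Hm0 : 0 < m0) by (unfold m0; lia).
  assert (Bt0 : forall x, fv_state t0 x \/ In x (globals t0) -> x < m0).
  { unfold m0. intros x [[H|H]|H];
      [specialize (B1 _ H)|specialize (B2 _ H)|specialize (B3 _ H)]; lia. }
  set (M0 := chase_model CT P t0 Hm0).
  assert (HM0 : models_CT CT M0) by (apply (@chase_model_CT Sg CT P R); auto).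
  assert (Hprop := @chase_model_propagation Sg CT P R Rs Rc t0 m0 Ht0 Rt0 Hm0 Bt0 HP Rn).
  exists (completion P M0). split.
  - apply completion_CP; auto.
  - set (L0 := fun x => base_names_fact CT P t0 Hm0 x).
    set (u0 := classes Hm0 L0).
    assert (T0 : true_state (store_truth (simplification_rules P) (M := M0)) u0 t0).
    { exists u0. split; [|split]; auto.
      - unfold holds_builtins. apply Forall_forall. intros b Hb.
        apply (@holds_builtin_classes Sg CT P R); auto. apply fact_base_builtin; auto.
      - apply store_truth_persistent; [exact Ht0|]. intros c Hc.
        apply holds_chr_classes; auto.
        + unfold purely_persistent in Ht0. rewrite Forall_forall in Ht0. auto.
        + apply fact_base_chr; auto. }
    (* Truth of the normal form [t0] goes back to the original state, whose linear constraints
       thereby form a true multiset with empty context. *)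
    eapply true_state_steps_backward in T0; [|exact HM0|apply store_truth_multiset
      |apply store_truth_backward, simplification_rules_spec, HP|exact Hst0].
    destruct T0 as (w & _ & W1 & W2 & W3). exists w. simpl in W1, W2, W3.
    assert (K : @holds_store Sg (completion P M0) w (L ++ Q)).
    { apply (@completion_store Sg P M0 w (L ++ Q) []); auto. rewrite app_nil_r. auto. }
    apply Forall_app in K. split; [|split]; try apply K.
    apply completion_builtins. auto.
Qed.

End Soundness.

Theorem theorem3 (Sg : signature) (CT : theory Sg) (P : program Sg)
  (L Q : list (chr Sg)) (E : list (builtin Sg)) (X : list var) :
  hybrid_program P ->
  confluent CT (simplification_rules P) ->
  Forall linear L ->
  Forall persistent Q ->
  data_sufficient CT P (St (L ++ Q) E X) ->
  (hybrid_semantics CT P (St (L ++ Q) E X) <-> satisfiable_CP CT P L Q E).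
Proof.
  intros HP Hconf _ _ Hd. split.
  - apply semantics_satisfiable; auto.
  - apply satisfiable_in_semantics; auto.
Qed.
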